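(* Suppose that $\sigma$ is independent of $y$ and $z$ and that $(b,\sigma,g,\phi)$ satisfies the Lipschitz condition. Then there exists at most one viscosity solution of $$\partial_tW(t,x)+\inf_{u\in U}H(t,x,W(t,x),DW(t,x),D^2W(t,x),u)=0,\qquad W(T,x)=\phi(x),$$ in the class of continuous functions on $[0,T]\times\mathbb{R}^n$ which are Lipschitz continuous with respect to $x$, where $$H(t,x,v,p,A,u)=\tfrac12\mathrm{tr}[\sigma\sigma^{\intercal}(t,x,u)A]+p^{\intercal}b(t,x,v,p^{\intercal}\sigma(t,x,u),u)+g(t,x,v,p^{\intercal}\sigma(t,x,u),u)$$ for $(t,x,v,p,A,u)\in[0,T]\times\mathbb{R}^n\times\mathbb{R}\times\mathbb{R}^n\times\mathbb{S}^n\times U$.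
   Context: Fix $T>0$, positive integers $n,d,k$ and a nonempty compact set $U\subset\mathbb{R}^k$. The coefficients are deterministic functions $b:[0,T]\times\mathbb{R}^n\times\mathbb{R}\times\mathbb{R}^{1\times d}\times U\to\mathbb{R}^n$, $\sigma:[0,T]\times\mathbb{R}^n\times U\to\mathbb{R}^{n\times d}$ (independent of $y,z$), $g:[0,T]\times\mathbb{R}^n\times\mathbb{R}\times\mathbb{R}^{1\times d}\times U\to\mathbb{R}$ and $\phi:\mathbb{R}^n\to\mathbb{R}$. $\mathbb{S}^n$ is the set of symmetric $n\times n$ matrices; $D$, $D^2$ denote gradient and Hessian in $x$. Lipschitz condition: $b,\sigma,g,\phi$ are continuous in all their arguments and there are constants $L_1,L_2>0$ such that for all $s\in[0,T]$, $u\in U$ and all $(x_i,y_i,z_i)$, $i=1,2$: $|b(s,x_1,y_1,z_1,u)-b(s,x_2,y_2,z_2,u)|\le L_1|x_1-x_2|+L_2(|y_1-y_2|+|z_1-z_2|)$; $|\sigma(s,x_1,u)-\sigma(s,x_2,u)|\le L_1|x_1-x_2|$; $|g(s,x_1,y_1,z_1,u)-g(s,x_2,y_2,z_2,u)|\le L_1(|x_1-x_2|+|y_1-y_2|+|z_1-z_2|)$; $|\phi(x_1)-\phi(x_2)|\le L_1|x_1-x_2|$. ''Lipschitz continuous with respect to $x$'' means with a Lipschitz constant not depending on $t$. Viscosity solution. $C_b^{2,3}([0,T]\times\mathbb{R}^n)$ is the space of functions with continuous and bounded partial derivatives up to order $2$ in $t$ and $3$ in $x$. $W\in C([0,T]\times\mathbb{R}^n)$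 is a viscosity subsolution (resp. supersolution) if $W(T,x)\le\phi(x)$ (resp. $\ge$) for all $x$ and, for every $\varphi\in C_b^{2,3}([0,T]\times\mathbb{R}^n)$ such that $W(t,x)=\varphi(t,x)$ and $W-\varphi$ attains a local maximum (resp. minimum) at $(t,x)\in[0,T)\times\mathbb{R}^n$, one has $\partial_t\varphi(t,x)+\inf_{u\in U}H(t,x,\varphi(t,x),D\varphi(t,x),D^2\varphi(t,x),u)\ge0$ (resp. $\le0$). A viscosity solution is both a subsolution and a supersolution. *)

(* Defs.v *)
From HB Require Import structures.
From mathcomp Require Import all_boot all_order all_algebra.
From mathcomp Require Import all_classical all_reals all_analysis.

Set Implicit Arguments.
Unset Strict Implicit.
Unset Printing Implicit Defensive.

Import Order.TTheory GRing.Theory Num.Theory.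
Import numFieldNormedType.Exports.

Local Open Scope classical_set_scope.
Local Open Scope ring_scope.

(* Functions of (t, x) on [0,T] x R^n are represented by total functions
   R -> 'cV[R]_n -> R; every notion below only depends on their values at
   times t in [0,T]. *)

(* Euclidean norm on vectors, Frobenius norm on matrices (the library norm
   `|A| on matrices is the sup norm). *)
Definition enorm (R : realType) (m n : nat) (A : 'M[R]_(m, n)) : R :=
  Num.sqrt (\sum_i \sum_j A i j ^+ 2).

Definition strip (R : realType) (n : nat) (T : R) : set (R * 'cV[R]_n) :=
  [set q | 0 <= q.1 <= T].

Definition continuous_strip (R : realType) (n : nat) (T : R)
    (f : R -> 'cV[R]_n -> R) : Prop :=
  {within @strip R n T, continuous (fun q : R * 'cV[R]_n => f q.1 q.2)}.

Definition bounded_strip (R : realType) (n : nat) (T : R)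
    (f : R -> 'cV[R]_n -> R) : Prop :=
  exists M : R, forall t x, 0 <= t <= T -> `|f t x| <= M.

Definition lipschitz_in_x (R : realType) (n : nat) (T : R)
    (W : R -> 'cV[R]_n -> R) : Prop :=
  exists L : R, forall t x1 x2, 0 <= t <= T ->
    `|W t x1 - W t x2| <= L * enorm (x1 - x2).

Section Coefficients.
Context (R : realType) (n d k : nat) (T : R) (U : set 'cV[R]_k).
Context (b : R -> 'cV[R]_n -> R -> 'rV[R]_d -> 'cV[R]_k -> 'cV[R]_n).
Context (sigma : R -> 'cV[R]_n -> 'cV[R]_k -> 'M[R]_(n, d)).
Context (g : R -> 'cV[R]_n -> R -> 'rV[R]_d -> 'cV[R]_k -> R).
Context (phi : 'cV[R]_n -> R).

Definition continuous_coefficients : Prop :=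
  [/\ {within [set q : R * 'cV[R]_n * R * 'rV[R]_d * 'cV[R]_k |
               0 <= q.1.1.1.1 <= T /\ U q.2],
         continuous (fun q => b q.1.1.1.1 q.1.1.1.2 q.1.1.2 q.1.2 q.2)},
      {within [set q : R * 'cV[R]_n * 'cV[R]_k | 0 <= q.1.1 <= T /\ U q.2],
         continuous (fun q => sigma q.1.1 q.1.2 q.2)},
      {within [set q : R * 'cV[R]_n * R * 'rV[R]_d * 'cV[R]_k |
               0 <= q.1.1.1.1 <= T /\ U q.2],
         continuous (fun q => g q.1.1.1.1 q.1.1.1.2 q.1.1.2 q.1.2 q.2)}
    & continuous phi].

Definition lipschitz_condition : Prop :=
  continuous_coefficients /\
  exists L1 L2 : R, 0 < L1 /\ 0 < L2 /\
    forall (s : R) (u : 'cV[R]_k), 0 <= s <= T -> U u ->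
    forall (x1 x2 : 'cV[R]_n) (y1 y2 : R) (z1 z2 : 'rV[R]_d),
    [/\ enorm (b s x1 y1 z1 u - b s x2 y2 z2 u)
          <= L1 * enorm (x1 - x2) + L2 * (`|y1 - y2| + enorm (z1 - z2)),
        enorm (sigma s x1 u - sigma s x2 u) <= L1 * enorm (x1 - x2),
        `|g s x1 y1 z1 u - g s x2 y2 z2 u|
          <= L1 * (enorm (x1 - x2) + `|y1 - y2| + enorm (z1 - z2))
      & `|phi x1 - phi x2| <= L1 * enorm (x1 - x2)].

Definition hamiltonian (t : R) (x : 'cV[R]_n) (v : R) (p : 'cV[R]_n)
    (A : 'M[R]_n) (u : 'cV[R]_k) : R :=
  2^-1 * \tr (sigma t x u *m (sigma t x u)^T *m A)
  + (p^T *m b t x v (p^T *m sigma t x u) u) 0 0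
  + g t x v (p^T *m sigma t x u) u.

End Coefficients.

Section TestFunctions.
Context (R : realType) (n : nat) (T : R).
Implicit Types (f : R -> 'cV[R]_n -> R) (s : seq (option 'I_n)).

(* Increments h for which t + h stays in [0,T]: the time derivative is
   two-sided inside ]0,T[ and one-sided at the end points. *)
Definition time_increments (t : R) : set_system R :=
  within [set h | 0 <= t + h <= T] (0 : R)^'.

Definition time_quotient f (t : R) (x : 'cV[R]_n) (h : R) : R :=
  h^-1 * (f (t + h) x - f t x).

Definition unit_vec (i : 'I_n) : 'cV[R]_n := delta_mx i 0.

(* Direction None is t, direction Some i is x_i. *)
Definition has_partial (i : option 'I_n) f (t : R) (x : 'cV[R]_n) : Prop :=
  match i with
  | None => cvg (time_quotient f t x @ time_increments t)
  | Some j => derivable (f t) x (unit_vec j)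
  end.

Definition partial (i : option 'I_n) f (t : R) (x : 'cV[R]_n) : R :=
  match i with
  | None => lim (time_quotient f t x @ time_increments t)
  | Some j => 'D_(unit_vec j) (f t) x
  end.

Definition iter_partial s f : R -> 'cV[R]_n -> R := foldr partial f s.

Definition order23 s : bool :=
  (count (pred1 None) s <= 2)%N && (count isSome s <= 3)%N.

(* All partial derivatives, mixed ones included and in any order of
   differentiation, of order at most 2 in t and at most 3 in x, exist and are
   continuous and bounded on [0,T] x R^n. *)
Definition Cb23 f : Prop :=
  forall s, order23 s ->
    [/\ continuous_strip T (iter_partial s f),
        bounded_strip T (iter_partial s f)
      & forall i, order23 (i :: s) ->
        forall t x, 0 <= t <= T -> has_partial i (iter_partial s f) t x].

Definition gradient f (t : R) (x : 'cV[R]_n) : 'cV[R]_n :=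
  \col_i partial (Some i) f t x.

Definition hessian f (t : R) (x : 'cV[R]_n) : 'M[R]_n :=
  \matrix_(i, j) partial (Some i) (partial (Some j) f) t x.

Definition local_max_strip f (t : R) (x : 'cV[R]_n) : Prop :=
  \forall q \near within (@strip R n T) (nbhs (t, x)), f q.1 q.2 <= f t x.

Definition local_min_strip f (t : R) (x : 'cV[R]_n) : Prop :=
  \forall q \near within (@strip R n T) (nbhs (t, x)), f t x <= f q.1 q.2.

End TestFunctions.

Section Viscosity.
Context (R : realType) (n d k : nat) (T : R) (U : set 'cV[R]_k).
Context (b : R -> 'cV[R]_n -> R -> 'rV[R]_d -> 'cV[R]_k -> 'cV[R]_n).
Context (sigma : R -> 'cV[R]_n -> 'cV[R]_k -> 'M[R]_(n, d)).
Context (g : R -> 'cV[R]_n -> R -> 'rV[R]_d -> 'cV[R]_k -> R).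
Context (phi : 'cV[R]_n -> R).
Implicit Types (W psi : R -> 'cV[R]_n -> R).

Definition hjb_lhs psi (t : R) (x : 'cV[R]_n) : R :=
  partial T None psi t x +
  inf [set hamiltonian b sigma g t x (psi t x)
             (gradient T psi t x) (hessian T psi t x) u | u in U].

Definition viscosity_subsolution W : Prop :=
  [/\ continuous_strip T W,
      (forall x, W T x <= phi x)
    & forall psi, Cb23 T psi -> forall t x, 0 <= t < T ->
        W t x = psi t x ->
        local_max_strip T (fun t' x' => W t' x' - psi t' x') t x ->
        0 <= hjb_lhs psi t x].

Definition viscosity_supersolution W : Prop :=
  [/\ continuous_strip T W,
      (forall x, phi x <= W T x)
    & forall psi, Cb23 T psi -> forall t x, 0 <= t < T ->
        W t x = psi t x ->
        local_min_strip T (fun t' x' => W t' x' - psi t' x') t x ->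
        hjb_lhs psi t x <= 0].

Definition viscosity_solution W : Prop :=
  viscosity_subsolution W /\ viscosity_supersolution W.

End Viscosity.

(* Main.v *)
(* Let W1 be a subsolution, W2 a supersolution, and V1, V2 the sup-convolutions
   in x of W1 and of - W2. If W1 > W2 somewhere, then for a large rate lambda the
   quotient of V1 + V2 by exp(lambda (T - t)) (1 + |x|^2) has a maximum alpha > 0,
   attained at some (th, xh) with th < T. Paraboloids touch V1 and V2 from below
   everywhere and, by maximality, from above at (th, xh), so the slopes at nearby
   points differ from those at (th, xh) by a small constant plus O(|x - xh|^2) in
   square. Hence the jets of V1 and V2 satisfy, for t close to th, the two
   inequalities with the coefficients frozen at (th, xh), up to a small constant
   plus O(|x - xh|^2).

   With frozen coefficients no theorem on sums is needed. For each control, V1 is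
   a subsolution of a heat equation with constant coefficients; a random walk with
   steps along the columns of sigma gives V1(t, x) <= E V1(t + h, x + walk) + c h,
   and this passes to spatial averages of V1, which have second order expansions
   with uniform remainders. These expansions are barriers for V2, which is pushed
   back by h through a touching argument; there the second order terms of V1 and V2
   cancel, control by control. Iterating over small steps from th + h0 down to th
   bounds (V1 + V2)(th, xh) by A (1 + |xh|^2) (1 + K h0), up to small errors, where
   A = alpha exp(lambda (T - th - h0)) and K does not depend on lambda. For lambda
   large this contradicts (V1 + V2)(th, xh) = A exp(lambda h0) (1 + |xh|^2). *)

Require Import Defs.
From mathcomp Require Import all_boot all_order all_algebra.
From mathcomp Require Import all_classical all_reals all_analysis.
From mathcomp Require Import ring lra.

Set Implicit Arguments.
Unset Strict Implicit.
Unset Printing Implicit Defensive.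

Import Order.TTheory GRing.Theory Num.Theory.
Import numFieldNormedType.Exports.

Local Open Scope classical_set_scope.
Local Open Scope ring_scope.

(** * Frobenius inner product and quadratic forms *)

(** The classical proof doubles the variables and relies on the theorem on sums, hence on
    Alexandrov's theorem and Jensen's lemma. Freezing replaces this: what remains is an extremum
    over controls of linear operators with constant coefficients. The quantifiers then fit. A
    subsolution satisfies the inequality for every control, so each control has its own mean value
    inequality; a supersolution satisfies it for some unknown control, and a barrier that is good
    for all controls is enough. Lipschitz continuity in x bounds the slopes of the sup-convolutions,
    which tames the product of p with b(t, x, v, p sigma). The weight 1 + |x|^2 matches the linear
    growth of b and sigma. This is harmless: the constants are fixed in the order lambda, eps, this
    factor [ce], and then h0 with [ce * h0] small, while the part of the error without |x - xh|^2 is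
    O(eps) plus an arbitrarily small constant. *)

Section Frobenius.
Context (R : realType).

Definition fdot (m n : nat) (A B : 'M[R]_(m, n)) : R :=
  \sum_i \sum_j A i j * B i j.

Section FrobeniusTheory.
Context (m n : nat).
Implicit Types (A B C : 'M[R]_(m, n)) (c : R).

Lemma fdotC A B : fdot A B = fdot B A.
Proof. by apply: eq_bigr => i _; apply: eq_bigr => j _; rewrite mulrC. Qed.

Lemma fdotDl A B C : fdot (A + B) C = fdot A C + fdot B C.
Proof.
rewrite /fdot -big_split; apply: eq_bigr => i _; rewrite -big_split.
by apply: eq_bigr => j _; rewrite mxE mulrDl.
Qed.

Lemma fdotZl c A B : fdot (c *: A) B = c * fdot A B.
Proof.
rewrite /fdot mulr_sumr; apply: eq_bigr => i _; rewrite mulr_sumr.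
by apply: eq_bigr => j _; rewrite mxE mulrA.
Qed.

Lemma fdotNl A B : fdot (- A) B = - fdot A B.
Proof. by rewrite -scaleN1r fdotZl mulN1r. Qed.

Lemma fdotBl A B C : fdot (A - B) C = fdot A C - fdot B C.
Proof. by rewrite fdotDl fdotNl. Qed.

Lemma fdotDr A B C : fdot A (B + C) = fdot A B + fdot A C.
Proof. by rewrite fdotC fdotDl !(fdotC A). Qed.

Lemma fdotZr c A B : fdot A (c *: B) = c * fdot A B.
Proof. by rewrite fdotC fdotZl fdotC. Qed.

Lemma fdotNr A B : fdot A (- B) = - fdot A B.
Proof. by rewrite fdotC fdotNl fdotC. Qed.

Lemma fdotBr A B C : fdot A (B - C) = fdot A B - fdot A C.
Proof. by rewrite fdotDr fdotNr. Qed.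

Lemma fdot0l A : fdot 0 A = 0.
Proof. by rewrite -(scale0r 0) fdotZl mul0r. Qed.

Lemma fdot0r A : fdot A 0 = 0. Proof. by rewrite fdotC fdot0l. Qed.

Lemma fdot_ge0 A : 0 <= fdot A A.
Proof. by apply: sumr_ge0 => i _; apply: sumr_ge0 => j _; rewrite -expr2 sqr_ge0. Qed.

Definition fdotE := (fdotDl, fdotDr, fdotNl, fdotNr, fdotZl, fdotZr, fdot0l, fdot0r).

Lemma fdot_eq0 A : fdot A A = 0 -> A = 0.
Proof.
move=> /eqP; rewrite psumr_eq0; last first.
  by move=> i _; apply: sumr_ge0 => j _; rewrite -expr2 sqr_ge0.
move=> /allP h; apply/matrixP => i j; rewrite mxE.
have := h i; rewrite mem_index_enum => /(_ isT)/=.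
rewrite psumr_eq0; last by move=> k _; rewrite -expr2 sqr_ge0.
move=> /allP/(_ j); rewrite mem_index_enum => /(_ isT)/=.
by rewrite -expr2 sqrf_eq0 => /eqP.
Qed.

Lemma fdot_CS A B : fdot A B ^+ 2 <= fdot A A * fdot B B.
Proof.
have [B0|B0] := eqVneq (fdot B B) 0.
  by rewrite (fdot_eq0 B0) !fdotE expr0n mulr0.
have Bgt : 0 < fdot B B by rewrite lt_def B0 fdot_ge0.
have := fdot_ge0 (fdot B B *: A - fdot A B *: B).
rewrite !fdotE (fdotC B A) => h.
rewrite -subr_ge0 -(pmulr_rge0 _ Bgt); apply: le_trans h _.
by rewrite le_eqVlt; apply/orP; left; apply/eqP; ring.
Qed.

Lemma enorm_sqr A : enorm A ^+ 2 = fdot A A.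
Proof.
rewrite /enorm; under eq_bigr do under eq_bigr do rewrite expr2.
by rewrite sqr_sqrtr // fdot_ge0.
Qed.

Lemma enormE A : enorm A = Num.sqrt (fdot A A).
Proof. by rewrite -enorm_sqr sqrtr_sqr ger0_norm // sqrtr_ge0. Qed.

Lemma enorm_ge0 A : 0 <= enorm A. Proof. exact: sqrtr_ge0. Qed.

Lemma fdot_le_enorm A B : `|fdot A B| <= enorm A * enorm B.
Proof.
rewrite -ler_sqr ?nnegrE ?mulr_ge0 ?enorm_ge0 //.
by rewrite real_normK ?num_real // exprMn !enorm_sqr fdot_CS.
Qed.

Lemma enormD A B : enorm (A + B) <= enorm A + enorm B.
Proof.
rewrite -ler_sqr ?nnegrE ?addr_ge0 ?enorm_ge0 //.
rewrite enorm_sqr !fdotE (fdotC B A) sqrrD !enorm_sqr.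
have := fdot_le_enorm A B; rewrite ler_norml => /andP[_]; lra.
Qed.

Lemma enormZ c A : enorm (c *: A) = `|c| * enorm A.
Proof. by rewrite !enormE !fdotE mulrA -expr2 sqrtrM ?sqr_ge0 // sqrtr_sqr. Qed.

Lemma enormN A : enorm (- A) = enorm A.
Proof. by rewrite -scaleN1r enormZ normrN1 mul1r. Qed.

Lemma enormB A B : enorm (A - B) = enorm (B - A).
Proof. by rewrite -enormN opprB. Qed.

Lemma enorm0 : enorm (0 : 'M[R]_(m, n)) = 0.
Proof. by rewrite enormE fdot0l sqrtr0. Qed.

Lemma enorm_le A c : 0 <= c -> fdot A A <= c ^+ 2 -> enorm A <= c.
Proof. by move=> c0; rewrite -enorm_sqr ler_sqr ?nnegrE ?enorm_ge0. Qed.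

Lemma enorm_leP A c : 0 <= c -> (enorm A <= c) = (fdot A A <= c ^+ 2).
Proof. by move=> c0; rewrite -enorm_sqr ler_sqr ?nnegrE ?enorm_ge0. Qed.

Lemma normr_coord_le A i j : `|A i j| <= enorm A.
Proof.
rewrite -ler_sqr ?nnegrE ?enorm_ge0 // real_normK ?num_real // enorm_sqr.
rewrite /fdot (bigD1 i) //= (bigD1 j) //= -expr2 -addrA lerDl addr_ge0 //.
  by apply: sumr_ge0 => k _; rewrite -expr2 sqr_ge0.
by apply: sumr_ge0 => k _; apply: sumr_ge0 => l _; rewrite -expr2 sqr_ge0.
Qed.

Lemma fdot_sqrD_le A B : fdot (A + B) (A + B) <= 2 * fdot A A + 2 * fdot B B.
Proof. by have := fdot_ge0 (A - B); rewrite !fdotE (fdotC B A); lra. Qed.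

End FrobeniusTheory.

Lemma enorm_mulmx (m n p : nat) (A : 'M[R]_(m, n)) (B : 'M[R]_(n, p)) :
  enorm (A *m B) <= enorm A * enorm B.
Proof.
apply: enorm_le; first by rewrite mulr_ge0 ?enorm_ge0.
rewrite exprMn !enorm_sqr /fdot mulr_suml; apply: ler_sum => i _.
rewrite [X in _ * X](exchange_big) /= mulr_sumr.
apply: ler_sum => j _; rewrite -expr2 mxE.
have rE (u v : 'I_n -> R) :
    \sum_k u k * v k = fdot (\row_k u k) (\row_k v k).
  by rewrite /fdot big_ord1; apply: eq_bigr => k _; rewrite !mxE.
by rewrite !rE fdot_CS.
Qed.

Lemma enorm_trmx (m n : nat) (A : 'M[R]_(m, n)) : enorm A^T = enorm A.
Proof.
rewrite !enormE; congr Num.sqrt; rewrite /fdot exchange_big.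
by apply: eq_bigr => i _; apply: eq_bigr => j _; rewrite !mxE.
Qed.

Lemma fdot_cV (n : nat) (u v : 'cV[R]_n) : fdot u v = (u^T *m v) 0 0.
Proof. by rewrite mxE; apply: eq_bigr => i _; rewrite big_ord1 mxE. Qed.

Lemma fdot_cVE (n : nat) (u v : 'cV[R]_n) : fdot u v = \sum_i u i 0 * v i 0.
Proof. by apply: eq_bigr => i _; rewrite big_ord1. Qed.

Lemma fdot_mulmxl (n m : nat) (M : 'M[R]_(n, m)) (u : 'cV[R]_m) (v : 'cV[R]_n) :
  fdot (M *m u) v = fdot u (M^T *m v).
Proof. by rewrite !fdot_cV trmx_mul mulmxA. Qed.

Section Quad.
Context (n : nat).
Implicit Types (X Y : 'M[R]_n) (v w : 'cV[R]_n) (c : R).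

Definition quad X v : R := fdot v (X *m v).

Lemma quadD X Y v : quad (X + Y) v = quad X v + quad Y v.
Proof. by rewrite /quad mulmxDl fdotDr. Qed.

Lemma quadZ c X v : quad (c *: X) v = c * quad X v.
Proof. by rewrite /quad -scalemxAl fdotZr. Qed.

Lemma quadN X v : quad (- X) v = - quad X v.
Proof. by rewrite /quad mulNmx fdotNr. Qed.

Lemma quad_scalar c v : quad c%:M v = c * fdot v v.
Proof. by rewrite /quad mul_scalar_mx fdotZr. Qed.

Lemma quad_scale X c v : quad X (c *: v) = c ^+ 2 * quad X v.
Proof. by rewrite /quad -scalemxAr !fdotE mulrA. Qed.

Lemma quad_add X v w :
  quad X (v + w) = quad X v + fdot v (X *m w) + fdot w (X *m v) + quad X w.
Proof. by rewrite /quad mulmxDr !fdotE; ring. Qed.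

Lemma quad_outer v w : quad (v *m v^T) w = fdot v w ^+ 2.
Proof.
rewrite /quad -mulmxA [v^T *m w]mx11_scalar mul_mx_scalar fdotZr.
by rewrite -fdot_cV (fdotC w v) expr2.
Qed.

Lemma quad_tr X v : quad X^T v = quad X v.
Proof. by rewrite /quad fdotC fdot_mulmxl trmxK. Qed.

Lemma quadE X v : quad X v = \sum_i \sum_j X i j * v i 0 * v j 0.
Proof.
rewrite /quad fdot_cVE; apply: eq_bigr => i _; rewrite mxE mulr_sumr.
by apply: eq_bigr => j _; ring.
Qed.

(** The second order term thus only sees second derivatives along the columns of sigma, which are
    the steps of the random walk. *)
Lemma mxtrace_quad (d : nat) (s : 'M[R]_(n, d)) X :
  \tr (s *m s^T *m X) = \sum_j quad X (col j s).
Proof.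
rewrite -mulmxA mxtrace_mulC /mxtrace; apply: eq_bigr => j _.
rewrite /quad fdot_cV tr_col mulmxA -row_mul [LHS]mxE [RHS]mxE.
by apply: eq_bigr => k _; rewrite [in RHS]mxE [col _ _ _ _]mxE.
Qed.

End Quad.

Lemma sum_fdot_col (m n : nat) (s : 'M[R]_(n, m)) :
  \sum_j fdot (col j s) (col j s) = fdot s s.
Proof.
rewrite /fdot exchange_big; apply: eq_bigr => i _; apply: eq_bigr => j _.
by rewrite big_ord1 !mxE.
Qed.

(** At a small multiple of z the left side is of first order and the right side of second order.
    Used to identify slopes of functions squeezed between paraboloids. *)
Lemma fdot_linear_eq0 (n : nat) (z : 'cV[R]_n) (K : R) :
  (forall v, fdot z v <= K * fdot v v) -> z = 0.
Proof.
move=> h; apply: fdot_eq0; apply/eqP; rewrite eq_le fdot_ge0 andbT.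
rewrite leNgt; apply/negP => z0.
pose e := (2 * (`|K| + 1))^-1.
have K1 : 0 < `|K| + 1 by rewrite ltr_wpDl.
have e0 : 0 < e by rewrite invr_gt0 mulr_gt0.
have := h (e *: z); rewrite !fdotE.
have Ke : K * e <= 2^-1.
  have -> : 2^-1 = (`|K| + 1) * e by rewrite /e invfM mulrCA divff ?mulr1 // gt_eqF.
  rewrite ler_wpM2r ?ltW //; have := ler_norm K; lra.
have : 0 < e * fdot z z by rewrite mulr_gt0.
nra.
Qed.

End Frobenius.

Lemma continuous_sumr (R : realType) (S : topologicalType) (I : Type) (r : seq I)
    (P : pred I) (F : I -> S -> R) :
  (forall i, continuous (F i)) -> continuous (fun x => \sum_(i <- r | P i) F i x).
Proof.
move=> cF; elim: r => [|i r IH] x.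
  by under eq_fun do rewrite big_nil; exact: cvg_cst.
under eq_fun do rewrite big_cons; case: ifP => _; last exact: IH.
by apply: cvgD; [exact: cF | exact: IH].
Qed.

(** * Averages over unit intervals *)

Section Mean.
Context (R : realType).
Implicit Types (phi psi : R -> R).
Local Notation mu := lebesgue_measure.

(** The base point -2 leaves room to translate the unit interval by any h with |h| <= 1:
    differentiability is needed on [-1, 2]. *)
Definition antider phi (x : R) : R := parameterized_integral mu (-2) x phi.

Definition mean phi : R := antider phi 1 - antider phi 0.

Lemma antider_derive phi (x : R) : continuous phi -> -2 < x < 3 ->
  is_derive (x : R) (1 : R) (antider phi) (phi x).
Proof.
move=> cphi /andP[x2 x3].
have iphi : mu.-integrable `[(-2 : R), 3] (EFin \o phi).
  apply: continuous_compact_integrable; first exact: segment_compact.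
  exact: continuous_subspaceT.
have [dF F'] : derivable (antider phi) x 1 /\ derive1 (antider phi) x = phi x.
  exact: (@continuous_FTC1_closed R phi (-2) x 3 x3 iphi x2 (cphi x)).
by apply: (DeriveDef dF); rewrite -derive1E.
Qed.

Lemma derive_cts (F : R -> R) f (a b : R) :
  (forall x : R, a <= x <= b -> is_derive (x : R) (1 : R) F (f x)) ->
  {within `[a, b], continuous F}.
Proof.
move=> dF; apply/continuous_in_subspaceT => x /set_mem /=.
rewrite in_itv/= => /dF [dF1 _].
by apply: differentiable_continuous; apply/derivable1_diffP.
Qed.

(** By the mean value theorem for F minus the antiderivative. Together with its mirror image this
    yields [meanE], from which linearity and translation follow without further integration
    theory. *)
Lemma mean_le_diff phi (F : R -> R) : continuous phi ->
  forall f, (forall x : R, 0 <= x <= 1 -> is_derive (x : R) (1 : R) F (f x)) ->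
  (forall x : R, 0 <= x <= 1 -> phi x <= f x) ->
  mean phi <= F 1 - F 0.
Proof.
move=> cphi f dF le_f.
pose G x := F x - antider phi x.
have dG x : 0 <= x <= 1 -> is_derive (x : R) (1 : R) G (f x - phi x).
  move=> x01; have dFx := dF _ x01.
  have dAx : is_derive (x : R) (1 : R) (antider phi) (phi x).
    by apply: antider_derive => //; lra.
  exact: is_deriveB.
have [x||c] := @MVT_segment R G (fun x => f x - phi x) 0 1 ler01.
- by rewrite in_itv/= => /andP[? ?]; apply: dG; lra.
- exact: derive_cts dG.
rewrite in_itv/= => /le_f ?; rewrite /G /mean; lra.
Qed.

Lemma mean_ge_diff phi (F : R -> R) : continuous phi ->
  forall f, (forall x : R, 0 <= x <= 1 -> is_derive (x : R) (1 : R) F (f x)) ->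
  (forall x : R, 0 <= x <= 1 -> f x <= phi x) ->
  F 1 - F 0 <= mean phi.
Proof.
move=> cphi f dF le_f.
pose G x := F x - antider phi x.
have dG x : 0 <= x <= 1 -> is_derive (x : R) (1 : R) G (f x - phi x).
  move=> x01; have dFx := dF _ x01.
  have dAx : is_derive (x : R) (1 : R) (antider phi) (phi x).
    by apply: antider_derive => //; lra.
  exact: is_deriveB.
have [x||c] := @MVT_segment R G (fun x => f x - phi x) 0 1 ler01.
- by rewrite in_itv/= => /andP[? ?]; apply: dG; lra.
- exact: derive_cts dG.
rewrite in_itv/= => /le_f ?; rewrite /G /mean; lra.
Qed.

Lemma meanE phi (F : R -> R) : continuous phi ->
  (forall x : R, 0 <= x <= 1 -> is_derive (x : R) (1 : R) F (phi x)) ->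
  mean phi = F 1 - F 0.
Proof.
move=> cphi dF; apply/eqP; rewrite eq_le.
by rewrite (mean_le_diff cphi dF) ?(mean_ge_diff cphi dF).
Qed.

Lemma mean_le phi psi : continuous phi -> continuous psi ->
  (forall x, 0 <= x <= 1 -> phi x <= psi x) -> mean phi <= mean psi.
Proof.
move=> cphi cpsi; apply: mean_le_diff => // x ?.
by apply: antider_derive => //; lra.
Qed.

Lemma meanD phi psi : continuous phi -> continuous psi ->
  mean (fun x => phi x + psi x) = mean phi + mean psi.
Proof.
move=> cphi cpsi; pose F x := antider phi x + antider psi x.
have cf : continuous (fun x => phi x + psi x).
  by move=> x; apply: cvgD; [exact: cphi | exact: cpsi].
have dF (x : R) : 0 <= x <= 1 -> is_derive x (1 : R) F (phi x + psi x).
  move=> x01.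
  have dA : is_derive x (1 : R) (antider phi) (phi x).
    by apply: antider_derive => //; lra.
  have dB : is_derive x (1 : R) (antider psi) (psi x).
    by apply: antider_derive => //; lra.
  exact: is_deriveD.
by rewrite (meanE cf dF) /F /mean; lra.
Qed.

Lemma meanZ c phi : continuous phi -> mean (fun x => c * phi x) = c * mean phi.
Proof.
move=> cphi; pose F x := c * antider phi x.
have cf : continuous (fun x => c * phi x).
  by move=> x; apply: cvgM; [exact: cvg_cst | exact: cphi].
have dF (x : R) : 0 <= x <= 1 -> is_derive x (1 : R) F (c * phi x).
  move=> x01.
  have dA : is_derive x (1 : R) (antider phi) (phi x).
    by apply: antider_derive => //; lra.
  exact: (@is_deriveZ _ _ _ (antider phi)).
by rewrite (meanE cf dF) /F /mean; lra.
Qed.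

Lemma mean_cst c : mean (fun _ => c) = c.
Proof.
have cf : continuous (fun _ : R => c) by move=> x; exact: cvg_cst.
have dF (x : R) : 0 <= x <= 1 -> is_derive x (1 : R) (fun x => c * x) c.
  move=> _; have := @is_deriveZ _ _ _ id c x 1 1 (is_derive_id _ _).
  by rewrite /GRing.scale /= mulr1.
by rewrite (meanE cf dF) mulr1 mulr0 subr0.
Qed.

Lemma mean_sum (I : Type) (r : seq I) (P : pred I) (F : I -> R -> R) :
  (forall i, continuous (F i)) ->
  mean (fun x => \sum_(i <- r | P i) F i x) = \sum_(i <- r | P i) mean (F i).
Proof.
move=> cF; elim: r => [|i r IH].
  under [X in mean X]eq_fun do rewrite big_nil.
  by rewrite big_nil mean_cst.
under [X in mean X]eq_fun do rewrite big_cons.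
rewrite big_cons; case: ifP => _; last exact: IH.
by rewrite meanD ?IH //; exact: continuous_sumr.
Qed.

Lemma mean_abs_le phi c : continuous phi ->
  (forall x, 0 <= x <= 1 -> `|phi x| <= c) -> `|mean phi| <= c.
Proof.
move=> cphi le_c; rewrite ler_norml; apply/andP; split.
  rewrite -(mean_cst (- c)); apply: mean_le => // x; first exact: cvg_cst.
  by move=> /le_c; rewrite ler_norml => /andP[].
rewrite -[leRHS](mean_cst c); apply: mean_le => // x; first exact: cvg_cst.
by move=> /le_c; rewrite ler_norml => /andP[].
Qed.

Lemma mean_shift phi (h : R) : continuous phi -> -1 <= h <= 1 ->
  mean (fun x => phi (x + h)) = antider phi (1 + h) - antider phi h.
Proof.
move=> cphi h1.
have cf : continuous (fun x => phi (x + h)).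
  move=> x; apply: (@continuous_comp _ _ _ (fun x => x + h) phi); last exact: cphi.
  by apply: cvgD; [exact: cvg_id | exact: cvg_cst].
have dF (x : R) : 0 <= x <= 1 ->
    is_derive x (1 : R) (fun x => antider phi (x + h)) (phi (x + h)).
  move=> x01.
  have dA : is_derive (x + h) (1 : R) (antider phi) (phi (x + h)).
    by apply: antider_derive => //; lra.
  have ds : is_derive x (1 : R) (fun y => y + h) 1.
    by apply: is_derive_eq; rewrite ?addr0.
  have := @is_derive1_comp _ (antider phi) (fun y => y + h) x _ _ dA ds.
  by rewrite mulr1.
by rewrite (meanE cf dF) add0r.
Qed.

Lemma lip_continuous (K : R) phi : (forall x y : R, `|phi x - phi y| <= K * `|x - y|) ->
  continuous phi.
Proof.
move=> lip x; apply/cvgrPdist_le => e e0.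
have K0 : 0 < `|K| + 1 by rewrite ltr_wpDl.
near=> y; apply: le_trans (lip _ _) _.
apply: (@le_trans _ _ ((`|K| + 1) * `|x - y|)).
  by rewrite ler_wpM2r // (le_trans (ler_norm K)) // lerDl.
rewrite mulrC -ler_pdivlMr //.
near: y; apply: cvgr_dist_le; [exact: cvg_id | by rewrite divr_gt0].
Unshelve. all: by end_near. Qed.

(* By the fundamental theorem of calculus the mean over a translated interval
   is differentiable in the translation parameter. *)
Lemma mean_diff (K : R) phi (h : R) : 0 <= K ->
  (forall x y : R, `|phi x - phi y| <= K * `|x - y|) ->
  `|mean (fun x => phi (x + h)) - mean phi - h * (phi 1 - phi 0)| <= 2 * K * h ^+ 2.
Proof.
move=> K0 lip; have cphi := lip_continuous lip.
have cphih : continuous (fun x => phi (x + h)).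
  apply: (@lip_continuous K) => x y; apply: le_trans (lip _ _) _.
  by rewrite opprD addrACA subrr addr0.
have [h1|h1] := leP `|h| 1.
  move: h1; rewrite ler_norml => h1; rewrite mean_shift //.
  (* The translated mean minus the mean is the increment of the antiderivative at 1 minus that at 0;
     each end point contributes an error K h^2. *)
  have key (a : R) : 0 <= a <= 1 ->
    `|antider phi (a + h) - antider phi a - h * phi a| <= K * h ^+ 2.
    move=> a01.
    have [c hc ->] : exists2 c, `|c - a| <= `|h| &
        antider phi (a + h) - antider phi a = phi c * h.
      have [h0|h0] := leP 0 h.
        have [|x||c] := @MVT_segment R (antider phi) phi a (a + h).
        - lra.
        - by rewrite in_itv/= => /andP[? ?]; apply: antider_derive => //; lra.
        - by apply: (@derive_cts _ phi) => x ?; apply: antider_derive => //; lra.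
        rewrite in_itv/= => /andP[? ?] ->; exists c; last by congr (_ * _); ring.
        by rewrite !ger0_norm; lra.
      have [|x||c] := @MVT_segment R (antider phi) phi (a + h) a.
      - lra.
      - by rewrite in_itv/= => /andP[? ?]; apply: antider_derive => //; lra.
      - by apply: (@derive_cts _ phi) => x ?; apply: antider_derive => //; lra.
      rewrite in_itv/= => /andP[? ?] e; exists c.
        by rewrite [`|h|]ltr0_norm // ler_norml; apply/andP; split; lra.
      by rewrite -[LHS]opprB e; ring.
    rewrite mulrC -mulrBr normrM.
    rewrite -[h ^+ 2]real_normK ?num_real // expr2 mulrCA ler_wpM2l //.
    by apply: le_trans (lip c a) _; rewrite ler_wpM2l.
  have h01 : 0 <= (0 : R) <= 1 by lra.
  have h11 : 0 <= (1 : R) <= 1 by lra.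
  have := key _ h01; have := key _ h11; rewrite add0r /mean !ler_norml.
  move: (antider phi (1 + h)) (antider phi h) (antider phi 1) (antider phi 0).
  by move=> ? ? ? ? /andP[? ?] /andP[? ?]; apply/andP; split; lra.
have e1 : mean (fun x => phi (x + h)) <= mean phi + K * `|h|.
  rewrite -[X in _ + X]mean_cst -meanD //; last exact: cst_continuous.
  apply: mean_le => // [|x _].
    by move=> y; apply: cvgD; [exact: cphi | exact: cvg_cst].
  by have := lip (x + h) x; rewrite addrAC subrr add0r ler_norml; lra.
have e2 : mean phi <= mean (fun x => phi (x + h)) + K * `|h|.
  rewrite -[X in _ + X]mean_cst -meanD //; last exact: cst_continuous.
  apply: mean_le => // [|x _].
    by move=> y; apply: cvgD; [exact: cphih | exact: cvg_cst].
  by have := lip (x + h) x; rewrite addrAC subrr add0r ler_norml; lra.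
have e3 : `|h * (phi 1 - phi 0)| <= `|h| * K.
  by rewrite normrM ler_wpM2l // (le_trans (lip _ _)) // subr0 normr1 mulr1.
have e4 : K * `|h| <= K * h ^+ 2.
  by rewrite ler_wpM2l // -[h ^+ 2]real_normK ?num_real // expr2; nra.
by move: e3; rewrite !ler_norml => /andP[? ?]; apply/andP; split; lra.
Qed.

End Mean.

(** * Smoothing by iterated box averages *)

Section Smoothing.
Context (R : realType) (n : nat).
Implicit Types (f g : 'cV[R]_n -> R) (x y v : 'cV[R]_n) (i j : 'I_n) (L C c : R).

Definition lipf L f := forall x y, `|f x - f y| <= L * enorm (x - y).

Definition evec i : 'cV[R]_n := delta_mx i 0.

Lemma enorm_evec i : enorm (evec i) = 1.
Proof.
rewrite enormE fdot_cVE (bigD1 i) //= big1; last first.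
  by move=> j /negPf ji; rewrite mxE ji mul0r.
by rewrite mxE !eqxx mulr1 addr0 sqrtr1.
Qed.

Lemma lipf_const_ge0 L f i : lipf L f -> 0 <= L.
Proof.
move=> lf; have := lf (evec i) 0; rewrite subr0 enorm_evec mulr1.
exact: le_trans (normr_ge0 _).
Qed.

Section Boxmean.
Variable delta : R.
Hypothesis delta0 : 0 < delta.

Definition boxmean i f x : R := mean (fun s => f (x + (s * delta) *: evec i)).

Lemma lipf_line L f i x : lipf L f -> forall s t : R,
  `|f (x + (s * delta) *: evec i) - f (x + (t * delta) *: evec i)|
    <= L * delta * `|s - t|.
Proof.
move=> lf s t; apply: le_trans (lf _ _) _.
rewrite opprD addrACA subrr add0r -scalerBl -mulrBl enormZ enorm_evec mulr1.
by rewrite normrM (gtr0_norm delta0) (mulrC `|_|) mulrA.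
Qed.

Lemma lipf_line_cts L f i x : lipf L f ->
  continuous (fun s : R => f (x + (s * delta) *: evec i)).
Proof. by move=> /lipf_line-/(_ i x)/lip_continuous. Qed.

Lemma boxmean_le L f g i x c : lipf L f -> lipf L g ->
  (forall y, enorm (y - x) <= delta -> f y <= g y + c) ->
  boxmean i f x <= boxmean i g x + c.
Proof.
move=> lf lg fg; rewrite /boxmean -[X in _ + X]mean_cst -meanD //; last 2 first.
- exact: lipf_line_cts lg.
- by move=> ?; exact: cvg_cst.
apply: mean_le; first exact: lipf_line_cts lf.
  by move=> s; apply: cvgD; [exact: lipf_line_cts lg _ | exact: cvg_cst].
move=> s /andP[s0 s1]; apply: fg.
rewrite addrAC subrr add0r enormZ enorm_evec mulr1 ger0_norm.
  by rewrite ler_piMl // ltW.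
by rewrite mulr_ge0 // ltW.
Qed.

Lemma boxmean_lip L i f : lipf L f -> lipf L (boxmean i f).
Proof.
move=> lf x y.
have lfs v : lipf L (fun x => f (x + v)).
  by move=> a b; apply: le_trans (lf _ _) _; rewrite opprD addrACA subrr addr0.
have e z w : boxmean i f z <= boxmean i f w + L * enorm (z - w).
  have -> : boxmean i f z = boxmean i (fun x => f (x + (z - w))) w.
    by congr mean; apply/funext => s; congr f; rewrite [RHS]addrC addrA subrK.
  apply: (@boxmean_le L) => // u _.
  have := lf (u + (z - w)) u; rewrite addrAC subrr add0r ler_norml; lra.
have := e x y; have := e y x; rewrite enormB ler_norml => ? ?.
by apply/andP; split; lra.
Qed.

Lemma boxmean_diff L i f x h : lipf L f ->
  `|boxmean i f (x + h *: evec i) - boxmean i f x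
    - h * ((f (x + delta *: evec i) - f x) / delta)| <= 2 * L / delta * h ^+ 2.
Proof.
move=> lf; have L0 := lipf_const_ge0 i lf.
have Ld : 0 <= L * delta by rewrite mulr_ge0 // ltW.
have := @mean_diff R (L * delta) (fun s => f (x + (s * delta) *: evec i))
  (h / delta) Ld (lipf_line i x lf).
rewrite /boxmean mul1r mul0r scale0r addr0.
have -> : (fun s => f (x + ((s + h / delta) * delta) *: evec i)) =
          (fun s => f (x + h *: evec i + (s * delta) *: evec i)).
  apply/funext => s; congr f; rewrite -addrA -scalerDl; congr (_ + _ *: _).
  by field; rewrite gt_eqF.
have -> : 2 * (L * delta) * (h / delta) ^+ 2 = 2 * L / delta * h ^+ 2.
  by field; rewrite gt_eqF.
by rewrite -[h / delta * _]mulrA [delta^-1 * _]mulrC.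
Qed.

(* K C f reads: f belongs to the class K with constant C. *)
Section FirstOrder.
Variable K : R -> ('cV[R]_n -> R) -> Prop.
Hypothesis K_lip : forall C f, K C f -> lipf C f.
Hypothesis K_le : forall C C' f, C <= C' -> K C f -> K C' f.
Hypothesis K_boxmean : forall C i f, K C f -> K C (boxmean i f).
Hypothesis K_diff : forall C i f, K C f ->
  K (2 * C / delta) (fun x => (f (x + delta *: evec i) - f x) / delta).

(** Averaging along the direction i creates a partial derivative along i, namely a difference
    quotient, and carries the other partial derivatives along by averaging them. The class K is
    abstract because the lemma is used twice: with Lipschitz functions it produces a gradient, with
    functions having a Lipschitz gradient it produces second derivatives. C' is uniform in f. *)
Lemma boxmeans_first_order C (l : seq 'I_n) : 0 <= C ->
  exists2 C', 0 <= C' & forall f, K C f ->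
    K C (foldr boxmean f l) /\
    exists g : 'I_n -> 'cV[R]_n -> R, (forall j, K C' (g j)) /\
    forall x v, (forall j, j \notin l -> v j 0 = 0) ->
      `|foldr boxmean f l (x + v) - foldr boxmean f l x - \sum_j g j x * v j 0|
        <= C' * fdot v v.
Proof.
move=> C0; elim: l => [|i l [C' C'0 IH]].
  exists C => // f Kf; split => //; exists (fun=> f); split => // x v v0.
  have -> : v = 0 by apply/matrixP => j k; rewrite ord1 mxE v0.
  rewrite addr0 subrr big1 => [|j _]; last by rewrite mxE mulr0.
  by rewrite subrr normr0 fdot0l mulr0.
have Cd0 : 0 <= 2 * C / delta by rewrite divr_ge0 ?mulr_ge0 // ltW.
exists (C' + 2 * (2 * C / delta)); first by lra.
move=> f /IH[] /=; set F := foldr _ _ _ => KF [g [Kg gE]]; split; first exact: K_boxmean.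
(* The new partial derivative along i is a difference quotient of F; the other ones are averages of
   the old ones. *)
pose G j := if j == i then fun x => (F (x + delta *: evec i) - F x) / delta
  else boxmean i (g j).
exists G; split => [j|x v v0].
  have le1 : 2 * C / delta <= C' + 2 * (2 * C / delta) by lra.
  have le2 : C' <= C' + 2 * (2 * C / delta) by lra.
  by rewrite /G; case: ifP => _; [exact: K_le (K_diff i KF) | exact: K_le (K_boxmean i (Kg j))].
(* The increment is split into v', where the induction hypothesis applies, followed by a move along
   the direction i. *)
pose v' := v - v i 0 *: evec i.
have v'i : v' i 0 = 0 by rewrite !mxE !eqxx mulr1 subrr.
have v'j j : j != i -> v' j 0 = v j 0.
  by move=> ji; rewrite !mxE (negPf ji) mulr0 subr0.
have v'0 j : j \notin l -> v' j 0 = 0.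
  have [->//|ji jl] := eqVneq j i; rewrite v'j // v0 //.
  by rewrite in_cons (negPf ji).
have vE : v = v' + v i 0 *: evec i by rewrite subrK.
have fv : fdot v v = fdot v' v' + v i 0 ^+ 2.
  rewrite !fdot_cVE (bigD1 i) //= [in RHS](bigD1 i) //= v'i mul0r add0r addrC expr2.
  by congr (_ + _); apply: eq_bigr => j ji; rewrite v'j.
have nv' : `|enorm v'| = enorm v' by rewrite ger0_norm // enorm_ge0.
have d1 := boxmean_diff i (x + v') (v i 0) (K_lip KF).
(* The move along i starts at x + v' instead of x; since the difference quotient is Lipschitz, this
   costs a multiple of |v i| |v'| <= |v|^2. *)
have d2 : `|v i 0 * (G i (x + v')) - v i 0 * G i x| <= 2 * C / delta * fdot v v.
  rewrite -mulrBr normrM /G eqxx.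
  have := K_lip (K_diff i KF) (x + v') x; rewrite [x + v' - x]addrAC subrr add0r => h.
  apply: le_trans (ler_wpM2l (normr_ge0 _) h) _.
  rewrite mulrCA ler_wpM2l // fv -enorm_sqr -[v i 0 ^+ 2]real_normK ?num_real //.
  have := sqr_ge0 (`|v i 0| - enorm v'); have := enorm_ge0 v'.
  have := normr_ge0 (v i 0); nra.
have lF := K_lip KF; have lg j := K_lip (Kg j).
have d3 : `|boxmean i F (x + v') - boxmean i F x
    - \sum_(j | j != i) boxmean i (g j) x * v j 0| <= C' * fdot v' v'.
  have cF z := @lipf_line_cts _ _ i z lF.
  have cg j := @lipf_line_cts _ _ i x (lg j).
  (* The remainder of the average is the average of the remainders, each of which the induction
     hypothesis bounds. *)
  pose D (s : R) := F (x + v' + (s * delta) *: evec i) +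
      (-1 * F (x + (s * delta) *: evec i) +
       \sum_(j | j != i) (- v j 0) * g j (x + (s * delta) *: evec i)).
  have cFN : continuous (fun s : R => -1 * F (x + (s * delta) *: evec i)).
    by move=> s; apply: cvgM; [exact: cvg_cst | exact: cF].
  have cgN j : continuous (fun s : R => - v j 0 * g j (x + (s * delta) *: evec i)).
    by move=> s; apply: cvgM; [exact: cvg_cst | exact: cg].
  have csum : continuous (fun s : R => \sum_(j | j != i)
      (- v j 0) * g j (x + (s * delta) *: evec i)).
    exact: continuous_sumr.
  have cFS : continuous (fun s : R => -1 * F (x + (s * delta) *: evec i) +
       \sum_(j | j != i) (- v j 0) * g j (x + (s * delta) *: evec i)).
    by move=> s; apply: cvgD; [exact: cFN | exact: csum].
  have -> : boxmean i F (x + v') - boxmean i F x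
      - \sum_(j | j != i) boxmean i (g j) x * v j 0 = mean D.
    rewrite meanD // meanD // meanZ // mulN1r -addrA; congr (_ + (_ + _)).
    rewrite mean_sum // -sumrN; apply: eq_bigr => j _.
    by rewrite meanZ // mulNr mulrC.
  apply: mean_abs_le => [s|s _].
    by apply: cvgD; [exact: cF | exact: cFS].
  rewrite /D; set y := x + _ *: _.
  have -> : x + v' + (s * delta) *: evec i = y + v' by rewrite addrAC.
  have := gE y v' v'0; rewrite (bigD1 i) //= v'i mulr0 add0r mulN1r -addrA.
  congr (`|_ + (_ + _)| <= _); rewrite -sumrN; apply: eq_bigr => j ji.
  by rewrite v'j // mulNr mulrC.
rewrite (bigD1 i) //=.
have -> : \sum_(j | j != i) G j x * v j 0 =
          \sum_(j | j != i) boxmean i (g j) x * v j 0.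
  by apply: eq_bigr => j /negPf ji; rewrite /G ji.
have GiE z : (F (z + delta *: evec i) - F z) / delta = G i z by rewrite /G eqxx.
have vxE : x + v' + v i 0 *: evec i = x + v by rewrite -addrA -vE.
move: d1 d2 d3; rewrite GiE vxE; set S := \sum_(_ | _) _.
have := fdot_ge0 v'; rewrite -/(2 * C / delta) => fv0 d1 d2 d3.
have e1 : 2 * C / delta * v i 0 ^+ 2 <= 2 * C / delta * fdot v v.
  by rewrite ler_wpM2l // fv lerDr.
have e2 : C' * fdot v' v' <= C' * fdot v v.
  by rewrite ler_wpM2l // fv lerDl sqr_ge0.
move: d1 d2 d3; rewrite !ler_norml => /andP[? ?] /andP[? ?] /andP[? ?].
by apply/andP; split; lra.
Qed.

End FirstOrder.

Definition c1lip C f := lipf C f /\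
  exists g : 'I_n -> 'cV[R]_n -> R, (forall j, lipf C (g j)) /\
    forall x v, `|f (x + v) - f x - \sum_j g j x * v j 0| <= C * fdot v v.

Lemma lipf_le C C' f : C <= C' -> lipf C f -> lipf C' f.
Proof.
by move=> CC lf x y; apply: le_trans (lf x y) _; rewrite ler_wpM2r ?enorm_ge0.
Qed.

Lemma lipf_diff C i f : lipf C f ->
  lipf (2 * C / delta) (fun x => (f (x + delta *: evec i) - f x) / delta).
Proof.
move=> lf x y; rewrite -mulrBl normrM [`|delta^-1|]gtr0_norm ?invr_gt0 //.
rewrite [leRHS]mulrAC ler_pM2r ?invr_gt0 //.
have h1 := lf (x + delta *: evec i) (y + delta *: evec i).
have h2 := lf x y; move: h1 h2; rewrite opprD addrACA subrr addr0.
by rewrite !ler_norml => /andP[? ?] /andP[? ?]; apply/andP; split; lra.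
Qed.

Lemma c1lip_le C C' f : C <= C' -> c1lip C f -> c1lip C' f.
Proof.
move=> CC [lf [g [lg gE]]]; split; first exact: lipf_le lf.
exists g; split => [j|x v]; first exact: lipf_le (lg j).
by apply: le_trans (gE x v) _; rewrite ler_wpM2r ?fdot_ge0.
Qed.

Lemma c1lip_diff C i f : c1lip C f ->
  c1lip (2 * C / delta) (fun x => (f (x + delta *: evec i) - f x) / delta).
Proof.
move=> [lf [g [lg gE]]]; split; first exact: lipf_diff.
exists (fun j x => (g j (x + delta *: evec i) - g j x) / delta); split => [j|x v].
  exact: lipf_diff.
under eq_bigr do rewrite mulrAC mulrBl; rewrite -mulr_suml sumrB -!mulrBl normrM.
rewrite [`|delta^-1|]gtr0_norm ?invr_gt0 // [leRHS]mulrAC ler_pM2r ?invr_gt0 //.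
have h1 := gE (x + delta *: evec i) v.
have h2 := gE x v; move: h1 h2; rewrite [x + delta *: _ + v]addrAC.
by rewrite !ler_norml => /andP[? ?] /andP[? ?]; apply/andP; split; lra.
Qed.

Lemma c1lip_boxmean C i f : c1lip C f -> c1lip C (boxmean i f).
Proof.
move=> [lf [g [lg gE]]]; split; first exact: boxmean_lip.
exists (fun j => boxmean i (g j)); split => [j|x v]; first exact: boxmean_lip.
have cf z := @lipf_line_cts _ _ i z lf.
have cg j := @lipf_line_cts _ _ i x (lg j).
have cfN : continuous (fun s : R => -1 * f (x + (s * delta) *: evec i)).
  by move=> s; apply: cvgM; [exact: cvg_cst | exact: cf].
have cgN j : continuous (fun s : R => - v j 0 * g j (x + (s * delta) *: evec i)).
  by move=> s; apply: cvgM; [exact: cvg_cst | exact: cg].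
have cgS : continuous (fun s : R => \sum_j (- v j 0) * g j (x + (s * delta) *: evec i)).
  exact: continuous_sumr.
have cfg : continuous (fun s : R => -1 * f (x + (s * delta) *: evec i) +
    \sum_j (- v j 0) * g j (x + (s * delta) *: evec i)).
  by move=> s; apply: cvgD; [exact: cfN | exact: cgS].
have -> : boxmean i f (x + v) - boxmean i f x - \sum_j boxmean i (g j) x * v j 0 =
    mean (fun s => f (x + v + (s * delta) *: evec i) +
      (-1 * f (x + (s * delta) *: evec i) +
       \sum_j (- v j 0) * g j (x + (s * delta) *: evec i))).
  rewrite meanD // meanD // meanZ // mulN1r -addrA; congr (_ + (_ + _)).
  rewrite mean_sum // -sumrN; apply: eq_bigr => j _.
  by rewrite meanZ // mulNr mulrC.
apply: mean_abs_le => [s|s _].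
  by apply: cvgD; [exact: cf | exact: cfg].
pose y := x + (s * delta) *: evec i.
rewrite [X in `|X|](_ : _ = f (y + v) - f y - \sum_j g j y * v j 0); first exact: gE.
rewrite [x + v + _]addrAC mulN1r [LHS]addrA -sumrN; congr (_ + _).
by apply: eq_bigr => j _; rewrite mulNr mulrC.
Qed.

(** One round of averages over all directions makes a Lipschitz function C^{1,1}; the second round
    makes it C^{2,1}, which gives a remainder of order |v|^3. *)
Definition smooth f : 'cV[R]_n -> R :=
  foldr boxmean (foldr boxmean f (enum 'I_n)) (enum 'I_n).

Lemma foldr_boxmean_le L f g (l : seq 'I_n) x c : lipf L f -> lipf L g ->
  (forall y, enorm (y - x) <= (size l)%:R * delta -> f y <= g y + c) ->
  foldr boxmean f l x <= foldr boxmean g l x + c.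
Proof.
move=> lf lg; elim: l x => [|i l IH] x fg /=.
  by apply: fg; rewrite subrr enorm0 mul0r.
have lF h : lipf L h -> lipf L (foldr boxmean h l).
  by move=> lh; elim: l {IH fg} => // j l IH /=; exact: boxmean_lip.
apply: (@boxmean_le L) => [||y yx]; [exact: lF|exact: lF|].
apply: IH => z zy; apply: fg => /=.
rewrite -(subrKA y) (le_trans (enormD _ _)) // -natr1 mulrDl mul1r; lra.
Qed.

Lemma foldr_boxmean_lip L f (l : seq 'I_n) : lipf L f -> lipf L (foldr boxmean f l).
Proof. by move=> lf; elim: l => //= i l; exact: boxmean_lip. Qed.

Lemma smooth_lip L f : lipf L f -> lipf L (smooth f).
Proof. by move=> lf; do 2!apply: foldr_boxmean_lip. Qed.

Lemma smooth_le L f g x c : lipf L f -> lipf L g ->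
  (forall y, enorm (y - x) <= (n + n)%:R * delta -> f y <= g y + c) ->
  smooth f x <= smooth g x + c.
Proof.
move=> lf lg fg; rewrite /smooth -!foldr_cat.
by apply: (@foldr_boxmean_le L) => // y; rewrite size_cat size_enum_ord; exact: fg.
Qed.

Lemma foldr_boxmean_cst c (l : seq 'I_n) x : foldr boxmean (fun=> c) l x = c.
Proof.
elim: l x => //= i l IH x; rewrite /boxmean.
by under [X in mean X]eq_fun do rewrite IH; rewrite mean_cst.
Qed.

Lemma smooth_near L f x : lipf L f -> 0 <= L ->
  `|smooth f x - f x| <= L * ((n + n)%:R * delta).
Proof.
move=> lf L0.
have lc c : lipf L (fun=> c).
  by move=> ? ?; rewrite subrr normr0 mulr_ge0 // enorm_ge0.
have cE c : smooth (fun=> c) x = c.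
  by rewrite /smooth -foldr_cat foldr_boxmean_cst.
have close y : enorm (y - x) <= (n + n)%:R * delta ->
    `|f y - f x| <= L * ((n + n)%:R * delta).
  by move=> yx; apply: le_trans (lf _ _) _; rewrite ler_wpM2l.
have : smooth f x <= smooth (fun=> f x) x + L * ((n + n)%:R * delta).
  by apply: (@smooth_le L) => // y /close; rewrite ler_norml; lra.
have : smooth (fun=> f x) x <= smooth f x + L * ((n + n)%:R * delta).
  by apply: (@smooth_le L) => // y /close; rewrite ler_norml; lra.
by rewrite cE ler_norml => ? ?; apply/andP; split; lra.
Qed.

End Boxmean.

End Smoothing.

(** * Second order expansions of smoothed functions *)

Section Taylor.
Context (R : realType).

(** Summing over m equal steps leaves K + C / m; then m tends to infinity. This plays the role of a
    mean value inequality for a function that is not known to be differentiable. *)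
Lemma le_of_steps (phi : R -> R) (K C : R) : 0 <= C ->
  (forall s h, 0 <= s -> 0 <= h -> s + h <= 1 ->
    `|phi (s + h) - phi s| <= K * h + C * h ^+ 2) ->
  `|phi 1 - phi 0| <= K.
Proof.
move=> C0 step; apply/ler_addgt0Pr => e e0.
pose m := (Num.trunc (C / e)).+1.
have m0 : (0 : R) < m%:R by rewrite ltr0n.
have Cm : C / m%:R <= e.
  rewrite ler_pdivrMr // -ler_pdivrMl // mulrC ltW //.
  by rewrite /m truncnS_gt.
have ind k : (k <= m)%N ->
    `|phi (k%:R / m%:R) - phi 0| <= k%:R * (K / m%:R + C / m%:R ^+ 2).
  elim: k => [|k IH] km; first by rewrite mul0r subrr normr0 mul0r.
  have h1 : 0 <= k%:R / m%:R :> R by rewrite divr_ge0.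
  have h2 : 0 <= m%:R^-1 :> R by rewrite invr_ge0 ltW.
  have h3 : k%:R / m%:R + m%:R^-1 <= 1 :> R.
    by rewrite -[X in _ + X]mul1r -mulrDl natr1 ler_pdivrMr // mul1r ler_nat.
  have kE : k.+1%:R = k%:R + 1 :> R by rewrite natr1.
  have := step _ _ h1 h2 h3; have := IH (ltnW km).
  rewrite kE mulrDl mul1r exprVn !ler_norml => /andP[? ?] /andP[? ?]; apply/andP; split; lra.
have := ind m (leqnn m); rewrite divff ?gt_eqF //.
have -> : m%:R * (K / m%:R + C / m%:R ^+ 2) = K + C / m%:R.
  by field; rewrite gt_eqF.
lra.
Qed.

Context (n : nat).
Implicit Types (f : 'cV[R]_n -> R) (x v : 'cV[R]_n).

(** C depends only on n, [delta] and L, so the same constant serves all times of a function that is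
    L-Lipschitz in x. The expansion of F and that of its gradient are combined along the segment
    from x to x + v. *)
Lemma smooth_taylor (delta L : R) : 0 < delta -> 0 <= L ->
  exists2 C, 0 <= C & forall f, lipf L f -> forall x,
  exists p X, forall v,
    `|smooth delta f (x + v) - smooth delta f x - fdot p v - 2^-1 * quad X v|
      <= C * enorm v ^+ 3.
Proof.
move=> delta0 L0.
have [C1 C10 step1] := @boxmeans_first_order R n delta delta0 (@lipf R n)
  (fun _ _ => id) (@lipf_le R n) (fun L i f => @boxmean_lip R n delta delta0 L i f)
  (fun L i f => @lipf_diff R n delta delta0 L i f) L (enum 'I_n) L0.
pose C1' := L + C1; have C1'0 : 0 <= C1' by rewrite addr_ge0.
have [C2 C20 step2] := @boxmeans_first_order R n delta delta0 (@c1lip R n)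
  (fun L f => @proj1 _ _) (@c1lip_le R n)
  (fun L i f => @c1lip_boxmean R n delta delta0 L i f)
  (fun L i f => @c1lip_diff R n delta delta0 L i f) C1' (enum 'I_n) C1'0.
exists (n%:R * C2) => [|f lf x]; first by rewrite mulr_ge0.
have allE (v : 'cV[R]_n) (j : 'I_n) : j \notin enum 'I_n -> v j 0 = 0.
  by rewrite mem_enum.
have c1f : c1lip C1' (foldr (boxmean delta) f (enum 'I_n)).
  have [lF [g [lg gE]]] := step1 _ lf; split; first by apply: lipf_le lF; rewrite lerDl.
  exists g; split => [j|y v]; first by apply: lipf_le (lg j); rewrite lerDr.
  by apply: le_trans (gE y v (allE v)) _; rewrite ler_wpM2r ?fdot_ge0 // lerDr.
have [_ [g [gc gE]]] := step2 _ c1f.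
have /choice[G GE] : forall i, exists G : 'I_n -> 'cV[R]_n -> R,
    forall x v, `|g i (x + v) - g i x - \sum_j G j x * v j 0| <= C2 * fdot v v.
  by move=> i; have [_ [G [_ GE]]] := gc i; exists G.
pose p : 'cV[R]_n := \col_i g i x; pose X : 'M[R]_n := \matrix_(i, j) G i j x.
exists p, X => v; set F := smooth delta f.
(* The second order remainder along the segment. Its increments are of the form required by
   [le_of_steps]: the derivative is of order |v|^3 because the gradient differs from its own linear
   expansion by O(|v|^2). *)
pose phi s := F (x + s *: v) - F x - s * fdot p v - 2^-1 * s ^+ 2 * quad X v.
have -> : F (x + v) - F x - fdot p v - 2^-1 * quad X v = phi 1 - phi 0.
  by rewrite /phi !(scale1r, scale0r, addr0, mul1r, expr1n, mul0r, expr0n, mulr0, mulr1) subrr !subr0.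
apply: (@le_of_steps phi _ (C2 * fdot v v + `|2^-1 * quad X v|)) => [|s h s0 h0 sh1].
  by rewrite addr_ge0 ?normr_ge0 ?mulr_ge0 ?fdot_ge0.
have s1 : s <= 1 by apply: le_trans sh1; rewrite lerDl.
have d1 := gE (x + s *: v) (h *: v) (allE _).
have d2 : `|\sum_i (g i (x + s *: v) - g i x - \sum_j G i j x * (s *: v) j 0) * v i 0|
    <= n%:R * C2 * enorm v ^+ 3.
  apply: le_trans (ler_norm_sum _ _ _) _.
  have -> : n%:R * C2 * enorm v ^+ 3 = \sum_(i < n) C2 * enorm v ^+ 3.
    by rewrite sumr_const card_ord -[RHS]mulr_natl [RHS]mulrA.
  apply: ler_sum => i _; rewrite normrM exprSr mulrA.
  apply: ler_pM => //; last exact: normr_coord_le.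
  apply: le_trans (GE i x (s *: v)) _; rewrite enorm_sqr ler_wpM2l //.
  rewrite !fdotE mulrA ler_piMl ?fdot_ge0 // -expr2 expr_le1 //.
have -> : phi (s + h) - phi s =
  (F (x + s *: v + h *: v) - F (x + s *: v) - \sum_j g j (x + s *: v) * (h *: v) j 0)
  + h * (\sum_i (g i (x + s *: v) - g i x - \sum_j G i j x * (s *: v) j 0) * v i 0)
  - h ^+ 2 * (2^-1 * quad X v).
  rewrite /phi scalerDl addrA.
  have -> : \sum_j g j (x + s *: v) * (h *: v) j 0 = h * \sum_j g j (x + s *: v) * v j 0.
    by rewrite mulr_sumr; apply: eq_bigr => j _; rewrite mxE mulrCA.
  have -> : \sum_i (g i (x + s *: v) - g i x - \sum_j G i j x * (s *: v) j 0) * v i 0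
     = \sum_i g i (x + s *: v) * v i 0 - fdot p v - s * quad X v.
    rewrite fdot_cVE quadE mulr_sumr -!sumrB; apply: eq_bigr => i _.
    rewrite !mulrBl mxE; congr (_ - _); rewrite mulr_suml mulr_sumr.
    by apply: eq_bigr => j _; rewrite !mxE; ring.
  by field.
apply: le_trans (ler_normB _ _) _; apply: le_trans (lerD (ler_normD _ _) (lexx _)) _.
have e1 : `|h * (\sum_i (g i (x + s *: v) - g i x - \sum_j G i j x * (s *: v) j 0) * v i 0)|
    <= h * (n%:R * C2 * enorm v ^+ 3).
  by rewrite normrM ger0_norm // ler_wpM2l.
have e2 : `|h ^+ 2 * (2^-1 * quad X v)| = h ^+ 2 * `|2^-1 * quad X v|.
  by rewrite normrM ger0_norm // sqr_ge0.
move: d1; rewrite e2 !fdotE mulrA -expr2; lra.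
Qed.

End Taylor.

Lemma eq_near_fmap (S V : Type) (F : set_system S) {FF : Filter F} (f g : S -> V) :
  (\forall x \near F, f x = g x) -> f @ F = g @ F.
Proof.
move=> fg; apply/seteqP; split=> A /= hA; apply: filterS2 fg hA => x e.
  by rewrite /preimage /= e.
by rewrite /preimage /= e.
Qed.

(** * Trigonometric test functions and jets *)

Section TrigExpressions.
Context (R : realType) (n : nat).

(* Trigonometric polynomials in (t, x); None is the time variable. *)
Inductive texp :=
  | TCst of R
  | TSin of option 'I_n & R
  | TCos of option 'I_n & R
  | TAdd of texp & texp
  | TMul of texp & texp.

Definition crd (k : option 'I_n) (t : R) (x : 'cV[R]_n) : R :=
  if k is Some j then x j 0 else t.

Fixpoint teval (e : texp) (t : R) (x : 'cV[R]_n) : R :=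
  match e with
  | TCst c => c
  | TSin k c => sin (crd k t x - c)
  | TCos k c => cos (crd k t x - c)
  | TAdd e1 e2 => teval e1 t x + teval e2 t x
  | TMul e1 e2 => teval e1 t x * teval e2 t x
  end.

Fixpoint tder (i : option 'I_n) (e : texp) : texp :=
  match e with
  | TCst c => TCst 0
  | TSin k c => TMul (TCst (i == k)%:R) (TCos k c)
  | TCos k c => TMul (TCst (- (i == k)%:R)) (TSin k c)
  | TAdd e1 e2 => TAdd (tder i e1) (tder i e2)
  | TMul e1 e2 => TAdd (TMul (tder i e1) e2) (TMul e1 (tder i e2))
  end.

Lemma teval_continuous e : continuous (fun q : R * 'cV[R]_n => teval e q.1 q.2).
Proof.
have ccrd k : continuous (fun q : R * 'cV[R]_n => crd k q.1 q.2).
  case: k => [j|] q /=; last exact: cvg_fst.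
  apply: (@continuous_comp _ _ _ snd (fun x : 'cV[R]_n => x j 0)).
    exact: cvg_snd.
  exact: coord_continuous.
elim: e => [c|k c|k c|e1 IH1 e2 IH2|e1 IH1 e2 IH2] q /=.
- exact: cvg_cst.
- apply: (@continuous_comp _ _ _ (fun q : R * 'cV[R]_n => crd k q.1 q.2 - c) sin).
    by apply: cvgB; [exact: ccrd | exact: cvg_cst].
  exact: continuous_sin.
- apply: (@continuous_comp _ _ _ (fun q : R * 'cV[R]_n => crd k q.1 q.2 - c) cos).
    by apply: cvgB; [exact: ccrd | exact: cvg_cst].
  exact: continuous_cos.
- by apply: cvgD; [exact: IH1 | exact: IH2].
- by apply: cvgM; [exact: IH1 | exact: IH2].
Qed.

Lemma teval_bounded e : exists M, forall t x, `|teval e t x| <= M.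
Proof.
elim: e => [c|k c|k c|e1 [M1 IH1] e2 [M2 IH2]|e1 [M1 IH1] e2 [M2 IH2]] /=.
- by exists `|c|.
- by exists 1 => t x; exact: sin_max.
- by exists 1 => t x; exact: cos_max.
- by exists (M1 + M2) => t x; apply: le_trans (ler_normD _ _) _; exact: lerD.
- by exists (M1 * M2) => t x; rewrite normrM ler_pM.
Qed.

Definition tdir (i : option 'I_n) : R := if i is Some _ then 0 else 1.
Definition xdir (i : option 'I_n) : 'cV[R]_n := if i is Some j then evec R j else 0.

Lemma crd_line i k t x h :
  crd k (t + h * tdir i) (x + h *: xdir i) = crd k t x + h * (i == k)%:R.
Proof.
case: i k => [i|] [k|] /=; rewrite ?mulr1 ?mulr0 ?addr0 //.
  by rewrite !mxE eqxx andbT -[Some i == Some k]/(i == k) eq_sym.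
by rewrite scaler0 addr0.
Qed.

Lemma teval_derive i e t x :
  is_derive (0 : R) (1 : R)
    (fun h => teval e (t + h * tdir i) (x + h *: xdir i)) (teval (tder i e) t x).
Proof.
have dcrd k c : is_derive (0 : R) (1 : R)
    (fun h => crd k (t + h * tdir i) (x + h *: xdir i) - c) (i == k)%:R.
  under eq_fun do rewrite crd_line.
  set b := (_ == _)%:R.
  have d1 : is_derive (0 : R) (1 : R) (fun h => h * b) b.
    have -> : (fun h => h * b) = (fun h => b * h) by apply/funext => h; rewrite mulrC.
    have := @is_deriveZ _ _ _ (@id R) b 0 1 1 (is_derive_id _ _).
    by rewrite /GRing.scale /= mulr1.
  have d2 : is_derive (0 : R) (1 : R) (fun h => crd k t x + h * b) b.
    have := @is_deriveD _ _ _ _ _ _ _ _ _ (is_derive_cst (crd k t x) (0 : R) 1) d1.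
    by rewrite add0r.
  have := @is_deriveB _ _ _ _ _ _ _ _ _ d2 (is_derive_cst c (0 : R) 1).
  by rewrite subr0.
have crd0 k c : crd k (t + 0 * tdir i) (x + 0 *: xdir i) - c = crd k t x - c.
  by rewrite mul0r addr0 scale0r addr0.
elim: e => [c|k c|k c|e1 IH1 e2 IH2|e1 IH1 e2 IH2] /=.
- exact: is_derive_cst.
- have := @is_derive1_comp _ sin _ 0 _ _ (is_derive_sin _) (dcrd k c).
  by rewrite crd0 mulrC.
- have := @is_derive1_comp _ cos _ 0 _ _ (is_derive_cos _) (dcrd k c).
  by rewrite crd0 mulNr mulrC -mulNr.
- exact: is_deriveD.
- have := @is_deriveM _ _ _ _ _ _ _ _ IH1 IH2.
  rewrite /= mul0r addr0 scale0r addr0 /GRing.scale /= => h.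
  by apply: is_derive_eq h _; rewrite addrC [X in X + _]mulrC.
Qed.

Context (T : R).
Hypothesis T0 : 0 < T.

(** As T > 0, a time in [0,T] always has admissible increments of at least one sign: positive in the
    first half, negative in the second. *)
Instance time_increments_proper t : 0 <= t <= T ->
  ProperFilter (time_increments T t).
Proof.
move=> /andP[t0 tT]; apply: Build_ProperFilter_ex => P.
move=> /nbhs_ballP[e /= e0] he.
pose s := Num.min (e / 2) (T / 2).
have s0 : 0 < s by rewrite lt_min !divr_gt0.
have se : s < e by rewrite gt_min ltr_pdivrMr // ltr_pMr // ltr1n.
have sT : s <= T / 2 by rewrite ge_min lexx orbT.
have [tT2|tT2] := leP t (T / 2).
  exists s; apply: he; rewrite /ball /= ?sub0r ?normrN ?gtr0_norm //.
    by rewrite gt_eqF.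
  by apply/andP; split; lra.
exists (- s); apply: he; rewrite /ball /= ?sub0r ?opprK ?gtr0_norm //.
  by rewrite oppr_eq0 gt_eqF.
by apply/andP; split; lra.
Qed.

Lemma partial_eq i (f g : R -> 'cV[R]_n -> R) t x : 0 <= t <= T ->
  (forall t x, 0 <= t <= T -> f t x = g t x) ->
  partial T i f t x = partial T i g t x /\ (has_partial T i f t x <-> has_partial T i g t x).
Proof.
move=> tT fg; case: i => [j|] /=.
  have -> // : f t = g t by apply/funext => y; exact: fg.
have -> // : time_quotient f t x @ time_increments T t =
          time_quotient g t x @ time_increments T t.
have F := time_increments_proper tT.
apply: eq_near_fmap; apply: filterS (withinT _ _) => h /= hT.
by rewrite /time_quotient !fg.
Qed.

Lemma teval_partial i e t x : 0 <= t <= T ->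
  has_partial T i (teval e) t x /\ partial T i (teval e) t x = teval (tder i e) t x.
Proof.
move=> tT; have [dF lF] := teval_derive i e t x.
pose F h := teval e (t + h * tdir i) (x + h *: xdir i).
pose G h := h^-1 *: ((F \o shift 0) (h *: 1) - F 0).
have GE h : G h = h^-1 * (teval e (t + h * tdir i) (x + h *: xdir i) - teval e t x).
  by rewrite /G /F /= [h%:A]mulr1 !mul0r !scale0r !addr0.
change (cvg (G @ 0^')) in dF; change (lim (G @ 0^') = teval (tder i e) t x) in lF.
case: i F G GE dF lF => [j|] F G GE dF lF /=; last first.
  have GT : G = time_quotient (teval e) t x.
    by apply/funext => h; rewrite GE /= mulr1 scaler0 addr0.
  have P := time_increments_proper tT.
  have cv : time_quotient (teval e) t x @ time_increments T t -->
      teval (tder None e) t x.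
    by apply: cvg_within_filter; rewrite -GT -lF.
  by split; [apply/cvg_ex; eexists; exact: cv | exact: (cvg_lim _ cv)].
rewrite /derivable /derive.
have <- : G = (fun h => h^-1 *: ((teval e t \o shift x) (h *: evec R j) - teval e t x)).
  by apply/funext => h; rewrite GE /= mulr0 addr0 [x + _]addrC.
by [].
Qed.

Lemma teval_iter_partial s e t x : 0 <= t <= T ->
  iter_partial T s (teval e) t x = teval (foldr tder e s) t x.
Proof.
elim: s t x => //= i s IH t x tT.
by rewrite (partial_eq i x tT IH).1 (teval_partial _ _ _ tT).2.
Qed.

(** Test functions must have bounded derivatives on an unbounded domain, which excludes polynomials.
    Trigonometric expressions are bounded and stable under differentiation, so all iterated
    derivatives are covered at once. *)
Lemma teval_Cb23 e : Cb23 T (teval e).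
Proof.
move=> s _; split.
- rewrite /continuous_strip.
  have c : {within @strip R n T, continuous
      (fun q : R * 'cV[R]_n => teval (foldr tder e s) q.1 q.2)}.
    by apply: continuous_subspaceT; exact: teval_continuous.
  apply: subspace_eq_continuous c => q /set_mem qT /=.
  by rewrite /from_subspace /= teval_iter_partial.
- have [M hM] := teval_bounded (foldr tder e s); exists M => t x tT.
  by rewrite teval_iter_partial.
move=> i _ t x tT.
apply/(partial_eq i x tT (fun t x => @teval_iter_partial s e t x)).2.
exact: (teval_partial _ _ _ tT).1.
Qed.

Lemma teval_gradient e t x : 0 <= t <= T ->
  gradient T (teval e) t x = \col_i teval (tder (Some i) e) t x.
Proof. by move=> tT; apply/matrixP => i j; rewrite !mxE (teval_partial _ _ _ tT).2. Qed.

Lemma teval_hessian e t x : 0 <= t <= T ->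
  hessian T (teval e) t x =
  \matrix_(i, j) teval (tder (Some i) (tder (Some j) e)) t x.
Proof.
move=> tT; apply/matrixP => i j; rewrite !mxE.
rewrite (partial_eq _ _ tT (fun t x tT => (teval_partial (Some j) e x tT).2)).1.
exact: (teval_partial _ _ _ tT).2.
Qed.

End TrigExpressions.

(** * Comparison of the sine with the identity *)

Section SinEstimates.
Context (R : realType).

Lemma mvt0 (f df : R -> R) (x : R) :
  (forall c : R, is_derive c (1 : R) f (df c)) ->
  exists2 c, `|c| <= `|x| & f x - f 0 = df c * x.
Proof.
move=> dF; have cf : continuous f.
  by move=> y; apply: differentiable_continuous; apply/derivable1_diffP; case: (dF y).
have [x0|x0] := leP 0 x.
  have [c] := @MVT_segment R f df 0 x x0 (fun y _ => dF y) (continuous_subspaceT cf).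
  rewrite in_itv/= subr0 => /andP[c0 cx] ->; exists c => //.
  by rewrite !ger0_norm // (le_trans c0).
have [c] := @MVT_segment R f df x 0 (ltW x0) (fun y _ => dF y) (continuous_subspaceT cf).
rewrite in_itv/= sub0r => /andP[cx c0] e; exists c.
  by rewrite !ler0_norm ?lerN2 // ltW.
by rewrite -[LHS]opprB e mulrN opprK.
Qed.

Lemma sin_abs_le (x : R) : `|sin x| <= `|x|.
Proof.
have [c _] := @mvt0 sin cos x (@is_derive_sin R).
by rewrite sin0 subr0 => ->; rewrite normrM ler_piMl ?normr_ge0 ?cos_max.
Qed.

Lemma sin_near (x : R) : `|x - sin x| <= x ^+ 2 * `|x|.
Proof.
have d (c : R) : is_derive c (1 : R) (fun y => y - sin y) (1 - cos c).
  by have := @is_deriveB _ _ _ _ _ _ _ _ _ (is_derive_id c 1) (is_derive_sin c).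
have [c cx] := @mvt0 (fun y => y - sin y) (fun y => 1 - cos y) x d.
rewrite sin0 !subr0 => ->; rewrite normrM ler_wpM2r //.
have [b bc] := @mvt0 cos (fun y => - sin y) c (@is_derive_cos R).
rewrite cos0 distrC => ->; rewrite normrM normrN.
rewrite -[x ^+ 2]real_normK ?num_real // expr2.
apply: ler_pM => //; apply: le_trans (sin_abs_le _) _; exact: le_trans bc cx.
Qed.

End SinEstimates.

Section Jets.
Context (R : realType) (n : nat) (T : R).
Implicit Types (W : R -> 'cV[R]_n -> R) (t a : R) (x p : 'cV[R]_n) (X : 'M[R]_n).

(** A parabolic superjet with a quadratic error in time in place of o(|s|), where C may depend on
    [eta]. In this form the jet converts directly into a test function: C s^2 leaves the derivatives
    used by the equation unchanged, and [eta] only perturbs the Hessian. *)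
Definition ujet W t x a p X := forall eta, 0 < eta -> exists C r, 0 < r /\
  forall s v, `|s| < r -> fdot v v < r -> 0 <= t + s <= T ->
    W (t + s) (x + v) <=
    W t x + a * s + fdot p v + 2^-1 * quad X v + C * s ^+ 2 + eta * fdot v v.

Definition tsum (l : seq (texp R n)) : texp R n := foldr (@TAdd R n) (TCst n 0) l.

Lemma teval_tsum (I : Type) (l : seq I) (F : I -> texp R n) t x :
  teval (tsum [seq F i | i <- l]) t x = \sum_(i <- l) teval (F i) t x.
Proof. by elim: l => [|i l IH] /=; rewrite ?big_nil ?big_cons ?IH. Qed.

Lemma tder_tsum (I : Type) (l : seq I) (F : I -> texp R n) k :
  tder k (tsum [seq F i | i <- l]) = tsum [seq tder k (F i) | i <- l].
Proof. by elim: l => [|i l IH] //=; rewrite IH. Qed.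

Section TestFunction.
Variables (t0 : R) (x0 : 'cV[R]_n) (w a C eta : R) (p : 'cV[R]_n) (X : 'M[R]_n).

Let sx i : texp R n := TSin (Some i) (x0 i 0).
Let st : texp R n := TSin None t0.
Let ord := enum 'I_n.

(** The polynomial of the jet with each increment replaced by its sine. As x - sin x is of third
    order, no derivative up to order two changes at the base point. *)
Definition jet_texp : texp R n :=
  TAdd (TCst n w) (TAdd (TMul (TCst n a) st) (TAdd (TMul (TCst n C) (TMul st st))
   (TAdd (tsum [seq TMul (TCst n (p i 0)) (sx i) | i <- ord])
   (TAdd (tsum [seq tsum [seq TMul (TCst n (2^-1 * X i j)) (TMul (sx i) (sx j))
       | j <- ord] | i <- ord])
    (tsum [seq TMul (TCst n eta) (TMul (sx i) (sx i)) | i <- ord]))))).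

Lemma teval_jet t x : teval jet_texp t x =
  w + (a * sin (t - t0) + (C * (sin (t - t0) * sin (t - t0)) +
   (\sum_i p i 0 * sin (x i 0 - x0 i 0) +
   (\sum_i \sum_j 2^-1 * X i j * (sin (x i 0 - x0 i 0) * sin (x j 0 - x0 j 0)) +
    \sum_i eta * (sin (x i 0 - x0 i 0) * sin (x i 0 - x0 i 0)))))).
Proof.
rewrite /jet_texp /= !teval_tsum !big_enum /=; do 5 congr (_ + _).
by apply: eq_bigr => i _; rewrite teval_tsum big_enum.
Qed.

Lemma teval_jet0 : teval jet_texp t0 x0 = w.
Proof.
rewrite teval_jet !subrr sin0 !mulr0.
have e1 : \sum_i p i 0 * sin (x0 i 0 - x0 i 0) = 0.
  by rewrite big1 // => i _; rewrite subrr sin0 mulr0.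
have e2 : \sum_i \sum_j 2^-1 * X i j * (sin (x0 i 0 - x0 i 0) * sin (x0 j 0 - x0 j 0)) = 0.
  by rewrite big1 // => i _; rewrite big1 // => j _; rewrite !subrr sin0 !mulr0.
have e3 : \sum_i eta * (sin (x0 i 0 - x0 i 0) * sin (x0 i 0 - x0 i 0)) = 0.
  by rewrite big1 // => i _; rewrite subrr sin0 !mulr0.
by rewrite e1 e2 e3 !addr0.
Qed.

Lemma sum_kronecker_l (F : 'I_n -> R) j :
  \sum_i (i == j)%:R * F i = F j.
Proof.
rewrite (bigD1 j) //= eqxx mul1r big1 ?addr0 // => i /negPf ->.
by rewrite mul0r.
Qed.

Let someE (i j : 'I_n) : (Some i == Some j) = (i == j). Proof. by []. Qed.

Lemma teval_jet_dt : teval (tder None jet_texp) t0 x0 = a.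
Proof.
rewrite /jet_texp /= !tder_tsum !teval_tsum /= subrr sin0 cos0.
rewrite !big1 => [| i _ | i _ | i _] /=; first ring.
- by ring.
- rewrite tder_tsum teval_tsum big1 // => j _ /=; ring.
- by ring.
Qed.

Lemma teval_jet_dx j : teval (tder (Some j) jet_texp) t0 x0 = p j 0.
Proof.
rewrite /jet_texp /= !tder_tsum !teval_tsum !big_enum /= subrr sin0 cos0.
have e1 : \sum_(i < n) teval (tder (Some j)
    (tsum [seq TMul (TCst n (2^-1 * X i j0)) (TMul (sx i) (sx j0)) | j0 <- ord])) t0 x0 = 0.
  rewrite big1 // => i _; rewrite tder_tsum teval_tsum big1 // => k _ /=.
  by rewrite !subrr sin0; ring.
rewrite e1 [X in _ + (_ + (_ + (_ + (_ + X))))]big1; last by move=> i _; rewrite !subrr sin0; ring.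
rewrite -[RHS](sum_kronecker_l (fun i => p i 0)).
rewrite [X in _ + (_ + (_ + (X + _)))](eq_bigr (fun i => (i == j)%:R * p i 0)); first by ring.
by move=> i _; rewrite subrr sin0 cos0 someE eq_sym; ring.
Qed.

Lemma teval_jet_dxx i j :
  teval (tder (Some i) (tder (Some j) jet_texp)) t0 x0 =
  (2^-1 *: (X + X^T) + (2 * eta)%:M) i j.
Proof.
rewrite /jet_texp /= !tder_tsum !teval_tsum !big_enum /= subrr sin0 cos0.
rewrite [X in _ + (_ + (_ + (X + _)))]big1; last first.
  by move=> k _ /=; rewrite !subrr sin0; ring.
have e1 : \sum_(k < n) teval (tder (Some i) (tder (Some j)
    (tsum [seq TMul (TCst n (2^-1 * X k l)) (TMul (sx k) (sx l)) | l <- ord]))) t0 x0 =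
    2^-1 * (X i j + X j i).
  transitivity (\sum_k ((k == i)%:R * (2^-1 * X k j) + (k == j)%:R * (2^-1 * X k i))).
    apply: eq_bigr => k _; rewrite !tder_tsum teval_tsum big_enum /=.
    transitivity (\sum_l ((l == j)%:R * ((k == i)%:R * (2^-1 * X k l)) +
                          (l == i)%:R * ((k == j)%:R * (2^-1 * X k l)))).
      apply: eq_bigr => l _ /=; rewrite !subrr sin0 cos0 !someE.
      by rewrite ![i == _]eq_sym ![j == _]eq_sym; ring.
    by rewrite big_split /= !sum_kronecker_l.
  by rewrite big_split /= !sum_kronecker_l mulrDr.
have e2 : \sum_(k < n) teval (tder (Some i) (tder (Some j)
    (TMul (TCst n eta) (TMul (sx k) (sx k))))) t0 x0 = 2 * eta *+ (i == j).
  transitivity (\sum_k ((k == i)%:R * (2 * eta * (k == j)%:R))).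
    apply: eq_bigr => k _ /=; rewrite !subrr sin0 cos0 !someE.
    by rewrite ![i == _]eq_sym ![j == _]eq_sym; ring.
  by rewrite sum_kronecker_l mulr_natr.
move: e2; rewrite /= => ->; rewrite e1 !mxE; ring.
Qed.

End TestFunction.
End Jets.

Section SineEstimates.
Context (R : realType).
Implicit Types (a C x y z N rho : R).

Lemma sin_sqr_ge z x : 0 <= z <= 1 -> `|x| <= z -> (1 - z ^+ 2) ^+ 2 * x ^+ 2 <= sin x * sin x.
Proof.
move=> /andP[z0 z1] xz.
have h1 : `|x| * (1 - z ^+ 2) <= `|sin x|.
  have h2 : `|x| <= `|sin x| + `|x - sin x|.
    by rewrite -{1}(subrK (sin x) x) addrC ler_normD.
  have h3 : x ^+ 2 * `|x| <= z ^+ 2 * `|x|.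
    by rewrite ler_wpM2r // -[x ^+ 2]real_normK ?num_real // lerXn2r ?nnegrE.
  have := sin_near x; lra.
have z2 : 0 <= 1 - z ^+ 2 by rewrite subr_ge0 expr_le1.
rewrite mulrC -[x ^+ 2]real_normK ?num_real // -exprMn -expr2 -[leRHS]real_normK ?num_real //.
by rewrite lerXn2r ?nnegrE ?mulr_ge0.
Qed.

Lemma sin_sqr_ge_quarter x : `|x| <= 4^-1 -> 7 / 8 * x ^+ 2 <= sin x ^+ 2.
Proof.
move=> hx; have q : 0 <= (4^-1 : R) <= 1 by lra.
by have := sin_sqr_ge q hx; have := sqr_ge0 x; rewrite -expr2; lra.
Qed.

(** For |x| <= 1/2 both |x - sin x| and x^2 / 2 are controlled, by x^2 and (sin x)^2 respectively;
    hence the new quadratic coefficient. *)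
Lemma sin_time_jet a C x : `|x| <= 2^-1 ->
  a * x + C * x ^+ 2 <= a * sin x + 2 * (`|C| + `|a|) * (sin x * sin x).
Proof.
move=> hx; have q : 0 <= (2^-1 : R) <= 1 by lra.
have e4 : x ^+ 2 / 2 <= sin x * sin x.
  by have := sin_sqr_ge q hx; have := sqr_ge0 x; lra.
have e1 : a * (x - sin x) <= `|a| * x ^+ 2.
  apply: le_trans (ler_norm _) _; rewrite normrM ler_wpM2l //.
  by apply: le_trans (sin_near _) _; rewrite ler_piMr ?sqr_ge0 //; lra.
have e2 : C * x ^+ 2 <= `|C| * x ^+ 2 by rewrite ler_wpM2r ?sqr_ge0 ?ler_norm.
have c0 : 0 <= 2 * (`|C| + `|a|) by rewrite mulr_ge0 // addr_ge0.
have := ler_wpM2l c0 e4; lra.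
Qed.

Lemma sin_product_near x y rho N : 0 <= rho -> `|x| <= rho -> `|y| <= rho -> rho <= 1 ->
  x ^+ 2 <= N -> y ^+ 2 <= N ->
  `|2^-1 * (x * (y - sin y) + sin y * (x - sin x))| <= rho * N.
Proof.
move=> r0 xr yr r1 xN yN.
have near u : `|u| <= rho -> u ^+ 2 <= N -> `|u - sin u| <= N * rho.
  by move=> ur uN; apply: le_trans (sin_near _) _; apply: ler_pM; rewrite ?sqr_ge0.
have hy := near y yr yN; have hx := near x xr xN.
have Nr : 0 <= N * rho by rewrite mulr_ge0 // (le_trans (sqr_ge0 x)).
have sy : `|sin y| <= 1.
  by apply: le_trans (sin_abs_le y) (le_trans yr r1).
have h1 : `|x * (y - sin y)| <= N * rho.
  by rewrite normrM -[leRHS]mul1r; apply: ler_pM => //; lra.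
have h2 : `|sin y * (x - sin x)| <= N * rho.
  by rewrite normrM -[leRHS]mul1r; apply: ler_pM.
rewrite normrM ger0_norm ?invr_ge0 //.
have := ler_normD (x * (y - sin y)) (sin y * (x - sin x)); lra.
Qed.

End SineEstimates.

Section JetTest.
Context (R : realType) (n : nat) (T : R).
Implicit Types (W : R -> 'cV[R]_n -> R) (t a : R) (x p : 'cV[R]_n) (X : 'M[R]_n).

(** Passes from neighbourhoods for the sup norm to conditions on the Euclidean norm; [r1 <= 1] gives
    [r1 ^+ 2 <= r1], and n squares of size r / (n + 1) sum up to less than r. *)
Lemma near_strip (P : R * 'cV[R]_n -> Prop) t x r : 0 < r ->
  (forall s v, `|s| < r -> fdot v v < r -> 0 <= t + s <= T -> P (t + s, x + v)) ->
  \forall q \near within (@strip R n T) (nbhs (t, x)), P q.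
Proof.
move=> r0 h; pose r1 := Num.min 1 (Num.min r (r / n.+1%:R)).
have rn0 : 0 < r / n.+1%:R by rewrite divr_gt0.
have r10 : 0 < r1 by rewrite !lt_min ltr01 r0 rn0.
apply/nbhs_ballP; exists r1 => //= -[t' x'] [/= bt [_ bx]]; rewrite /strip /= => tT.
move: bt; rewrite /ball /= distrC => bt.
have := h (t' - t) (x' - x); rewrite ![_ + (_ - _)]addrC !subrK; apply => //.
  by apply: lt_le_trans bt _; rewrite /r1 !ge_min lexx orbT.
rewrite fdot_cVE; apply: (@le_lt_trans _ _ (\sum_(i < n) r / n.+1%:R)).
  apply: ler_sum => i _; rewrite !mxE; have := bx i 0; rewrite /ball /= distrC => b.
  rewrite -expr2 -real_normK ?num_real //.
  have r11 : r1 <= 1 by rewrite /r1 !ge_min lexx.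
  have r1r : r1 <= r / n.+1%:R by rewrite /r1 !ge_min lexx !orbT.
  rewrite expr2 -[leRHS]mul1r.
  by apply: ler_pM => //; apply/ltW; exact: lt_le_trans b _.
rewrite sumr_const card_ord -[ltLHS]mulr_natl mulrCA -[ltRHS]mulr1 ltr_pM2l //.
by rewrite ltr_pdivrMr ?ltr0n // mul1r ltr_nat.
Qed.

(** The Hessian is symmetrized because X in a jet is only determined through its quadratic form; the
    term [(2 * eta)%:M] pays for the error of the jet and for the passage to sines. *)
Lemma ujet_test W t x a p X eta : 0 < T -> 0 <= t <= T -> ujet T W t x a p X ->
  0 < eta -> exists e : texp R n,
  [/\ teval e t x = W t x,
      local_max_strip T (fun t' x' => W t' x' - teval e t' x') t x,
      partial T None (teval e) t x = a, gradient T (teval e) t x = p &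
      hessian T (teval e) t x = 2^-1 *: (X + X^T) + (2 * eta)%:M].
Proof.
move=> T0 tT jW eta0; have eta20 : 0 < eta / 2 by rewrite divr_gt0.
have [C [r [r0 hW]]] := jW _ eta20.
pose C' := 2 * (`|C| + `|a|).
exists (jet_texp t x (W t x) a C' eta p X); split.
- exact: teval_jet0.
- pose P1 := \sum_i `|p i 0|; pose X1 := \sum_i \sum_j `|X i j|.
  have P10 : 0 <= P1 by apply: sumr_ge0.
  have X10 : 0 <= X1 by apply: sumr_ge0 => i _; apply: sumr_ge0.
  (* On this scale the sines give back at least 7/8 of eta |v|^2. One half of eta |v|^2 pays for the
     jet, which leaves 3/8 for the errors in p and X. *)
  pose rho := Num.min (4^-1) (3 * eta / (8 * (P1 + X1 + 1))).
  have D0 : 0 < 8 * (P1 + X1 + 1) by rewrite mulr_gt0 // ltr_wpDl // addr_ge0.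
  have rho0 : 0 < rho by rewrite lt_min invr_gt0 ltr0n divr_gt0 // mulr_gt0.
  have rho4 : rho <= 4^-1 by rewrite ge_min lexx.
  have rhoe : rho * (P1 + X1) <= 3 / 8 * eta.
    have : rho * (8 * (P1 + X1 + 1)) <= 3 * eta.
      by rewrite -ler_pdivlMr // ge_min lexx orbT.
    lra.
  pose r1 := Num.min (2^-1) (Num.min r (rho ^+ 2)).
  have r10 : 0 < r1 by rewrite !lt_min invr_gt0 ltr0n r0 exprn_gt0.
  rewrite /local_max_strip; apply: (near_strip r10) => s v sr vr tsT; rewrite [(t + s, _).1]/= [(t + s, _).2]/=.
  have e0 : W t x - teval (jet_texp t x (W t x) a C' eta p X) t x = 0.
    by rewrite teval_jet0 subrr.
  rewrite e0 subr_le0; move: sr vr; rewrite !lt_min => /and3P[s2 sr _] /and3P[v2 vr vrho].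
  apply: le_trans (hW s v sr vr tsT) _; rewrite teval_jet.
  have vi i : `|v i 0| <= rho.
    apply: le_trans (normr_coord_le _ _ _) _; apply: enorm_le; first exact: ltW.
    exact: ltW.
  have xv i : (x + v) i 0 - x i 0 = v i 0 by rewrite mxE addrAC subrr add0r.
  have ts : t + s - t = s by rewrite addrAC subrr add0r.
  rewrite ts; under [X in _ + (_ + (_ + (X + _)))]eq_bigr do rewrite xv.
  under [X in _ + (_ + (_ + (_ + (X + _))))]eq_bigr do under eq_bigr do rewrite !xv.
  under [X in _ + (_ + (_ + (_ + (_ + X))))]eq_bigr do rewrite !xv.
  have hs : a * s + C * s ^+ 2 <= a * sin s + C' * (sin s * sin s).
    exact: (sin_time_jet _ _ (ltW s2)).
  have d1 i : `|v i 0 - sin (v i 0)| <= rho * (v i 0 ^+ 2).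
    by apply: le_trans (sin_near _) _; rewrite mulrC ler_wpM2r ?sqr_ge0.
  have v2N i : v i 0 ^+ 2 <= fdot v v.
    rewrite fdot_cVE (bigD1 i) //= -expr2 lerDl; apply: sumr_ge0 => j _.
    by rewrite -expr2 sqr_ge0.
  have hp : fdot p v <= \sum_i p i 0 * sin (v i 0) + rho * P1 * fdot v v.
    rewrite fdot_cVE /P1 mulrAC mulr_sumr -big_split; apply: ler_sum => i _ /=.
    rewrite -lerBlDl -mulrBr; apply: le_trans (ler_norm _) _.
    rewrite normrM mulrC; apply: ler_wpM2r => //; apply: le_trans (d1 i) _.
    by rewrite ler_wpM2l // ltW.
  have hX : 2^-1 * quad X v <= \sum_i \sum_j 2^-1 * X i j * (sin (v i 0) * sin (v j 0))
      + rho * X1 * fdot v v.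
    rewrite quadE /X1 mulrAC [leLHS]mulr_sumr [X in _ + X]mulr_sumr -big_split; apply: ler_sum => i _ /=.
    rewrite [leLHS]mulr_sumr [X in _ + X]mulr_sumr -big_split; apply: ler_sum => j _ /=.
    rewrite -lerBlDl.
    have -> : 2^-1 * (X i j * v i 0 * v j 0) - 2^-1 * X i j * (sin (v i 0) * sin (v j 0))
      = X i j * (2^-1 * (v i 0 * (v j 0 - sin (v j 0)) + sin (v j 0) * (v i 0 - sin (v i 0)))).
      by ring.
    apply: le_trans (ler_norm _) _; rewrite normrM mulrC; apply: ler_wpM2r => //.
    apply: (sin_product_near (ltW rho0) (vi i) (vi j) _ (v2N i) (v2N j)).
    by rewrite (le_trans rho4) // invf_le1 ?ler1n.
  have hN : 7 / 8 * eta * fdot v v <= \sum_i eta * (sin (v i 0) * sin (v i 0)).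
    rewrite fdot_cVE mulr_sumr; apply: ler_sum => i _.
    rewrite [7 / 8 * eta]mulrC -mulrA ler_pM2l //.
    by rewrite -!expr2; exact: sin_sqr_ge_quarter (le_trans (vi i) rho4).
  have hr : rho * P1 * fdot v v + rho * X1 * fdot v v <= 3 / 8 * eta * fdot v v.
    by rewrite -mulrDl -mulrDr ler_wpM2r ?fdot_ge0.
  move: hp hX hN hr (fdot_ge0 v); move: (fdot v v) (fdot p v) (quad X v) => *; lra.
- by rewrite (teval_partial T0 _ _ _ tT).2 teval_jet_dt.
- by rewrite teval_gradient //; apply/matrixP => i j; rewrite mxE ord1 teval_jet_dx.
- by rewrite teval_hessian //; apply/matrixP => i j; rewrite [LHS]mxE teval_jet_dxx.
Qed.

End JetTest.

(** * Maxima and uniformity on compact sets *)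

Section Compactness.
Context (R : realType).

Definition mxbox (m n : nat) (r : R) : set 'M[R]_(m, n) :=
  [set v | forall i j, `|v i j| <= r].

Lemma mxbox_rV_compact n r : compact (@mxbox 1 n r).
Proof.
have := @rV_compact R n (fun=> `[(- r), r]%classic) (fun=> @segment_compact R _ _).
congr compact; apply/seteqP; split => v /= h i.
  by move=> j; rewrite ord1; have := h j; rewrite in_itv/= ler_norml.
by have := h 0 i; rewrite in_itv/= ler_norml.
Qed.

Lemma mxbox_cV_compact n r : compact (@mxbox n 1 r).
Proof.
have -> : @mxbox n 1 r = trmx @` @mxbox 1 n r.
  apply/seteqP; split => [v h|_ [v h <-] i j]; last by rewrite mxE.
  by exists v^T; [move=> i j; rewrite mxE | rewrite trmxK].
apply: continuous_compact; last exact: mxbox_rV_compact.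
apply: continuous_subspaceT => v P /nbhs_ballP[e /= e0 he].
apply/nbhs_ballP; exists e => // w [_ vw]; apply: he.
by split => // i j; rewrite !mxE; exact: vw.
Qed.

Lemma enorm_mxbox m n (r : R) (v : 'M[R]_(m, n)) : enorm v <= r -> @mxbox m n r v.
Proof. by move=> vr i j; apply: le_trans vr; exact: normr_coord_le. Qed.

Lemma enorm_le_normr m n (v : 'M[R]_(m, n)) : enorm v <= (m * n)%:R * `|v|.
Proof.
have vij i j : `|v i j| <= `|v|.
  rewrite [leRHS]/Num.norm /= mx_normrE; apply/bigmax_geP; right => /=.
  by exists (i, j).
have [m0|m0] := posnP (m * n).
  have -> : v = 0.
    apply/matrixP => i j; exfalso; move: m0 => /eqP; rewrite muln_eq0.
    by move=> /orP[] /eqP e; [case: i | case: j] => k; rewrite e.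
  by rewrite enorm0 m0 mul0r.
apply: enorm_le; first by rewrite mulr_ge0.
apply: (@le_trans _ _ (\sum_(i < m) \sum_(j < n) `|v| ^+ 2)).
  apply: ler_sum => i _; apply: ler_sum => j _.
  by rewrite -expr2 -real_normK ?num_real // lerXn2r ?nnegrE.
rewrite !sumr_const !card_ord -mulrnA -[leLHS]mulr_natl mulnC exprMn.
by rewrite ler_wpM2r ?sqr_ge0 // -natrX ler_nat leq_pmull.
Qed.

Section TimeUniform.
Context (S : topologicalType) (V : normedModType R) (T : R) (K : set S).
Variable f : R -> S -> V.
Hypothesis cK : compact K.
Hypothesis cf : {within [set q : R * S | 0 <= q.1 <= T /\ K q.2],
  continuous (fun q => f q.1 q.2)}.

(** A tube argument: continuity at each (t, u) with u in K gives neighbourhoods, and compactness of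
    K, in the form of near coverings, extracts one time radius. *)
Lemma unif_time t e : 0 <= t <= T -> 0 < e -> exists2 r, 0 < r &
  forall t', 0 <= t' <= T -> `|t' - t| < r -> forall u, K u -> `|f t' u - f t u| <= e.
Proof.
move=> tT e0; have e20 : 0 < e / 2 by rewrite divr_gt0.
move: cf => /subspace_continuousP cfp.
have nc := (near_covering_withinP K).2 ((compact_near_coveringP K).1 cK).
have := nc R (nbhs t) (fun t' u => 0 <= t' <= T -> `|f t' u - f t u| <= e) _.
have h u : K u -> \forall u' \near u & t' \near t,
    K u' -> 0 <= t' <= T -> `|f t' u' - f t u'| <= e.
  move=> Ku; have /cvgrPdist_le/(_ _ e20) := cfp (t, u) (conj tT Ku).
  rewrite /prop_near1 /within /= => -[[A B] [/= At Bu] AB].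
  exists (B, A); first by [].
  move=> [u' t'] [/= Bu' At'] Ku' t'T.
  have h1 : `|f t u - f t' u'| <= e / 2.
    exact: (AB (t', u') (conj At' Bu')).
  have h2 : `|f t u - f t u'| <= e / 2.
    by apply: (AB (t, u') (conj _ Bu')) => //; exact: nbhs_singleton At.
  have := ler_normD (f t' u' - f t u) (f t u - f t u'); rewrite subrKA.
  move: h1; rewrite distrC; lra.
move=> /(_ _ h) /nbhs_ballP[r /= r0 hr]; exists r => // t' t'T t'r u Ku.
by apply: (hr t') => //; rewrite /ball /= distrC.
Qed.

Lemma compact_time_bounded : 0 <= T -> exists2 M, 0 <= M &
  forall t u, 0 <= t <= T -> K u -> `|f t u| <= M.
Proof.
move=> T0; have [[u0 Ku0]|K0] := pselect (K !=set0); last first.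
  by exists 0 => // t u _ Ku; exfalso; apply: K0; exists u.
have c2 : compact [set q : R * S | 0 <= q.1 <= T /\ K q.2].
  have -> : [set q : R * S | 0 <= q.1 <= T /\ K q.2] = `[0, T]%classic `*` K.
    by apply/seteqP; split => -[t u] /=; rewrite in_itv.
  exact: compact_setX (@segment_compact R 0 T) cK.
have ne : [set q : R * S | 0 <= q.1 <= T /\ K q.2] !=set0.
  by exists (0, u0); split => //=; rewrite lexx.
have [|[t0 u0'] _ h] := @compact_EVT_max _ R (fun q => `|f q.1 q.2|) _ ne c2.
  by move=> q; apply: continuous_comp; [exact: cf | exact: norm_continuous].
exists `|f t0 u0'| => // t u tT Ku; apply: (h (t, u)).
by rewrite inE.
Qed.

End TimeUniform.

(** The maximum is taken over a sup norm box, which contains the Euclidean ball; the maximizer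
    itself may therefore lie outside the ball. *)
Lemma strip_max n (a b r : R) (f : R -> 'cV[R]_n -> R) : a <= b -> 0 <= r ->
  {within [set q : R * 'cV[R]_n | a <= q.1 <= b], continuous (fun q => f q.1 q.2)} ->
  exists t x, a <= t <= b /\
    forall t' x', a <= t' <= b -> enorm x' <= r -> f t' x' <= f t x.
Proof.
move=> ab r0 cf; pose K : set (R * 'cV[R]_n) := `[a, b]%classic `*` @mxbox n 1 r.
have cK : compact K.
  apply: compact_setX; [exact: segment_compact | exact: mxbox_cV_compact].
have ne : K !=set0.
  exists (a, 0); split => /=; first by rewrite in_itv/= lexx.
  by move=> i j; rewrite mxE normr0.
have [|[t x] /set_mem[/=]] := @compact_EVT_max _ R (fun q => f q.1 q.2) _ ne cK.
  by apply: continuous_subspaceW cf => -[t x] [/= +] _; rewrite in_itv.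
rewrite in_itv/= => tab _ h; exists t, x; split => // t' x' t'ab x'r.
apply: (h (t', x')); rewrite inE; split => /=; first by rewrite in_itv.
exact: enorm_mxbox.
Qed.

Section StripContinuity.
Context (n : nat) (T : R).
Implicit Types (W : R -> 'cV[R]_n -> R).

Definition ctime W := forall x t e, 0 <= t <= T -> 0 < e -> exists2 r, 0 < r &
  forall t', 0 <= t' <= T -> `|t' - t| < r -> `|W t' x - W t x| <= e.

Lemma continuous_strip_unif W rho t e : continuous_strip T W -> 0 <= t <= T ->
  0 < e -> exists2 r, 0 < r & forall t', 0 <= t' <= T -> `|t' - t| < r ->
    forall x, enorm x <= rho -> `|W t' x - W t x| <= e.
Proof.
move=> cW tT e0.
have cW' : {within [set q : R * 'cV[R]_n | 0 <= q.1 <= T /\ @mxbox n 1 rho q.2],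
    continuous (fun q => W q.1 q.2)}.
  by apply: continuous_subspaceW cW => q [].
have [r r0 hr] := unif_time (@mxbox_cV_compact n rho) cW' tT e0.
exists r => // t' t'T t'r x xr; apply: hr => //; exact: enorm_mxbox.
Qed.

Lemma continuous_strip_ctime W : continuous_strip T W -> ctime W.
Proof.
move=> cW x t e tT e0.
have [r r0 hr] := continuous_strip_unif (enorm x) cW tT e0.
by exists r => // t' t'T t'r; exact: hr.
Qed.

Lemma ctime_continuous_strip W L : (forall t, 0 <= t <= T -> lipf L (W t)) ->
  ctime W -> continuous_strip T W.
Proof.
move=> lW cW; apply/subspace_continuousP => -[t x] /= tT.
apply/cvgrPdist_le => e e0 /=.
have e20 : 0 < e / 2 by rewrite divr_gt0.
have [r r0 hr] := cW x t _ tT e20.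
have L0 : 0 < `|L| + 1 by rewrite ltr_wpDl.
have n0 : 0 < (n * 1)%:R + 1 :> R by rewrite ltr_wpDl.
pose r1 := Num.min r (e / 2 / (`|L| + 1) / ((n * 1)%:R + 1)).
have r10 : 0 < r1 by rewrite lt_min r0 !divr_gt0.
apply/nbhs_ballP; exists r1 => // -[t' x'] [/= bt bx] t'T.
have h1 : `|W t' x - W t x| <= e / 2.
  apply: hr => //; move: bt; rewrite /ball /= distrC => /lt_le_trans; apply.
  by rewrite ge_min lexx.
have h2 : `|W t' x - W t' x'| <= e / 2.
  apply: le_trans (lW _ t'T _ _) _.
  apply: (@le_trans _ _ ((`|L| + 1) * enorm (x - x'))).
    by rewrite ler_wpM2r ?enorm_ge0 // (le_trans (ler_norm L)) // lerDl.
  rewrite mulrC -ler_pdivlMr //; apply: le_trans (enorm_le_normr _) _.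
  have bx' : `|x - x'| <= e / 2 / (`|L| + 1) / ((n * 1)%:R + 1).
    move: bx; rewrite mx_norm_ball /ball_ /= => /ltW/le_trans; apply.
    by rewrite ge_min lexx orbT.
  apply: (@le_trans _ _ (((n * 1)%:R + 1) * `|x - x'|)).
    by rewrite ler_wpM2r // lerDl.
  by rewrite mulrC -ler_pdivlMr.
have := ler_normD (W t x - W t' x) (W t' x - W t' x'); rewrite subrKA.
move: h1; rewrite distrC; lra.
Qed.

End StripContinuity.
End Compactness.

(** * The equation in terms of jets *)

Section Diffusion.
Context (R : realType) (n d : nat).
Implicit Types (s : 'M[R]_(n, d)) (X Y : 'M[R]_n).

Definition dif s X : R := 2^-1 * \sum_j quad X (col j s).

Lemma difD s X Y : dif s (X + Y) = dif s X + dif s Y.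
Proof.
by rewrite /dif -mulrDr -big_split; congr (_ * _); apply: eq_bigr => j _; rewrite quadD.
Qed.

Lemma difZ s c X : dif s (c *: X) = c * dif s X.
Proof.
by rewrite /dif [RHS]mulrCA [c * _]mulr_sumr; congr (_ * _); apply: eq_bigr => j _; rewrite quadZ.
Qed.

Lemma difN s X : dif s (- X) = - dif s X.
Proof. by rewrite -scaleN1r difZ mulN1r. Qed.

Lemma dif_tr s X : dif s X^T = dif s X.
Proof. by congr (_ * _); apply: eq_bigr => j _; rewrite quad_tr. Qed.

Lemma dif_scalar s c : dif s c%:M = 2^-1 * c * fdot s s.
Proof.
rewrite /dif -sum_fdot_col -mulrA; congr (_ * _); rewrite mulr_sumr.
by apply: eq_bigr => j _; rewrite quad_scalar.
Qed.

Lemma quad_abs_le X v : `|quad X v| <= enorm X * fdot v v.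
Proof.
apply: le_trans (fdot_le_enorm _ _) _; rewrite -enorm_sqr expr2 mulrCA ler_wpM2l ?enorm_ge0 //.
by apply: le_trans (enorm_mulmx _ _) _; rewrite mulrC.
Qed.

Lemma dif_abs_le s X : `|dif s X| <= enorm X * fdot s s.
Proof.
rewrite /dif normrM ger0_norm ?invr_ge0 //.
have : `|\sum_j quad X (col j s)| <= enorm X * fdot s s.
  rewrite -sum_fdot_col mulr_sumr; apply: le_trans (ler_norm_sum _ _ _) _.
  by apply: ler_sum => j _; exact: quad_abs_le.
have := normr_ge0 (\sum_j quad X (col j s)); lra.
Qed.

Lemma dif_le s X y : (forall v, quad X v <= y * fdot v v) ->
  dif s X <= 2^-1 * y * fdot s s.
Proof.
move=> h; rewrite /dif -sum_fdot_col -mulrA ler_wpM2l ?invr_ge0 // mulr_sumr.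
by apply: ler_sum => j _; exact: h.
Qed.

End Diffusion.

Section ViscosityJets.
Context (R : realType) (n d k : nat) (T : R) (U : set 'cV[R]_k).
Context (b : R -> 'cV[R]_n -> R -> 'rV[R]_d -> 'cV[R]_k -> 'cV[R]_n).
Context (sigma : R -> 'cV[R]_n -> 'cV[R]_k -> 'M[R]_(n, d)).
Context (g : R -> 'cV[R]_n -> R -> 'rV[R]_d -> 'cV[R]_k -> R).
Context (phi : 'cV[R]_n -> R).

Definition fterm t x v (p : 'cV[R]_n) u : R :=
  fdot p (b t x v (p^T *m sigma t x u) u) + g t x v (p^T *m sigma t x u) u.

Lemma hamiltonianE t x v p A u :
  hamiltonian b sigma g t x v p A u = dif (sigma t x u) A + fterm t x v p u.
Proof. by rewrite /hamiltonian mxtrace_quad -fdot_cV -addrA. Qed.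

Hypothesis T0 : 0 < T.
Hypothesis U0 : U !=set0.
Hypothesis sigma_bdd : forall t x, 0 <= t <= T ->
  exists S, forall u, U u -> fdot (sigma t x u) (sigma t x u) <= S.
Hypothesis fterm_bdd : forall t x v p, 0 <= t <= T ->
  exists M, forall u, U u -> `|fterm t x v p u| <= M.

(** [inf] returns a default value on sets that are empty or not bounded below, so the infimum in the
    equation only carries information once this is known. *)
Lemma hamiltonian_has_inf t x v p A : 0 <= t <= T ->
  has_inf [set hamiltonian b sigma g t x v p A u | u in U].
Proof.
move=> tT; split; first by have [u Uu] := U0; eexists; exists u.
have [S hS] := sigma_bdd x tT; have [M hM] := fterm_bdd x v p tT.
exists (- (enorm A * S) - M) => _ [u Uu <-]; rewrite hamiltonianE.
have h1 := le_trans (dif_abs_le (sigma t x u) A) (ler_wpM2l (enorm_ge0 A) (hS _ Uu)).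
by have := hM _ Uu; move: h1; rewrite !ler_norml; lra.
Qed.

(** A nonnegative infimum bounds every control. The perturbation of the Hessian by [eta] costs eta
    |sigma|^2, which is made smaller than any e since sigma(t, x, .) is bounded. *)
Lemma viscosity_sub_ujet W t x a p X :
  viscosity_subsolution T U b sigma g phi W -> 0 <= t < T ->
  ujet T W t x a p X -> forall u, U u ->
  0 <= a + dif (sigma t x u) X + fterm t x (W t x) p u.
Proof.
move=> [_ _ visc] /andP[t0 tT] jW u Uu; have tT' : 0 <= t <= T by rewrite t0 ltW.
have [S hS] := sigma_bdd x tT'.
have S0 : 0 <= S by apply: le_trans (hS _ Uu); exact: fdot_ge0.
apply/ler_addgt0Pr => e e0.
have eta0 : 0 < e / (S + 1) by rewrite divr_gt0 // ltr_wpDl.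
have [f [f0 fmax fdt fdx fdxx]] := ujet_test T0 tT' jW eta0.
have := visc _ (teval_Cb23 T0 f) t x; rewrite t0 tT => /(_ isT (esym f0) fmax).
rewrite /hjb_lhs fdt fdx fdxx f0 => h.
have hi := hamiltonian_has_inf x (W t x) p
  (2^-1 *: (X + X^T) + (2 * (e / (S + 1)))%:M) tT'.
have := ge_inf hi.2; move=> /(_ _ (imageP _ Uu)).
rewrite hamiltonianE difD difZ difD dif_tr dif_scalar.
have : e / (S + 1) * fdot (sigma t x u) (sigma t x u) <= e.
  rewrite mulrAC ler_pdivrMr ?ltr_wpDl // ler_wpM2l ?(ltW e0) //.
  by apply: le_trans (hS _ Uu) _; rewrite lerDl.
by move: h; lra.
Qed.

(** Written for superjets of - W so that the later arguments treat W1 and - W2 alike; hence the sign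
    of p. Only a control that almost attains the infimum is available, which explains the slack
    e. *)
Lemma viscosity_super_ujet W t x a p X :
  viscosity_supersolution T U b sigma g phi W -> 0 <= t < T ->
  ujet T (fun t x => - W t x) t x a p X -> forall e, 0 < e ->
  exists2 u, U u & - e <= a + dif (sigma t x u) X - fterm t x (W t x) (- p) u.
Proof.
move=> [_ _ visc] /andP[t0 tT] jW e e0; have tT' : 0 <= t <= T by rewrite t0 ltW.
have [S hS] := sigma_bdd x tT'; have [u0 Uu0] := U0.
have S0 : 0 <= S by apply: le_trans (hS _ Uu0); exact: fdot_ge0.
pose eta := e / 2 / (S + 1).
have eta0 : 0 < eta by rewrite !divr_gt0 // ltr_wpDl.
have [f [f0 fmax fdt fdx fdxx]] := ujet_test T0 tT' jW eta0.
pose nf : texp R n := TMul (TCst n (-1)) f.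
have nfE t' x' : teval nf t' x' = - teval f t' x' by rewrite /= mulN1r.
have nf0 : teval nf t x = W t x by rewrite nfE f0 opprK.
have nfdt : partial T None (teval nf) t x = - a.
  by rewrite (teval_partial T0 _ _ _ tT').2 /= -fdt (teval_partial T0 _ _ _ tT').2; ring.
have nfdx : gradient T (teval nf) t x = - p.
  by rewrite -fdx !teval_gradient //; apply/matrixP => i j; rewrite !mxE /=; ring.
have nfdxx : hessian T (teval nf) t x = - (2^-1 *: (X + X^T) + (2 * eta)%:M).
  by rewrite -fdxx !teval_hessian //; apply/matrixP => i j; rewrite !mxE /=; ring.
have nfmin : local_min_strip T (fun t' x' => W t' x' - teval nf t' x') t x.
  apply: filterS fmax => q; rewrite !nfE; lra.
have := visc _ (teval_Cb23 T0 nf) t x; rewrite t0 tT => /(_ isT (esym nf0) nfmin).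
rewrite /hjb_lhs nfdt nfdx nfdxx nf0 => h.
have hi := hamiltonian_has_inf x (W t x) (- p)
  (- (2^-1 *: (X + X^T) + (2 * eta)%:M)) tT'.
have e20 : 0 < e / 2 by rewrite divr_gt0.
have [_ [u Uu <-]] := inf_adherent e20 hi.
rewrite hamiltonianE difN difD difZ difD dif_tr dif_scalar => hu; exists u => //.
have : eta * fdot (sigma t x u) (sigma t x u) <= e / 2.
  rewrite /eta mulrAC ler_pdivrMr ?ltr_wpDl // ler_wpM2l ?(ltW e20) //.
  by apply: le_trans (hS _ Uu) _; rewrite lerDl.
by move: h hu; lra.
Qed.

End ViscosityJets.

Lemma continuous_pair (X Y Z : topologicalType) (f : X -> Y) (g : X -> Z) :
  continuous f -> continuous g -> continuous (fun x => (f x, g x)).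
Proof. by move=> cf cg x; apply: cvg_pair; [exact: cf | exact: cg]. Qed.

Lemma within_continuous_comp (X Y Z : topologicalType) (A : set X) (B : set Y)
    (h : X -> Y) (f : Y -> Z) :
  continuous h -> (forall x, A x -> B (h x)) -> {within B, continuous f} ->
  {within A, continuous (fun x => f (h x))}.
Proof.
move=> ch AB /subspace_continuousP cf; apply/subspace_continuousP => x Ax P fP.
have hP : nbhs (h x) [set y | B y -> P (f y)] by exact: cf _ (AB _ Ax) P fP.
have hx : nbhs x (h @^-1` [set y | B y -> P (f y)]) by exact: ch.
by apply: filterS hx => y /= hy /AB /hy.
Qed.

(** * Growth and continuity of the coefficients *)

Section Coefficients.
Context (R : realType) (n d k : nat) (T : R) (U : set 'cV[R]_k).
Context (b : R -> 'cV[R]_n -> R -> 'rV[R]_d -> 'cV[R]_k -> 'cV[R]_n).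
Context (sigma : R -> 'cV[R]_n -> 'cV[R]_k -> 'M[R]_(n, d)).
Context (g : R -> 'cV[R]_n -> R -> 'rV[R]_d -> 'cV[R]_k -> R).
Context (phi : 'cV[R]_n -> R).

Definition lip_coefs (L : R) := forall s u, 0 <= s <= T -> U u ->
  forall x1 x2 y1 y2 z1 z2,
  [/\ enorm (b s x1 y1 z1 u - b s x2 y2 z2 u)
        <= L * (enorm (x1 - x2) + `|y1 - y2| + enorm (z1 - z2)),
      enorm (sigma s x1 u - sigma s x2 u) <= L * enorm (x1 - x2) &
      `|g s x1 y1 z1 u - g s x2 y2 z2 u|
        <= L * (enorm (x1 - x2) + `|y1 - y2| + enorm (z1 - z2))].

Lemma lipschitz_condition_lip_coefs : lipschitz_condition T U b sigma g phi ->
  exists2 L, 0 <= L & lip_coefs L.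
Proof.
move=> [_ [L1 [L2 [L10 [L20 h]]]]]; exists (L1 + L2); first by lra.
move=> s u sT Uu x1 x2 y1 y2 z1 z2; have [h1 h2 h3 _] := h s u sT Uu x1 x2 y1 y2 z1 z2.
have := enorm_ge0 (x1 - x2); have := normr_ge0 (y1 - y2).
have := enorm_ge0 (z1 - z2) => ? ? ?; split.
- by apply: le_trans h1 _; rewrite mulrDl !mulrDr; have := mulr_ge0 (ltW L20);
    move=> m; have := m _ (enorm_ge0 (x1 - x2)); have := mulr_ge0 (ltW L10);
    move=> m'; have := m' _ (normr_ge0 (y1 - y2)); have := m' _ (enorm_ge0 (z1 - z2)); lra.
- by apply: le_trans h2 _; rewrite ler_wpM2r // lerDl ltW.
- by apply: le_trans h3 _; rewrite ler_wpM2r ?addr_ge0 // lerDl ltW.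
Qed.

Variable L : R.
Hypothesis T0 : 0 <= T.
Hypothesis L0 : 0 <= L.
Hypothesis lip : lip_coefs L.
Hypothesis cU : compact U.
Hypothesis cc : continuous_coefficients T U b sigma g phi.

Let ctsigma x : {within [set q : R * 'cV[R]_k | 0 <= q.1 <= T /\ U q.2],
  continuous (fun q => sigma q.1 x q.2)}.
Proof.
have [_ cs _ _] := cc.
apply: (@within_continuous_comp _ _ _ _ _
  (fun q : R * 'cV[R]_k => (q.1, x, q.2)) _ _ _ cs) => //.
apply: continuous_pair; last by move=> ?; exact: cvg_snd.
by apply: continuous_pair => ?; [exact: cvg_fst | exact: cvg_cst].
Qed.

Let cpair x v : continuous (fun q : R * ('rV[R]_d * 'cV[R]_k) =>
  (q.1, x : 'cV[R]_n, v : R, q.2.1, q.2.2)).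
Proof.
apply: continuous_pair; last first.
  by move=> q; apply: (@continuous_comp _ _ _ snd snd); exact: cvg_snd.
apply: continuous_pair; last first.
  by move=> q; apply: (@continuous_comp _ _ _ snd fst); [exact: cvg_snd | exact: cvg_fst].
apply: continuous_pair; last by move=> ?; exact: cvg_cst.
by apply: continuous_pair => ?; [exact: cvg_fst | exact: cvg_cst].
Qed.

Let ctb x v r : {within [set q : R * ('rV[R]_d * 'cV[R]_k) |
    0 <= q.1 <= T /\ (@mxbox R 1 d r `*` U) q.2],
  continuous (fun q => b q.1 x v q.2.1 q.2.2)}.
Proof.
have [cb _ _ _] := cc.
apply: (@within_continuous_comp _ _ _ _ _
  (fun q : R * ('rV[R]_d * 'cV[R]_k) => (q.1, x, v, q.2.1, q.2.2)) _ _ _ cb).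
  exact: cpair.
by move=> q [qT [_ Uq]].
Qed.

Let ctg x v r : {within [set q : R * ('rV[R]_d * 'cV[R]_k) |
    0 <= q.1 <= T /\ (@mxbox R 1 d r `*` U) q.2],
  continuous (fun q => g q.1 x v q.2.1 q.2.2)}.
Proof.
have [_ _ cg _] := cc.
apply: (@within_continuous_comp _ _ _ _ _
  (fun q : R * ('rV[R]_d * 'cV[R]_k) => (q.1, x, v, q.2.1, q.2.2)) _ _ _ cg).
  exact: cpair.
by move=> q [qT [_ Uq]].
Qed.

Let cKU r : compact (@mxbox R 1 d r `*` U).
Proof. exact: compact_setX (@mxbox_rV_compact R d r) cU. Qed.

Lemma coefs_bounded : exists2 B, 0 <= B & forall t u, 0 <= t <= T -> U u ->
  [/\ enorm (sigma t 0 u) <= B, enorm (b t 0 0 0 u) <= B & `|g t 0 0 0 u| <= B].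
Proof.
have [M1 M10 h1] := @compact_time_bounded R _ _ T _ (fun t u => sigma t 0 u) cU (@ctsigma 0) T0.
have [M2 M20 h2] := @compact_time_bounded R _ _ T _ (fun t q => b t 0 0 q.1 q.2) (@cKU 0) (@ctb 0 0 0) T0.
have [M3 M30 h3] := @compact_time_bounded R _ R T _ (fun t q => g t 0 0 q.1 q.2) (@cKU 0) (@ctg 0 0 0) T0.
exists ((n * d)%:R * M1 + (n * 1)%:R * M2 + M3).
  by rewrite !addr_ge0 ?mulr_ge0.
move=> t u tT Uu.
have n1 : 0 <= (n * d)%:R * M1 by rewrite mulr_ge0.
have n2 : 0 <= (n * 1)%:R * M2 by rewrite mulr_ge0.
have z0 : (@mxbox R 1 d 0 `*` U) (0, u) by split => // i j; rewrite mxE normr0.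
split.
- apply: le_trans (enorm_le_normr _) _.
  have : (n * d)%:R * `|sigma t 0 u| <= (n * d)%:R * M1 by rewrite ler_wpM2l // h1.
  lra.
- apply: le_trans (enorm_le_normr _) _.
  have : (n * 1)%:R * `|b t 0 0 0 u| <= (n * 1)%:R * M2.
    by rewrite ler_wpM2l // (h2 t (0, u)).
  lra.
- have := h3 t (0, u) tT z0; rewrite /=; lra.
Qed.

Section Growth.
Variable B : R.
Hypothesis bdd : forall t u, 0 <= t <= T -> U u ->
  [/\ enorm (sigma t 0 u) <= B, enorm (b t 0 0 0 u) <= B & `|g t 0 0 0 u| <= B].

Lemma sigma_growth t x u : 0 <= t <= T -> U u -> enorm (sigma t x u) <= B + L * enorm x.
Proof.
move=> tT Uu; have [hs _ _] := bdd tT Uu.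
have [_ + _] := lip tT Uu x 0 0 0 0 0; rewrite subr0 => h.
by rewrite -(subrK (sigma t 0 u) (sigma t x u)); apply: le_trans (enormD _ _) _; lra.
Qed.

Lemma b_growth t x v z u : 0 <= t <= T -> U u ->
  enorm (b t x v z u) <= B + L * (enorm x + `|v| + enorm z).
Proof.
move=> tT Uu; have [_ hb _] := bdd tT Uu.
have [+ _ _] := lip tT Uu x 0 v 0 z 0; rewrite !subr0 => h.
by rewrite -(subrK (b t 0 0 0 u) (b t x v z u)); apply: le_trans (enormD _ _) _; lra.
Qed.

Lemma g_growth t x v z u : 0 <= t <= T -> U u ->
  `|g t x v z u| <= B + L * (enorm x + `|v| + enorm z).
Proof.
move=> tT Uu; have [_ _ hb] := bdd tT Uu.
have [_ _] := lip tT Uu x 0 v 0 z 0; rewrite !subr0 => h.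
by rewrite -(subrK (g t 0 0 0 u) (g t x v z u)); apply: le_trans (ler_normD _ _) _; lra.
Qed.

Lemma fterm_growth t x v p : 0 <= t <= T ->
  exists M, forall u, U u -> `|fterm b sigma g t x v p u| <= M.
Proof.
move=> tT; pose Z := enorm p * (B + L * enorm x).
pose Bb := B + L * (enorm x + `|v| + Z).
exists (enorm p * Bb + Bb) => u Uu.
have hz : enorm (p^T *m sigma t x u) <= Z.
  apply: le_trans (enorm_mulmx _ _) _; rewrite enorm_trmx ler_wpM2l ?enorm_ge0 //.
  exact: sigma_growth.
have le_Bb : B + L * (enorm x + `|v| + enorm (p^T *m sigma t x u)) <= Bb.
  by rewrite lerD2l ler_wpM2l // lerD2l.
apply: le_trans (ler_normD _ _) _; apply: lerD.
  apply: le_trans (fdot_le_enorm _ _) _; rewrite ler_wpM2l ?enorm_ge0 //.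
  exact: le_trans (b_growth _ _ _ tT Uu) le_Bb.
exact: le_trans (g_growth _ _ _ tT Uu) le_Bb.
Qed.

End Growth.

Lemma fterm_lip (P t : R) u x y v w p q : 0 <= t <= T -> U u -> enorm p <= P ->
  `|fterm b sigma g t y w p u - fterm b sigma g t x v q u| <=
  (P + 1) * L * (1 + P * L) * (enorm (y - x) + `|w - v|) +
  (enorm (b t x v (q^T *m sigma t x u) u) + (P + 1) * L * enorm (sigma t x u))
    * enorm (p - q).
Proof.
move=> tT Uu pP; have P0 : 0 <= P by apply: le_trans pP; exact: enorm_ge0.
rewrite /fterm; set zp := p^T *m _; set zq := q^T *m _.
have [hb hs hg] := lip tT Uu y x w v zp zq.
have hz : enorm (zp - zq) <= P * (L * enorm (y - x)) + enorm (p - q) * enorm (sigma t x u).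
  have -> : zp - zq = p^T *m (sigma t y u - sigma t x u) + (p - q)^T *m sigma t x u.
    by rewrite mulmxBr linearB /= mulmxBl addrA subrK.
  apply: le_trans (enormD _ _) _; apply: lerD; apply: le_trans (enorm_mulmx _ _) _.
    by rewrite enorm_trmx; apply: ler_pM; rewrite ?enorm_ge0.
  by rewrite enorm_trmx.
set Y := enorm (y - x) in hb hs hg hz *; set D := enorm (p - q) in hz *.
set S := enorm (sigma t x u) in hz *; set Wv := `|w - v| in hb hg *.
set bq := b t x v zq u in hb *; set bp := b t y w zp u in hb *.
have Y0 : 0 <= Y by exact: enorm_ge0.
have D0 : 0 <= D by exact: enorm_ge0.
have S0 : 0 <= S by exact: enorm_ge0.
have W0 : 0 <= Wv by exact: normr_ge0.
pose E := L * (Y + Wv + (P * (L * Y) + D * S)).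
have hb' : enorm (bp - bq) <= E.
  by apply: le_trans hb _; rewrite ler_wpM2l // lerD2l.
have hg' : `|g t y w zp u - g t x v zq u| <= E.
  by apply: le_trans hg _; rewrite ler_wpM2l // lerD2l.
have h1 : `|fdot p (bp - bq)| <= P * E.
  by apply: le_trans (fdot_le_enorm _ _) _; apply: ler_pM; rewrite ?enorm_ge0.
have h2 : `|fdot (p - q) bq| <= D * enorm bq by exact: fdot_le_enorm.
have e : fdot p bp + g t y w zp u - (fdot q bq + g t x v zq u) =
    fdot p (bp - bq) + fdot (p - q) bq + (g t y w zp u - g t x v zq u).
  by rewrite fdotBr fdotBl; ring.
rewrite e; apply: le_trans (ler_normD _ _) _.
apply: le_trans (lerD (ler_normD _ _) (lexx _)) _.
have eE : P * E + E = (P + 1) * L * ((1 + P * L) * Y + Wv) + (P + 1) * L * S * D.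
  by rewrite /E; ring.
have : (P + 1) * L * ((1 + P * L) * Y + Wv) <= (P + 1) * L * (1 + P * L) * (Y + Wv).
  rewrite -[leRHS]mulrA ler_wpM2l ?mulr_ge0 ?addr_ge0 // mulrDr lerD2l.
  by rewrite ler_peMl // lerDl mulr_ge0.
move: h1 h2 hg' eE; lra.
Qed.

(** Continuity in time, uniform in the control. The argument z = p sigma of b and g moves with t and
    u, but it stays in a bounded box; b and g are compared at a fixed z over box times U, and the
    motion of z is absorbed by their Lipschitz constant. *)
Lemma coefs_time_modulus t x v p e : 0 <= t <= T -> 0 < e -> exists2 r, 0 < r &
  forall t', 0 <= t' <= T -> `|t' - t| < r -> forall u, U u ->
  enorm (sigma t' x u - sigma t x u) <= e /\
  `|fterm b sigma g t' x v p u - fterm b sigma g t x v p u| <= e.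
Proof.
move=> tT e0; pose P := enorm p; have P0 : 0 <= P by exact: enorm_ge0.
have [B B0 bdd] := coefs_bounded.
pose Z := P * (B + L * enorm x).
(* The factor by which a modulus e1 of sigma, b and g separately is amplified in the first order
   term. *)
pose K := (P + 1) * (L * P + 1).
have LP0 : 0 <= L * P by rewrite mulr_ge0.
have K1 : 1 <= K by rewrite /K; nra.
have K0 : 0 < K by lra.
pose N1 := (n * d)%:R + 1 : R; have N10 : 0 < N1 by rewrite ltr_wpDl.
pose N2 := (n * 1)%:R + 1 : R; have N20 : 0 < N2 by rewrite ltr_wpDl.
pose e1 := e / K; have e10 : 0 < e1 by rewrite divr_gt0.
have e1N1 : 0 < e1 / N1 by rewrite divr_gt0.
have e1N2 : 0 < e1 / N2 by rewrite divr_gt0.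
have [r1 r10 h1] := @unif_time R _ _ T _ (fun t u => sigma t x u) cU (@ctsigma x) _ _ tT e1N1.
have [r2 r20 h2] := @unif_time R _ _ T _ (fun t q => b t x v q.1 q.2) (@cKU Z) (@ctb x v Z) _ _ tT e1N2.
have [r3 r30 h3] := @unif_time R _ R T _ (fun t q => g t x v q.1 q.2) (@cKU Z) (@ctg x v Z) _ _ tT e10.
exists (Num.min r1 (Num.min r2 r3)); first by rewrite !lt_min r10 r20.
move=> t' t'T; rewrite !lt_min => /and3P[t1 t2 t3] u Uu.
have hs : enorm (sigma t' x u - sigma t x u) <= e1.
  apply: le_trans (enorm_le_normr _) _; have := h1 _ t'T t1 _ Uu; rewrite ler_pdivlMr // => h.
  apply: le_trans h; rewrite mulrC ler_wpM2l // lerDl //.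
split; first by apply: le_trans hs _; rewrite /e1 ler_pdivrMr // ler_peMr // ltW.
rewrite /fterm; set z := p^T *m sigma t x u; set z' := p^T *m sigma t' x u.
have zz : enorm (z' - z) <= P * e1.
  rewrite -mulmxBr; apply: le_trans (enorm_mulmx _ _) _.
  by rewrite enorm_trmx ler_wpM2l.
have zK : (@mxbox R 1 d Z `*` U) (z, u).
  split => //=; apply: enorm_mxbox; apply: le_trans (enorm_mulmx _ _) _.
  by rewrite enorm_trmx ler_wpM2l // (sigma_growth bdd).
have [hb _ hg] := lip t'T Uu x x v v z' z.
move: hb hg; rewrite !subrr enorm0 normr0 !add0r => hb hg.
have hb2 : enorm (b t' x v z u - b t x v z u) <= e1.
  apply: le_trans (enorm_le_normr _) _; have := h2 _ t'T t2 _ zK; rewrite ler_pdivlMr //= => h.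
  by apply: le_trans h; rewrite mulrC ler_wpM2l // lerDl.
have hg2 : `|g t' x v z u - g t x v z u| <= e1 by have := h3 _ t'T t3 _ zK.
have LPe : L * enorm (z' - z) <= L * (P * e1) by rewrite ler_wpM2l.
have hbb : enorm (b t' x v z' u - b t x v z u) <= L * (P * e1) + e1.
  rewrite -(subrKA (b t' x v z u)); apply: le_trans (enormD _ _) _; lra.
have hgg : `|g t' x v z' u - g t x v z u| <= L * (P * e1) + e1.
  rewrite -(subrKA (g t' x v z u)); apply: le_trans (ler_normD _ _) _; lra.
have hp : `|fdot p (b t' x v z' u - b t x v z u)| <= P * (L * (P * e1) + e1).
  by apply: le_trans (fdot_le_enorm _ _) _; rewrite ler_wpM2l.
have -> : fdot p (b t' x v z' u) + g t' x v z' u - (fdot p (b t x v z u) + g t x v z u)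
  = fdot p (b t' x v z' u - b t x v z u) + (g t' x v z' u - g t x v z u).
  by rewrite fdotBr; ring.
apply: le_trans (ler_normD _ _) _.
have -> : e = P * (L * (P * e1) + e1) + (L * (P * e1) + e1).
  transitivity (e1 * K); first by rewrite /e1 divfK // gt_eqF.
  by rewrite /K; ring.
exact: lerD.
Qed.

End Coefficients.

(** * One backward step with constant coefficients *)

Section OneStepScalars.
Context (R : realType).

(** To be read with W = |w|^2, D = v.w and N = |v|^2. The left side collects what is left after the
    second order expansion of c4 |v + w|^4 and the mixed terms in time and space of B (t1 - t) |v +
    w|^2. By Young's inequality it fits into the error that [ujet] allows. *)
Lemma quartic_remainder (c4 B N eta : R) : 0 <= c4 -> 0 <= B -> 0 <= N -> 0 < eta ->
  exists K r, 0 < r /\ forall s W D : R, `|s| < r -> 0 <= W < r -> D ^+ 2 <= N * W ->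
  c4 * (4 * D * W + W ^+ 2) - s * B * (2 * D + W) <= K * s ^+ 2 + eta * W.
Proof.
move=> c40 B0 N0 eta0.
pose rho := eta / (16 * (c4 + 1)).
have rho0 : 0 < rho by rewrite divr_gt0 // mulr_gt0 // ltr_wpDl.
have rhoE : c4 * rho <= eta / 16.
  rewrite /rho mulrA ler_pdivrMr ?mulr_gt0 ?ltr_wpDl //; nra.
pose K := 4 * (B * N + 1) / eta.
have BN0 : 0 <= B * N by rewrite mulr_ge0.
have K0 : 0 < K by rewrite divr_gt0 // mulr_gt0 // ltr_wpDl.
pose r := Num.min (rho ^+ 2 / (N + 1)) (Num.min rho (eta / (4 * (B + 1)))).
have r0 : 0 < r.
  have h1 : 0 < rho ^+ 2 / (N + 1) by rewrite divr_gt0 ?exprn_gt0 // ltr_wpDl.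
  have h2 : 0 < eta / (4 * (B + 1)) by rewrite divr_gt0 // mulr_gt0 // ltr_wpDl.
  by rewrite !lt_min rho0 h1 h2.
exists (B * K), r; split => // s W D sr /andP[W0 Wr] DW.
have r1 : r <= rho ^+ 2 / (N + 1) by rewrite ge_min lexx.
have r2 : r <= rho by rewrite /r !ge_min lexx orbT.
have r3 : r <= eta / (4 * (B + 1)) by rewrite /r !ge_min lexx !orbT.
have N1 : 0 < N + 1 by rewrite ltr_wpDl.
have Drho : D <= rho.
  have : D ^+ 2 <= rho ^+ 2.
    apply: le_trans DW _; move: r1; rewrite ler_pdivlMr // => h.
    apply: le_trans h; rewrite mulrC; apply: ler_pM => //; first exact: ltW.
    by rewrite lerDl.
  rewrite -ler_sqrt ?sqr_ge0 // !sqrtr_sqr (gtr0_norm rho0); exact: le_trans (ler_norm _).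
have e1 : c4 * (4 * D * W) <= eta / 4 * W.
  have : c4 * D <= c4 * rho by rewrite ler_wpM2l.
  nra.
have e2 : c4 * W ^+ 2 <= eta / 16 * W.
  have : c4 * W <= c4 * rho by rewrite ler_wpM2l // (le_trans (ltW Wr)).
  rewrite expr2; nra.
have e3 : - (s * B * W) <= eta / 4 * W.
  have h : `|s| * (4 * (B + 1)) <= eta.
    rewrite -ler_pdivlMr ?mulr_gt0 ?ltr_wpDl //; exact: ltW (lt_le_trans sr r3).
  have h2 : - s * B <= eta / 4.
    have : - s <= `|s| by rewrite -normrN ler_norm.
    have := normr_ge0 s; nra.
  by rewrite -mulNr -mulNr ler_wpM2r.
have e4 : - (s * B * (2 * D)) <= B * K * s ^+ 2 + eta / 4 * W.
  have h : - (2 * s * D) <= K * s ^+ 2 + D ^+ 2 / K.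
    have : 0 <= (K * s + D) ^+ 2 / K by rewrite divr_ge0 ?sqr_ge0 // ltW.
    have -> : (K * s + D) ^+ 2 / K = K * s ^+ 2 + 2 * s * D + D ^+ 2 / K.
      by field; rewrite gt_eqF.
    lra.
  have h2 : B * (D ^+ 2 / K) <= eta / 4 * W.
    apply: (@le_trans _ _ (B * (N * W / K))).
      by rewrite ler_wpM2l // ler_wpM2r // invr_ge0 ltW.
    have -> : B * (N * W / K) = (B * N / K) * W by rewrite !mulrA mulrAC -!mulrA; ring.
    rewrite ler_wpM2r // ler_pdivrMr // /K.
    have -> : eta / 4 * (4 * (B * N + 1) / eta) = B * N + 1 by field; rewrite gt_eqF.
    by rewrite lerDl.
  have : B * - (2 * s * D) <= B * (K * s ^+ 2 + D ^+ 2 / K) by rewrite ler_wpM2l.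
  lra.
have : 0 <= eta * W by rewrite mulr_ge0 // ltW.
lra.
Qed.

(** Second order expansion in time of the penalty M / (t - t0) used in [one_step]. *)
Lemma inv_expansion (M tau s : R) : 0 <= M -> 0 < tau -> `|s| <= tau / 2 ->
  M / (tau + s) <= M / tau - M / tau ^+ 2 * s + 2 * M / tau ^+ 3 * s ^+ 2.
Proof.
move=> M0 tau0; rewrite ler_norml => /andP[s1 s2].
have ts : 0 < tau + s by lra.
have t3 : 0 < tau ^+ 3 by rewrite exprn_gt0.
rewrite -subr_ge0.
have -> : M / tau - M / tau ^+ 2 * s + 2 * M / tau ^+ 3 * s ^+ 2 - M / (tau + s) =
  M * s ^+ 2 * (tau + 2 * s) / (tau ^+ 3 * (tau + s)).
  by field; rewrite !gt_eqF.
have h : 0 <= tau + 2 * s by lra.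
apply: divr_ge0; last by apply: mulr_ge0; exact: ltW.
by apply: mulr_ge0 => //; apply: mulr_ge0 => //; exact: sqr_ge0.
Qed.

End OneStepScalars.

Lemma fdot_continuous (R : realType) (n : nat) (Y : topologicalType)
    (h h' : Y -> 'cV[R]_n) :
  continuous h -> continuous h' -> continuous (fun z => fdot (h z) (h' z)).
Proof.
move=> ch ch'; under eq_fun do rewrite fdot_cVE.
apply: continuous_sumr => i z.
apply: cvgM; apply: (@continuous_comp _ _ _ _ (fun v : 'cV[R]_n => v i 0)).
- exact: ch.
- exact: coord_continuous.
- exact: ch'.
- exact: coord_continuous.
Qed.

Lemma quad_continuous (R : realType) (n : nat) (Y : topologicalType)
    (X : 'M[R]_n) (h : Y -> 'cV[R]_n) :
  continuous h -> continuous (fun z => quad X (h z)).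
Proof.
move=> ch; under eq_fun do rewrite quadE.
have cc j : continuous (fun z => h z j 0).
  move=> z; apply: (@continuous_comp _ _ _ _ (fun v : 'cV[R]_n => v j 0)).
    exact: ch.
  exact: coord_continuous.
apply: continuous_sumr => i; apply: continuous_sumr => j z.
apply: cvgM; last exact: cc.
by apply: cvgM; [exact: cvg_cst | exact: cc].
Qed.

Section OneStep.
Context (R : realType) (n d : nat) (T : R) (I : Type).
Context (s : I -> 'M[R]_(n, d)) (c : I -> R) (S ce : R) (xh : 'cV[R]_n).
Hypothesis sS : forall i, fdot (s i) (s i) <= S.
Hypothesis S0 : 0 <= S.
Hypothesis ce0 : 0 <= ce.

(** For some index up to every e > 0, i.e. the supremum over i is nonnegative. A single index
    encodes one linear equation, as satisfied by a subsolution for each fixed control; the type of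
    all controls encodes the inequality of a supersolution. *)
Definition subjet V (t0 t1 : R) := forall t, t0 < t < t1 -> forall (x : 'cV[R]_n) a p X,
  ujet T V t x a p X -> forall e, 0 < e -> exists i,
  - e <= a + (dif (s i) X + c i) + ce * fdot (x - xh) (x - xh).

Lemma dif_outer (m : 'M[R]_(n, d)) (v : 'cV[R]_n) : dif m (v *m v^T) <= 2^-1 * fdot v v * fdot m m.
Proof. by apply: dif_le => w; rewrite quad_outer fdot_CS. Qed.

(** Comparison with an explicit barrier q whose time slope is l' plus a multiple of |x - x0|^2. Its
    quartic term dominates the quadratic growth of V and matches the error form eta |v|^2 + |v|^4 /
    eta, in which every cubic remainder can be written; with eta = sqrt(t1 - t0) the total error is
    of order (t1 - t0)^(3/2). *)
Lemma one_step V t0 t1 x0 f0 p X C eta l :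
  0 <= t0 -> t0 < t1 -> t1 <= T -> ctime T V ->
  {within [set q : R * 'cV[R]_n | t0 <= q.1 <= t1], continuous (fun q => V q.1 q.2)} ->
  (exists G, forall t x, t0 <= t <= t1 -> V t x <= G * (1 + fdot x x)) ->
  subjet V t0 t1 -> 0 < C -> 0 < eta ->
  (forall v, V t1 (x0 + v) <= f0 + fdot p v + 2^-1 * quad X v +
      C * (eta * fdot v v + fdot v v ^+ 2 / eta)) ->
  (forall i, dif (s i) X + c i <= l) ->
  V t0 x0 <= f0 + (t1 - t0) * (l + 2 * ce * fdot (x0 - xh) (x0 - xh) +
    (C * eta * S + (t1 - t0) * S * (6 * C * S / eta + 2 * ce))).
Proof.
move=> t00 t01 t1T tV cV [G hG] jV C0 eta0 hf hl.
have [c4 c4E] : exists c4 : R, c4 = C / eta by eexists.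
have c40 : 0 < c4 by rewrite c4E divr_gt0.
have [B2 B2E] : exists B2 : R, B2 = 6 * c4 * S + 2 * ce by eexists.
have c4S : 0 <= c4 * S by rewrite mulr_ge0 // ltW.
have B20 : 0 <= B2.
  by rewrite B2E; apply: addr_ge0; [rewrite -mulrA; exact: (mulr_ge0 _ c4S) | exact: (mulr_ge0 _ ce0)].
have [l' l'E] : exists l' : R,
    l' = l + 2 * ce * fdot (x0 - xh) (x0 - xh) + (C * eta * S + (t1 - t0) * S * B2) by eexists.
have -> : l + 2 * ce * fdot (x0 - xh) (x0 - xh) +
    (C * eta * S + (t1 - t0) * S * (6 * C * S / eta + 2 * ce)) = l'.
  by rewrite l'E B2E c4E; congr (_ + (_ + _ * _)); field; rewrite gt_eqF.
pose q (t : R) (v : 'cV[R]_n) := f0 + fdot p v + 2^-1 * quad X v +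
  C * eta * fdot v v + c4 * fdot v v ^+ 2 + (t1 - t) * l' + (t1 - t) * B2 * fdot v v.
(* The factor t - t0 keeps a positive maximum away from t0, where no jet inequality is available. *)
pose F (t : R) (x : 'cV[R]_n) := (t - t0) * (V t x - q t (x - x0)).
suff key : forall t x, t0 <= t <= t1 -> F t x <= 0.
  (* F vanishes at t0, so the bound there is recovered from times slightly after t0 by continuity in
     time. *)
  apply/ler_addgt0Pr => e e0; have e20 : 0 < e / 2 by rewrite divr_gt0.
  have t0T : 0 <= t0 <= T by rewrite t00 /= (le_trans (ltW t01)).
  have [r r0 hr] := tV x0 t0 _ t0T e20.
  have [h hE] : exists h, h = Num.min (t1 - t0) (Num.min (r / 2) (e / 2 / (`|l'| + 1))).
    by eexists.
  have l1 : 0 < `|l'| + 1 by rewrite ltr_wpDl.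
  have h0 : 0 < h by rewrite hE !lt_min subr_gt0 t01 !divr_gt0.
  have h1 : h <= t1 - t0 by rewrite hE ge_min lexx.
  have h2 : h <= r / 2 by rewrite hE !ge_min lexx orbT.
  have h3 : h <= e / 2 / (`|l'| + 1) by rewrite hE !ge_min lexx !orbT.
  have tT : 0 <= t0 + h <= T.
    by rewrite addr_ge0 ?(ltW h0) //= (le_trans _ t1T) // -lerBrDl.
  have tr : `|t0 + h - t0| < r by rewrite addrAC subrr add0r gtr0_norm //; lra.
  have := hr _ tT tr; rewrite ler_norml => /andP[hV _].
  have tt : t0 <= t0 + h <= t1 by rewrite lerDl (ltW h0) -lerBrDl.
  have := key (t0 + h) x0 tt; rewrite /F addrAC subrr add0r pmulr_rle0 // subrr.
  rewrite /q /quad mulmx0 !fdot0r.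
  have : h * `|l'| <= e / 2.
    by move: h3; rewrite ler_pdivlMr // mulrDr mulr1; lra.
  have : - (h * l') <= h * `|l'| by rewrite -mulrN ler_wpM2l ?(ltW h0) // -normrN ler_norm.
  lra.
(* For |x - x0|^2 >= N0 >= 1 the quartic term beats all the others, each of which is at most a
   constant times |x - x0|^2. *)
have far : exists2 N0, 1 <= N0 & forall t x, t0 <= t <= t1 ->
    N0 <= fdot (x - x0) (x - x0) -> F t x <= 0.
  have [K2 K2E] : exists K2 : R, K2 = `|G| * (1 + 2 * fdot x0 x0) + 2 * `|G| + `|f0| +
     enorm p + enorm X + (t1 - t0) * `|l'| by eexists.
  have K20 : 0 <= K2.
    have n5 := normr_ge0 G; have := normr_ge0 f0.
    have n1 : 0 <= `|G| * (1 + 2 * fdot x0 x0).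
      by rewrite mulr_ge0 // addr_ge0 // mulr_ge0 // fdot_ge0.
    have n2 : 0 <= (t1 - t0) * `|l'| by rewrite mulr_ge0 // subr_ge0 ltW.
    by have := enorm_ge0 p; have := enorm_ge0 X; rewrite K2E; lra.
  have K2c : 0 <= 2 * K2 / c4.
    by apply: divr_ge0; [exact: mulr_ge0 | exact: ltW].
  exists (1 + 2 * K2 / c4) => [|t x tt hN]; first by rewrite lerDl.
  rewrite /F; apply: mulr_ge0_le0; first by lra.
  set v := x - x0 in hN *; set N := fdot v v in hN *.
  have N1 : 1 <= N by apply: le_trans hN; rewrite lerDl.
  have hN2 : 2 * K2 <= c4 * N.
    have : 2 * K2 / c4 <= N by lra.
    by rewrite ler_pdivrMr // [N * _]mulrC.
  have hV : V t x <= `|G| * (1 + 2 * fdot x0 x0 + 2 * N).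
    apply: le_trans (hG t x tt) _; apply: (@le_trans _ _ (`|G| * (1 + fdot x x))).
      by rewrite ler_wpM2r ?ler_norm // addr_ge0 ?fdot_ge0.
    rewrite ler_wpM2l //.
    by have := fdot_sqrD_le v x0; rewrite [v + x0]subrK /N; lra.
  have hp : - fdot p v <= enorm p * N.
    apply: le_trans (ler_norm _) _; rewrite normrN.
    apply: le_trans (fdot_le_enorm _ _) _; rewrite ler_wpM2l ?enorm_ge0 //.
    apply: enorm_le; first by lra.
    by rewrite -/N expr2; nra.
  have hX : - (2^-1 * quad X v) <= enorm X * N.
    have := quad_abs_le X v; rewrite -/N ler_norml => /andP[? _].
    have : 0 <= enorm X * N by apply: mulr_ge0; rewrite ?enorm_ge0 ?fdot_ge0.
    lra.
  have hl' : - ((t1 - t) * l') <= (t1 - t0) * `|l'|.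
    rewrite -mulrN; apply: (@le_trans _ _ ((t1 - t) * `|l'|)).
      apply: ler_wpM2l; first by rewrite subr_ge0; have /andP[] := tt.
      by rewrite -normrN ler_norm.
    by apply: ler_wpM2r => //; move: tt => /andP[? ?]; rewrite lerB.
  have hf0 : - f0 <= `|f0| by rewrite -normrN ler_norm.
  have N0 : 0 <= N := le_trans ler01 N1.
  have hCN : 0 <= C * eta * N.
    by apply: mulr_ge0 => //; apply: mulr_ge0; exact: ltW.
  have hBN : 0 <= (t1 - t) * B2 * N.
    apply: mulr_ge0 => //; apply: mulr_ge0 => //.
    by rewrite subr_ge0; have /andP[] := tt.
  have hN3 : 2 * K2 * N <= c4 * N ^+ 2 by rewrite expr2 mulrA ler_wpM2r.
  have n1 : 0 <= `|G| * (1 + 2 * fdot x0 x0).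
    by rewrite mulr_ge0 // addr_ge0 // mulr_ge0 // fdot_ge0.
  have n2 : 0 <= (t1 - t0) * `|l'| by rewrite mulr_ge0 // subr_ge0 ltW.
  have n3 := enorm_ge0 p; have n4 := enorm_ge0 X; have n5 := normr_ge0 G.
  have hK2 : `|G| * (1 + 2 * fdot x0 x0) + 2 * `|G| * N + `|f0| + enorm p * N + enorm X * N
     + (t1 - t0) * `|l'| <= K2 * N.
    have m1 : `|G| * (1 + 2 * fdot x0 x0) <= `|G| * (1 + 2 * fdot x0 x0) * N by rewrite ler_peMr.
    have m2 : `|f0| <= `|f0| * N by rewrite ler_peMr.
    have m3 : (t1 - t0) * `|l'| <= (t1 - t0) * `|l'| * N by rewrite ler_peMr.
    rewrite K2E !mulrDl; lra.
  have hKN : 0 <= K2 * N by rewrite mulr_ge0.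
  rewrite subr_le0 /q -/N; lra.
have [N0 N01 hfar] := far.
have cF : {within [set q : R * 'cV[R]_n | t0 <= q.1 <= t1], continuous (fun q => F q.1 q.2)}.
  have cq : continuous (fun z : R * 'cV[R]_n => q z.1 (z.2 - x0)).
    have cv : continuous (fun z : R * 'cV[R]_n => z.2 - x0).
      by move=> z; apply: cvgB; [exact: cvg_snd | exact: cvg_cst].
    have ct : continuous (fun z : R * 'cV[R]_n => t1 - z.1).
      by move=> z; apply: cvgB; [exact: cvg_cst | exact: cvg_fst].
    have cN : continuous (fun z : R * 'cV[R]_n => fdot (z.2 - x0) (z.2 - x0)).
      exact: fdot_continuous.
    rewrite /q => z; apply: cvgD; last first.
      apply: cvgM; last exact: cN.
      by apply: cvgM; [exact: ct | exact: cvg_cst].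
    apply: cvgD; last by apply: cvgM; [exact: ct | exact: cvg_cst].
    apply: cvgD; last first.
      apply: cvgM; first exact: cvg_cst.
      by rewrite expr2; apply: cvgM; exact: cN.
    apply: cvgD; last by apply: cvgM; [exact: cvg_cst | exact: cN].
    apply: cvgD; last by apply: cvgM; [exact: cvg_cst | exact: (quad_continuous cv)].
    apply: cvgD; first exact: cvg_cst.
    by apply: (fdot_continuous _ cv) => y; exact: cvg_cst.
  move=> z; apply: cvgM; last first.
    apply: cvgB; first exact: cV.
    apply: (continuous_subspaceT cq).
  apply: (@continuous_subspaceT _ _ _ (fun z : R * 'cV[R]_n => z.1 - t0)) => y.
  by apply: cvgB; [exact: cvg_fst | exact: cvg_cst].
have r0 : 0 <= enorm x0 + N0 by rewrite addr_ge0 ?enorm_ge0 // (le_trans ler01).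
have [ts [xs [/andP[ts0 ts1] hmax]]] := strip_max (ltW t01) r0 cF.
have hmax' t x : t0 <= t <= t1 -> F t x <= Num.max 0 (F ts xs).
  move=> tt; have [xr|xr] := leP (enorm x) (enorm x0 + N0).
    by rewrite le_max hmax ?orbT.
  rewrite le_max hfar //.
  have : N0 < enorm (x - x0).
    by have := enormD (x - x0) x0; rewrite subrK; lra.
  rewrite -enorm_sqr expr2; nra.
have [M0|M0] := leP (F ts xs) 0.
  by move=> t x /(hmax' t x); rewrite max_l.
exfalso; set M := F ts xs in M0 hmax hmax'.
have hM t x : t0 <= t <= t1 -> F t x <= M by move=> /(hmax' t x); rewrite max_r // ltW.
have ts0' : t0 < ts.
  rewrite lt_neqAle ts0 andbT; apply/negP => /eqP e.
  by move: M0; rewrite /M /F -e subrr mul0r ltxx.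
have ts1' : ts < t1.
  rewrite lt_neqAle ts1 andbT; apply/negP => /eqP e.
  move: M0; rewrite /M /F e ltNge => /negP; apply.
  apply: mulr_ge0_le0; first by rewrite subr_ge0 ltW.
  have := hf (xs - x0); rewrite [x0 + _]addrC subrK /q subrr !mul0r !addr0 subr_le0.
  have -> : forall z, C * (eta * z + z ^+ 2 / eta) = C * eta * z + c4 * z ^+ 2.
    by move=> z; rewrite c4E; ring.
  by rewrite !addrA.
have [tau tauE] : exists tau, tau = ts - t0 by eexists.
have tau0 : 0 < tau by rewrite tauE subr_gt0.
have [v vE] : exists v, v = xs - x0 by exists (xs - x0).
pose N := fdot v v; have N0' : 0 <= N by exact: fdot_ge0.
(* V lies below q + M / (t - t0) with equality at (ts, xs). The next lines are the time derivative,
   the gradient and the Hessian of that function there. *)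
pose kap := 2 * C * eta + 4 * c4 * N + 2 * (t1 - ts) * B2.
pose a := - l' - B2 * N - M / tau ^+ 2.
pose pj := p + 2^-1 *: ((X + X^T) *m v) + kap *: v.
pose Xj := X + kap%:M + (8 * c4) *: (v *m v^T).
have Veq : V ts xs = q ts v + M / tau.
  by rewrite /M /F -vE -tauE mulrC mulKf ?gt_eqF // addrC subrK.
have Vle t x : t0 < t -> t <= t1 -> V t x <= q t (x - x0) + M / (t - t0).
  move=> tt0 tt1; rewrite -lerBlDl ler_pdivlMr ?subr_gt0 // mulrC.
  by apply: hM; rewrite tt1 (ltW tt0).
have jet : ujet T V ts xs a pj Xj.
  move=> e e0.
  have [K [r [r0' hr]]] := quartic_remainder (ltW c40) B20 N0' e0.
  pose r1 := Num.min r (Num.min (tau / 2) (t1 - ts)).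
  have r10 : 0 < r1 by rewrite !lt_min r0' subr_gt0 ts1' divr_gt0.
  exists (K + 2 * M / tau ^+ 3), r1; split => // sg w.
  rewrite !lt_min => /and3P[sg1 sg2 sg3] /andP[w1 _] _.
  have sg3' : sg <= t1 - ts by apply: le_trans (ler_norm _) (ltW sg3).
  have sg2' : - sg <= tau / 2.
    by apply: le_trans (ltW sg2); rewrite -normrN ler_norm.
  have tt0 : t0 < ts + sg.
    rewrite -subr_gt0 addrAC -tauE -[sg]opprK subr_gt0 (le_lt_trans sg2') //.
    by rewrite ltr_pdivrMr // ltr_pMr // ltr1n.
  have tt1 : ts + sg <= t1 by rewrite -lerBrDl.
  apply: le_trans (Vle _ _ tt0 tt1) _.
  have -> : xs + w - x0 = v + w by rewrite vE addrAC.
  have -> : ts + sg - t0 = tau + sg by rewrite tauE addrAC.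
  have := inv_expansion (ltW M0) tau0 (ltW sg2).
  have := hr sg (fdot w w) (fdot v w) sg1 _ (fdot_CS v w).
  rewrite fdot_ge0 w1 => /(_ isT); rewrite Veq.
  have -> : fdot pj w = fdot p w + 2^-1 * (fdot v (X *m w) + fdot w (X *m v))
      + kap * fdot v w.
    have e1 : fdot (X^T *m v) w = fdot v (X *m w) by rewrite fdot_mulmxl trmxK.
    by rewrite /pj !fdotDl !fdotZl mulmxDl fdotDl e1 (fdotC (X *m v) w); ring.
  have -> : quad Xj w = quad X w + kap * fdot w w + 8 * c4 * fdot v w ^+ 2.
    by rewrite /Xj !quadD quad_scalar quadZ quad_outer.
  rewrite /q quad_add !fdotE (fdotC w v) -/N /a /kap; lra.
(* The time derivative contains - M / tau^2, while all other terms of the jet inequality are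
   balanced by l' and B2; half of this amount as slack yields the contradiction. *)
have e0 : 0 < M / tau ^+ 2 / 2 by rewrite !divr_gt0 ?exprn_gt0.
have tt : t0 < ts < t1 by rewrite ts0' ts1'.
have [i] := jV _ tt _ _ _ _ jet _ e0.
have hd : dif (s i) Xj <= dif (s i) X + (2^-1 * kap + 4 * c4 * N) * S.
  have h0 := sS i; have h1 := dif_outer (s i) v.
  have k0 : 0 <= kap.
    have c1 : 0 <= C * eta by rewrite mulr_ge0 ?ltW.
    have c2 : 0 <= c4 * N by rewrite mulr_ge0 ?(ltW c40).
    have c3 : 0 <= (t1 - ts) * B2 by rewrite mulr_ge0 // subr_ge0 ltW.
    have -> : kap = 2 * (C * eta) + 4 * (c4 * N) + 2 * ((t1 - ts) * B2).
      by rewrite /kap; ring.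
    by rewrite !addr_ge0 // mulr_ge0.
  rewrite /Xj !difD dif_scalar difZ -addrA lerD2l [leRHS]mulrDl; apply: lerD.
    by rewrite ler_wpM2l // mulr_ge0.
  apply: (@le_trans _ _ (8 * c4 * (2^-1 * N * S))).
    apply: ler_wpM2l; first by apply: mulr_ge0 => //; exact: ltW.
    apply: le_trans h1 _; apply: ler_wpM2l => //.
    by apply: mulr_ge0 => //; rewrite invr_ge0.
  lra.
have hx : ce * fdot (xs - xh) (xs - xh) <= ce * (2 * fdot (x0 - xh) (x0 - xh) + 2 * N).
  rewrite ler_wpM2l //; have := fdot_sqrD_le (x0 - xh) v.
  by have -> : x0 - xh + v = xs - xh by rewrite vE addrC subrKA.
have hS : (t1 - ts) * S * B2 <= (t1 - t0) * S * B2.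
  by rewrite -!mulrA ler_wpM2r ?mulr_ge0 // lerD2l lerN2 ltW.
have := hl i; move: hd hx hS e0; rewrite /a l'E /kap B2E.
set Q := M / tau ^+ 2; lra.
Qed.

End OneStep.

(** * Random walks and the mean value inequality *)

Section Walk.
Context (R : realType) (n d : nat).
Hypothesis d0 : (0 < d)%N.
Context (s : 'M[R]_(n, d)).
Implicit Types (f g : 'cV[R]_n -> R) (x y : 'cV[R]_n).

(** The expectation of f after one step: a column of s chosen uniformly, a random sign, and the
    length factor sqrt(d tau) that makes the covariance equal to tau times s s^T. *)
Definition walk (tau : R) f x : R := (2 * d%:R)^-1 *
  \sum_j (f (x + Num.sqrt (d%:R * tau) *: col j s) +
          f (x - Num.sqrt (d%:R * tau) *: col j s)).

Let dR0 : 0 < d%:R :> R. Proof. by rewrite ltr0n. Qed.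
Let d20 : 0 < 2 * d%:R :> R. Proof. by rewrite mulr_gt0. Qed.

Lemma walk_le tau f g x : (forall y, f y <= g y) -> walk tau f x <= walk tau g x.
Proof.
move=> fg; rewrite /walk ler_wpM2l ?invr_ge0 ?(ltW d20) //.
by apply: ler_sum => j _; rewrite lerD.
Qed.

Lemma walk_addc tau f c x : walk tau (fun y => f y + c) x = walk tau f x + c.
Proof.
rewrite /walk; under eq_bigr do rewrite addrACA; rewrite big_split /= mulrDr.
congr (_ + _); rewrite sumr_const card_ord -mulr_natl; field.
by rewrite gt_eqF.
Qed.

Lemma walk_lip tau L f : lipf L f -> lipf L (walk tau f).
Proof.
move=> lf x y; rewrite /walk -mulrBr -sumrB normrM ger0_norm ?invr_ge0 ?(ltW d20) //.
rewrite ler_pdivrMl //; apply: le_trans (ler_norm_sum _ _ _) _.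
have -> : 2 * d%:R * (L * enorm (x - y)) = \sum_(j < d) 2 * (L * enorm (x - y)).
  by rewrite sumr_const card_ord -[RHS]mulr_natl; ring.
apply: ler_sum => j _; set r := Num.sqrt _ *: _.
have h1 := lf (x + r) (y + r); have h2 := lf (x - r) (y - r).
have e1 : x + r - (y + r) = x - y by rewrite opprD addrACA subrr addr0.
have e2 : x - r - (y - r) = x - y by rewrite opprB addrA subrK.
move: h1 h2; rewrite e1 e2.
have -> : f (x + r) + f (x - r) - (f (y + r) + f (y - r)) =
  (f (x + r) - f (y + r)) + (f (x - r) - f (y - r)) by ring.
have := ler_normD (f (x + r) - f (y + r)) (f (x - r) - f (y - r)); lra.
Qed.

Lemma walk_avg_le tau f x (g : R) (h : 'I_d -> R) :
  (forall j, let r := Num.sqrt (d%:R * tau) *: col j s in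
     f (x + r) + f (x - r) <= 2 * g + 2 * h j) ->
  walk tau f x <= g + d%:R^-1 * \sum_j h j.
Proof.
move=> hf; apply: (@le_trans _ _ ((2 * d%:R)^-1 * \sum_j (2 * g + 2 * h j))).
  rewrite ler_wpM2l ?invr_ge0 ?(ltW d20) //; apply: ler_sum => j _; exact: hf.
rewrite le_eqVlt; apply/orP; left; apply/eqP.
rewrite big_split /= sumr_const card_ord -mulr_natl -mulr_sumr; field.
by rewrite gt_eqF.
Qed.

Lemma walk_avg_ge tau f x (g : R) (h : 'I_d -> R) :
  (forall j, let r := Num.sqrt (d%:R * tau) *: col j s in
     2 * g + 2 * h j <= f (x + r) + f (x - r)) ->
  g + d%:R^-1 * \sum_j h j <= walk tau f x.
Proof.
move=> hf; apply: (@le_trans _ _ ((2 * d%:R)^-1 * \sum_j (2 * g + 2 * h j))); last first.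
  rewrite ler_wpM2l ?invr_ge0 ?(ltW d20) //; apply: ler_sum => j _; exact: hf.
rewrite le_eqVlt; apply/orP; left; apply/eqP.
rewrite big_split /= sumr_const card_ord -mulr_natl -mulr_sumr; field.
by rewrite gt_eqF.
Qed.

Let step2 tau j : 0 <= tau ->
  fdot (Num.sqrt (d%:R * tau) *: col j s) (Num.sqrt (d%:R * tau) *: col j s) =
  d%:R * tau * fdot (col j s) (col j s).
Proof. by move=> t0; rewrite !fdotE mulrA -expr2 sqr_sqrtr // mulr_ge0. Qed.

Let stepq tau X j : 0 <= tau ->
  quad X (Num.sqrt (d%:R * tau) *: col j s) = d%:R * tau * quad X (col j s).
Proof. by move=> t0; rewrite quad_scale sqr_sqrtr // mulr_ge0. Qed.

Lemma sum_fdot_sqr_le :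
  \sum_j fdot (col j s) (col j s) ^+ 2 <= fdot s s ^+ 2.
Proof.
rewrite [leRHS]expr2 -{1}(sum_fdot_col s) mulr_suml; apply: ler_sum => j _.
rewrite expr2 ler_wpM2l ?fdot_ge0 // -(sum_fdot_col s) (bigD1 j) //= lerDl.
by apply: sumr_ge0 => i _; exact: fdot_ge0.
Qed.

Let S := fdot s s.
Let S0 : 0 <= S. Proof. exact: fdot_ge0. Qed.

Lemma walk_taylor_ge (tau eta C : R) f x p (X : 'M[R]_n) : 0 <= tau -> 0 < eta -> 0 <= C ->
  (forall v, `|f (x + v) - f x - fdot p v - 2^-1 * quad X v|
     <= C * (eta * fdot v v + fdot v v ^+ 2 / eta)) ->
  f x + tau * dif s X - C * (eta * tau * S + d%:R * tau ^+ 2 * S ^+ 2 / eta)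
    <= walk tau f x.
Proof.
move=> t0 eta0 C0 hf.
pose h j := d%:R * tau * (2^-1 * quad X (col j s)) -
  C * (eta * (d%:R * tau * fdot (col j s) (col j s)) +
       (d%:R * tau * fdot (col j s) (col j s)) ^+ 2 / eta).
have step : f x + d%:R^-1 * \sum_j h j <= walk tau f x.
  apply: walk_avg_ge => j; set r0 := _ *: _.
  have [r rE] : exists r, r = r0 by exists r0.
  have r2 : fdot r r = d%:R * tau * fdot (col j s) (col j s) by rewrite rE step2.
  have rq : quad X r = d%:R * tau * quad X (col j s) by rewrite rE stepq.
  have qN : quad X (- r) = quad X r by rewrite -scaleN1r quad_scale sqrrN expr1n mul1r.
  rewrite -rE; have := hf r; have := hf (- r).
  rewrite qN !fdotNr fdotNl opprK r2 rq !ler_norml /h.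
  by move=> /andP[? _] /andP[? _]; lra.
apply: le_trans step; rewrite -addrA lerD2l /h sumrB -!mulr_sumr mulrBr.
have e1 : d%:R^-1 * (d%:R * tau * (2^-1 * \sum_j quad X (col j s))) = tau * dif s X.
  by rewrite /dif; field; rewrite gt_eqF.
rewrite e1 lerD2l lerN2.
rewrite big_split /= -!mulr_sumr -mulr_suml.
under [X in _ + X / _]eq_bigr do rewrite exprMn.
rewrite -mulr_sumr sum_fdot_col -/S mulrCA ler_wpM2l // mulrDr lerD //.
  by rewrite le_eqVlt; apply/orP; left; apply/eqP; field; rewrite gt_eqF.
rewrite !mulrA ler_wpM2r ?invr_ge0 ?(ltW eta0) //.
have -> : d%:R^-1 * d%:R * tau * d%:R * tau = d%:R * tau ^+ 2 by field; rewrite gt_eqF.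
have -> : d%:R * tau * tau * S * S = d%:R * tau ^+ 2 * S ^+ 2 by ring.
by rewrite ler_wpM2l ?mulr_ge0 ?sqr_ge0 // sum_fdot_sqr_le.
Qed.

(** Signs cancel odd terms. Per step the second moment grows by tau S, and the fourth by at most 6
    tau S N + d tau^2 S^2, by Cauchy-Schwarz for the mixed term; summed over k steps this gives the
    constant d + 6. *)
Lemma walk_poly (tau : R) k (f0 : R) (p : 'cV[R]_n) (X : 'M[R]_n) (c1 c2 : R) x y : 0 <= tau -> 0 <= c2 ->
  iter k (walk tau) (fun z => f0 + fdot p (z - x) + 2^-1 * quad X (z - x) +
    c1 * fdot (z - x) (z - x) + c2 * fdot (z - x) (z - x) ^+ 2) y
  <= f0 + fdot p (y - x) + 2^-1 * quad X (y - x) +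
    c1 * fdot (y - x) (y - x) + c2 * fdot (y - x) (y - x) ^+ 2 +
    k%:R * tau * (dif s X + c1 * S) + c2 * (6 * (k%:R * tau) * S * fdot (y - x) (y - x) +
      (d%:R + 6) * S ^+ 2 * (k%:R * tau) ^+ 2).
Proof.
move=> t0 c20; elim: k y => [|k IH] y.
  by rewrite /= !mul0r expr0n !mulr0 !mul0r !addr0 mulr0 addr0.
rewrite iterS; apply: le_trans (walk_le _ _ IH) _.
have [v vE] : exists v, v = y - x by exists (y - x).
pose N := fdot v v; have N0 : 0 <= N by exact: fdot_ge0.
pose kt := k%:R * tau; have kt0 : 0 <= kt by rewrite mulr_ge0.
pose sj (j : 'I_d) := fdot (col j s) (col j s).
pose h j := d%:R * tau * (2^-1 * quad X (col j s) + (c1 + c2 * (6 * N + 6 * kt * S)) * sj j)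
  + c2 * (d%:R * tau) ^+ 2 * sj j ^+ 2.
pose g := f0 + fdot p v + 2^-1 * quad X v + c1 * N + c2 * N ^+ 2 +
  kt * (dif s X + c1 * S) + c2 * (6 * kt * S * N + (d%:R + 6) * S ^+ 2 * kt ^+ 2).
apply: (@le_trans _ _ (g + d%:R^-1 * \sum_j h j)).
  apply: walk_avg_le => j; set r0 := _ *: _.
  have [r rE] : exists r, r = r0 by exists r0.
  have r2 : fdot r r = d%:R * tau * sj j by rewrite rE step2.
  have rq : quad X r = d%:R * tau * quad X (col j s) by rewrite rE stepq.
  rewrite -rE /=; have -> : y + r - x = v + r by rewrite vE addrAC.
  have -> : y - r - x = v - r by rewrite vE addrAC.
  have D2 := fdot_CS v r; rewrite r2 -/N in D2.
  have qm : quad X (v - r) = quad X v - fdot v (X *m r) - fdot r (X *m v) + quad X r.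
    by rewrite quad_add mulmxN !fdotNr !fdotNl /quad mulmxN fdotNr fdotNl opprK.
  have -> : fdot (v + r) (v + r) = N + 2 * fdot v r + fdot r r.
    by rewrite !fdotE (fdotC r v) /N; ring.
  have -> : fdot (v - r) (v - r) = N - 2 * fdot v r + fdot r r.
    by rewrite !fdotE (fdotC r v) /N; ring.
  rewrite quad_add qm !fdotDr fdotNr r2 rq /g /h -/kt.
  have := ler_wpM2l c20 D2.
  set sg := sj j; set dt := d%:R * tau; set D := fdot v r; lra.
rewrite -vE /g -/N -/kt /h big_split /= -!mulr_sumr big_split /= -!mulr_sumr.
rewrite (_ : \sum_j sj j = S); last by rewrite /sj sum_fdot_col.
have hs := ler_wpM2l (mulr_ge0 c20 (mulr_ge0 (ltW dR0) (sqr_ge0 tau))) sum_fdot_sqr_le.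
have -> : d%:R^-1 * (d%:R * tau * (2^-1 * (\sum_j quad X (col j s)) +
     (c1 + c2 * (6 * N + 6 * kt * S)) * S) + c2 * (d%:R * tau) ^+ 2 * \sum_j sj j ^+ 2) =
   tau * dif s X + tau * (c1 + c2 * (6 * N + 6 * kt * S)) * S +
   c2 * (d%:R * tau ^+ 2) * \sum_j sj j ^+ 2.
  by rewrite /dif; field; rewrite gt_eqF.
have -> : k.+1%:R * tau = kt + tau by rewrite -natr1 mulrDl mul1r.
have h1 : 0 <= c2 * (S ^+ 2 * (kt * tau)) by rewrite !mulr_ge0 ?sqr_ge0.
have h2 : 0 <= c2 * (S ^+ 2 * (kt * tau)) * d%:R by rewrite mulr_ge0.
have h3 : 0 <= c2 * (S ^+ 2 * tau ^+ 2) by rewrite !mulr_ge0 ?sqr_ge0.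
rewrite -/S in hs *; rewrite /sj; lra.
Qed.

End Walk.

Section MeanValue.
Context (R : realType) (n d : nat).
Hypothesis d0 : (0 < d)%N.
Context (s : 'M[R]_(n, d)).
Implicit Types (f g : 'cV[R]_n -> R) (x y : 'cV[R]_n).

Lemma iter_walk_lip tau L f k : lipf L f -> lipf L (iter k (walk s tau) f).
Proof. by move=> lf; elim: k => //= k; exact: walk_lip. Qed.

Lemma iter_walk_le tau k f g x : (forall y, f y <= g y) ->
  iter k (walk s tau) f x <= iter k (walk s tau) g x.
Proof. by move=> fg; elim: k x => //= k IH x; exact: walk_le. Qed.

Lemma iter_walk_addc tau k f c x :
  iter k (walk s tau) (fun y => f y + c) x = iter k (walk s tau) f x + c.
Proof.
elim: k x => //= k IH x; rewrite -walk_addc //; congr (walk _ _ _ _).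
by apply/funext => y; exact: IH.
Qed.

Lemma boxmean_walk tau delta i L f x : 0 < delta -> lipf L f ->
  boxmean delta i (walk s tau f) x = walk s tau (boxmean delta i f) x.
Proof.
move=> delta0 lf; rewrite /boxmean /walk; set r := Num.sqrt _.
have cf y : continuous (fun t : R => f (y + (t * delta) *: evec R i)).
  exact: lipf_line_cts lf.
have cfw w : continuous (fun t : R => f (x + (t * delta) *: evec R i + w)).
  have -> : (fun t : R => f (x + (t * delta) *: evec R i + w)) =
      (fun t : R => f (x + w + (t * delta) *: evec R i)).
    by apply/funext => t; rewrite addrAC.
  exact: cf.
have cfD w : continuous (fun t : R => f (x + (t * delta) *: evec R i + w) +
    f (x + (t * delta) *: evec R i - w)).
  by move=> t; apply: cvgD; exact: cfw.
rewrite meanZ; last by apply: continuous_sumr => j; exact: cfD.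
rewrite mean_sum; last by move=> j; exact: cfD.
congr (_ * _); apply: eq_bigr => j _; rewrite meanD.
- by congr (mean _ + mean _); apply/funext => t; rewrite addrAC.
- exact: cfw.
- exact: cfw.
Qed.

(** Both operators average over translates with steps that do not depend on the point, so they
    commute. This is where constant coefficients are indispensable. *)
Lemma smooth_walk tau delta L f x : 0 < delta -> lipf L f ->
  smooth delta (walk s tau f) x = walk s tau (smooth delta f) x.
Proof.
move=> delta0 lf; rewrite /smooth -!foldr_cat; elim: (_ ++ _) x => //= i l IH x.
have -> : foldr (boxmean delta) (walk s tau f) l =
          walk s tau (foldr (boxmean delta) f l) by apply/funext.
by apply: boxmean_walk => //; apply: (foldr_boxmean_lip delta0 l lf).
Qed.

Lemma smooth_iter_walk tau delta L f k x : 0 < delta -> lipf L f ->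
  smooth delta (iter k (walk s tau) f) x = iter k (walk s tau) (smooth delta f) x.
Proof.
move=> delta0 lf; elim: k x => //= k IH x.
rewrite (smooth_walk _ _ delta0 (iter_walk_lip _ k lf)).
by congr (walk _ _ _ _); apply/funext.
Qed.

(** Puts the cubic remainder of a Taylor expansion into the form handled by [one_step]. For
    increments of size sqrt(tau) and eta = sqrt(tau) nothing is lost in the order tau^(3/2). *)
Lemma cube_le_quartic (a eta : R) : 0 < eta -> 0 <= a ->
  a ^+ 3 <= eta * a ^+ 2 + (a ^+ 2) ^+ 2 / eta.
Proof.
move=> eta0 a0; rewrite -subr_ge0.
have -> : eta * a ^+ 2 + (a ^+ 2) ^+ 2 / eta - a ^+ 3 =
  a ^+ 2 / eta * ((eta - a / 2) ^+ 2 + 3 / 4 * a ^+ 2).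
  by field; rewrite gt_eqF.
by rewrite mulr_ge0 ?divr_ge0 ?sqr_ge0 ?(ltW eta0) // addr_ge0 ?sqr_ge0 ?mulr_ge0 ?sqr_ge0.
Qed.

Context (T c ce : R) (xh : 'cV[R]_n).
Hypothesis ce0 : 0 <= ce.
Let S := fdot s s.
Let S0 : 0 <= S. Proof. exact: fdot_ge0. Qed.
Let sub V := @subjet R n d T unit (fun=> s) (fun=> c) ce xh V.

Lemma subjet_sub V t0 t1 t0' t1' : t0 <= t0' -> t1' <= t1 -> sub V t0 t1 -> sub V t0' t1'.
Proof.
move=> h0 h1 hV t /andP[ht0 ht1]; apply: hV.
by rewrite (le_lt_trans h0 ht0) (lt_le_trans ht1 h1).
Qed.

Section Iterate.
Variables (V : R -> 'cV[R]_n -> R) (t0 t1 : R).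
Hypothesis t00 : 0 <= t0.
Hypothesis t01 : t0 < t1.
Hypothesis t1T : t1 <= T.
Hypothesis cV : continuous_strip T V.
Hypothesis gV : exists G, forall t x, 0 <= t <= T -> V t x <= G * (1 + fdot x x).
Hypothesis jV : sub V t0 t1.
Local Notation h := (t1 - t0).

(** Induction over m steps of length tau, each applying [one_step] to the previous bound as terminal
    data. Every step costs an error of order tau^(3/2), hence sqrt(tau) h in total, which disappears
    as m grows. *)
Lemma walk_iterate f C m : 0 < C -> (0 < m)%N -> (forall x, V t1 x <= f x) ->
  (forall x, exists p X, forall v,
    `|f (x + v) - f x - fdot p v - 2^-1 * quad X v| <= C * enorm v ^+ 3) ->
  forall x, V t0 x <= iter m (walk s (h / m%:R)) f x +
    h * (c + 2 * ce * fdot (x - xh) (x - xh) +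
      (2 * ce * h * S + Num.sqrt (h / m%:R) * (C * (2 * S + (6 + d%:R) * S ^+ 2)))).
Proof.
move=> C0 m0 Vf tf.
have mR0 : 0 < m%:R :> R by rewrite ltr0n.
have h0 : 0 < h by rewrite subr_gt0.
have [tau tauD] : exists tau, tau = h / m%:R by eexists.
have tau0 : 0 < tau by rewrite tauD divr_gt0.
have tauE : m%:R * tau = h by rewrite tauD mulrC divfK // gt_eqF.
have [eta etaD] : exists eta, eta = Num.sqrt tau by eexists.
have eta0 : 0 < eta by rewrite etaD sqrtr_gt0.
have eta2 : eta * eta = tau by rewrite etaD -expr2 sqr_sqrtr // ltW.
rewrite -tauD -etaD.
pose B := 2 * ce * h * S + eta * (C * (2 * S + (6 + d%:R) * S ^+ 2)).
pose A (k : nat) := iter k (walk s tau) f.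
(* The walk averages translates, so all iterates have expansions with the same remainder constant as
   f. *)
have J k x : exists p X, forall v,
    `|A k (x + v) - A k x - fdot p v - 2^-1 * quad X v| <=
    C * (eta * fdot v v + fdot v v ^+ 2 / eta).
  have base y : exists p X, forall v,
      `|f (y + v) - f y - fdot p v - 2^-1 * quad X v| <=
      C * (eta * fdot v v + fdot v v ^+ 2 / eta).
    have [p [X hX]] := tf y; exists p, X => v; apply: le_trans (hX v) _.
    by rewrite ler_wpM2l ?(ltW C0) // -!enorm_sqr cube_le_quartic ?enorm_ge0.
  elim: k x => [|k IH] x; first exact: base.
  rewrite /A /=; set r := Num.sqrt (d%:R * tau).
  have /choice[pp] := fun j : 'I_d => IH (x + r *: col j s).
  move=> /choice[XX hp].
  have /choice[pm] := fun j : 'I_d => IH (x - r *: col j s).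
  move=> /choice[XM hm].
  exists ((2 * d%:R)^-1 *: \sum_j (pp j + pm j)), ((2 * d%:R)^-1 *: \sum_j (XX j + XM j)) => v.
  have d2 : 0 < 2 * d%:R :> R by rewrite mulr_gt0 // ltr0n.
  have fs (F : 'I_d -> 'cV[R]_n) : fdot (\sum_j F j) v = \sum_j fdot (F j) v.
    by elim/big_rec2: _ => [|j a b _ <-]; rewrite ?fdot0l ?fdotDl.
  have qs (F : 'I_d -> 'M[R]_n) : quad (\sum_j F j) v = \sum_j quad (F j) v.
    by elim/big_rec2: _ => [|j a b _ <-]; rewrite ?quadD // /quad mul0mx fdot0r.
  rewrite fdotZl quadZ fs qs /walk -/r [2^-1 * (_ * _)]mulrCA -!mulrBr.
  rewrite normrM ger0_norm ?invr_ge0 ?(ltW d2) // ler_pdivrMl //.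
  set E := C * _.
  have -> : 2 * d%:R * E = \sum_(j < d) (E + E).
    by rewrite sumr_const card_ord -[RHS]mulr_natl; ring.
  rewrite mulr_sumr -!sumrB; apply: le_trans (ler_norm_sum _ _ _) _.
  apply: ler_sum => j _; rewrite fdotDl quadD.
  have := hp j v; have := hm j v; rewrite /A ![_ + v]addrAC -/E.
  set a1 := iter k _ _ _; set a2 := iter k _ _ _; set a3 := iter k _ _ _.
  set a4 := iter k _ _ _; set b1 := fdot _ _; set b2 := fdot _ _.
  set q1 := quad _ _; set q2 := quad _ _.
  by rewrite !ler_norml => /andP[? ?] /andP[? ?]; apply/andP; split; lra.
have ind k x : (k <= m)%N -> V (t1 - k%:R * tau) x <= A k x +
    k%:R * tau * (c + 2 * ce * fdot (x - xh) (x - xh) + B).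
  elim: k x => [|k IH] x km; first by rewrite !mul0r subr0 addr0; exact: Vf.
  have km' : (k <= m)%N := ltnW km.
  have kt : k.+1%:R * tau = k%:R * tau + tau by rewrite -natr1 mulrDl mul1r.
  have ktm : k.+1%:R * tau <= h by rewrite -tauE ler_wpM2r ?(ltW tau0) // ler_nat.
  have [z zE] : exists z : R, z = k%:R * tau by eexists.
  have z0 : 0 <= z by rewrite zE mulr_ge0 // ltW.
  rewrite kt -zE in ktm *.
  have [p [X hX]] := J k x.
  have [w wE] : exists w, w = x - xh by eexists.
  pose q := fdot w w.
  pose f0 := A k x + z * (c + 2 * ce * q + B).
  (* The error z (2 ce |x - xh|^2) accumulated so far is part of the terminal data and adds its own
     gradient and Hessian; the latter costs at most 2 ce h S, which B contains. *)
  pose p' := p + (z * (4 * ce)) *: w.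
  pose X' := X + (4 * ce * z)%:M.
  have hf v : V (t1 - z) (x + v) <= f0 + fdot p' v + 2^-1 * quad X' v +
      C * (eta * fdot v v + fdot v v ^+ 2 / eta).
    rewrite zE; apply: le_trans (IH (x + v) km') _; rewrite -zE.
    have := hX v; rewrite ler_norml => /andP[_].
    have -> : x + v - xh = w + v by rewrite wE addrAC.
    have -> : fdot (w + v) (w + v) = q + 2 * fdot w v + fdot v v.
      by rewrite /q !fdotE (fdotC v w); ring.
    rewrite /f0 /p' /X' fdotDl fdotZl quadD quad_scalar -/q.
    by set E := C * _; lra.
  have s0 : 0 <= t1 - (z + tau).
    by move: ktm t00; rewrite subr_ge0; lra.
  have s01 : t1 - (z + tau) < t1 - z by rewrite ltrD2l ltrN2 ltrDl.
  have s1T : t1 - z <= T by apply: le_trans t1T; rewrite gerBl.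
  have inT (t : R) : t1 - (z + tau) <= t <= t1 - z -> 0 <= t <= T.
    by move=> /andP[? ?]; apply/andP; split; lra.
  have cV' : {within [set q : R * 'cV[R]_n | t1 - (z + tau) <= q.1 <= t1 - z],
      continuous (fun q => V q.1 q.2)}.
    by apply: continuous_subspaceW cV => -[t y] /= /inT.
  have gV' : exists G, forall t y, t1 - (z + tau) <= t <= t1 - z ->
      V t y <= G * (1 + fdot y y).
    by have [G hG] := gV; exists G => t y /inT; exact: hG.
  have jV' : sub V (t1 - (z + tau)) (t1 - z) by apply: subjet_sub jV; lra.
  have hl (i : unit) : dif s X' + c <= dif s X' + c by [].
  have := @one_step R n d T unit (fun=> s) (fun=> c) S ce xh (fun=> lexx _) S0 ce0
    V _ _ x f0 p' X' C eta _ s0 s01 s1T (continuous_strip_ctime cV) cV' gV' jV' C0 eta0 hf hl.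
  have -> : t1 - z - (t1 - (z + tau)) = tau by ring.
  rewrite -wE -/q => h1.
  have h2 := @walk_taylor_ge R n d d0 s tau eta C (A k) x p X (ltW tau0) eta0 (ltW C0) hX.
  have -> : A k.+1 x = walk s tau (A k) x by [].
  have e1 : dif s X' = dif s X + 2 * ce * z * S.
    by rewrite /X' difD dif_scalar; congr (_ + _); rewrite -/S; field.
  have e2 : tau * S * (6 * C * S / eta) = eta * (6 * C * S ^+ 2).
    by rewrite -eta2; field; rewrite gt_eqF.
  have e3 : d%:R * tau ^+ 2 * S ^+ 2 / eta = d%:R * tau * eta * S ^+ 2.
    by rewrite -eta2; field; rewrite gt_eqF.
  move: h1 h2; rewrite [tau * S * _]mulrDr e2 e1 -/S e3.
  have hB : 2 * ce * (z + tau) * S <= 2 * ce * h * S.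
    by rewrite -!mulrA ler_wpM2l // ler_wpM2l // ler_wpM2r.
  have hB2 := ler_wpM2l (ltW tau0) hB.
  rewrite /f0 /B => h1 h2.
  set a0 := A k x in h1 h2 *; set b0 := walk s tau (A k) x in h2 *.
  move: (dif s X) (V (t1 - (z + tau)) x) h1 h2 => D v h1 h2.
  clear - h1 h2 hB2; lra.
move=> x; have := ind m x (leqnn m); rewrite tauE.
by have -> : t1 - h = t0 by ring.
Qed.

End Iterate.
End MeanValue.

Section SmoothMeanValue.
Context (R : realType) (n d : nat).
Hypothesis d0 : (0 < d)%N.
Context (s : 'M[R]_(n, d)) (T c ce : R) (xh : 'cV[R]_n).
Hypothesis ce0 : 0 <= ce.
Local Notation S := (fdot s s).

Lemma sqrt_div_small (h K e : R) : 0 <= h -> 0 < e ->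
  exists m, (0 < m)%N /\ Num.sqrt (h / m%:R) * K <= e.
Proof.
move=> h0 e0; pose K1 := `|K| + 1; have K10 : 0 < K1 by rewrite ltr_wpDl.
pose m := (Num.trunc (h / (e / K1) ^+ 2)).+1; exists m; split => //.
have m0 : (0 : R) < m%:R by rewrite ltr0n.
have eK : 0 < e / K1 by rewrite divr_gt0.
have hm : h / m%:R <= (e / K1) ^+ 2.
  rewrite ler_pdivrMr // -ler_pdivrMl ?exprn_gt0 // mulrC ltW //.
  by rewrite /m truncnS_gt.
have hs : Num.sqrt (h / m%:R) <= e / K1.
  rewrite -[leRHS]gtr0_norm // -sqrtr_sqr; exact: ler_wsqrtr.
apply: (@le_trans _ _ (Num.sqrt (h / m%:R) * K1)).
  rewrite ler_wpM2l ?sqrtr_ge0 // (le_trans (ler_norm K)) // lerDl //.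
by move: hs; rewrite ler_pdivlMr.
Qed.

(** Two smoothing scales are at work. An auxiliary scale delta' and a number m of steps, both sent
    to their limits, bound V(t0) by walk averages of V(t1); smoothing this at the fixed scale
    [delta] commutes with the walk, and the expansion of the smoothed V(t1) at x evaluates the
    average. Thus C refers to [delta] only, and the auxiliary constant C1 leaves no trace. *)
Lemma smooth_mean_value V t0 t1 L delta C x p X :
  0 <= t0 -> t0 < t1 -> t1 <= T -> continuous_strip T V ->
  (exists G, forall t x, 0 <= t <= T -> V t x <= G * (1 + fdot x x)) ->
  @subjet R n d T unit (fun=> s) (fun=> c) ce xh V t0 t1 ->
  0 <= L -> lipf L (V t0) -> lipf L (V t1) -> 0 < delta -> 0 <= C ->
  (forall v, `|smooth delta (V t1) (x + v) - smooth delta (V t1) x - fdot p v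
     - 2^-1 * quad X v| <= C * enorm v ^+ 3) ->
  smooth delta (V t0) x <= smooth delta (V t1) x + (t1 - t0) *
    (dif s X + c + 4 * ce * fdot (x - xh) (x - xh) +
     (4 * ce * ((n + n)%:R * delta) ^+ 2 + 2 * ce * (t1 - t0) * S +
      Num.sqrt (t1 - t0) * (C * (S + (d%:R + 6) * S ^+ 2)))).
Proof.
move=> t00 t01 t1T cV gV jV L0 lV0 lV1 delta0 C0 hX.
have [h hE] : exists h, h = t1 - t0 by eexists.
have h0 : 0 < h by rewrite hE subr_gt0.
rewrite -hE; apply/ler_addgt0Pr => e e0.
have [nn nnE] : exists r : R, r = (n + n)%:R by eexists.
have nn0 : 0 <= nn by rewrite nnE.
(* The gap between V(t1) and its auxiliary smoothing is counted twice and may use half of e. *)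
pose delta' := e / (4 * (L * nn + 1)).
have Ln0 : 0 <= L * nn by rewrite mulr_ge0.
have delta'0 : 0 < delta' by rewrite divr_gt0 // mulr_gt0 // ltr_wpDl.
have delta'E : 2 * (L * (nn * delta')) <= e / 2.
  have -> : 2 * (L * (nn * delta')) = (L * nn) / (L * nn + 1) * (e / 2).
    by rewrite /delta'; field; rewrite gt_eqF // ltr_wpDl.
  by rewrite ler_piMl ?divr_ge0 ?(ltW e0) // ler_pdivrMr ?mul1r ?lerDl ?ltr_wpDl.
have [C1 C10 hC1] := @smooth_taylor R n delta' L delta'0 L0.
pose K := (C1 + 1) * (2 * S + (6 + d%:R) * S ^+ 2).
have e20 : 0 < e / 2 / h by rewrite !divr_gt0.
have [m [m0 hm]] := @sqrt_div_small h K _ (ltW h0) e20.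
(* Raised by the smoothing error so that it lies above V(t1), as [walk_iterate] requires. *)
pose psi x := smooth delta' (V t1) x + L * (nn * delta').
have near_psi y : `|smooth delta' (V t1) y - V t1 y| <= L * (nn * delta').
  by rewrite nnE; exact: smooth_near.
have Vpsi y : V t1 y <= psi y.
  by have := near_psi y; rewrite ler_norml /psi => /andP[? _]; lra.
have psiV y : psi y <= V t1 y + 2 * (L * (nn * delta')).
  by have := near_psi y; rewrite ler_norml /psi => /andP[_ ?]; lra.
have lpsi : lipf L psi.
  by move=> a b; rewrite /psi opprD addrACA subrr addr0; exact: smooth_lip.
have tpsi y : exists p X, forall v,
    `|psi (y + v) - psi y - fdot p v - 2^-1 * quad X v| <= (C1 + 1) * enorm v ^+ 3.
  have [p' [X' hX']] := hC1 _ lV1 y; exists p', X' => v; rewrite /psi.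
  rewrite opprD addrACA subrr addr0; apply: le_trans (hX' v) _.
  by rewrite ler_wpM2r ?exprn_ge0 ?enorm_ge0 // lerDl.
have C11 : 0 < C1 + 1 by rewrite ltr_wpDl.
have it := @walk_iterate R n d d0 s T c ce xh ce0 V t0 t1 t00 t01 t1T cV gV jV
  psi (C1 + 1) m C11 m0 Vpsi tpsi.
rewrite -hE -/K in it.
pose A f := iter m (walk s (h / m%:R)) f.
pose rho := nn * delta.
pose N := fdot (x - xh) (x - xh).
have step1 : smooth delta (V t0) x <= smooth delta (A psi) x +
    h * (c + 4 * ce * N + 4 * ce * rho ^+ 2 + (2 * ce * h * S + e / 2 / h)).
  apply: (@smooth_le R n delta delta0 L) => //; first exact: iter_walk_lip.
  move=> y yx; apply: le_trans (it y) _; rewrite lerD2l ler_wpM2l ?(ltW h0) //.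
  rewrite -!addrA lerD2l.
  have h1 : 2 * ce * fdot (y - xh) (y - xh) <= 4 * ce * N + 4 * ce * rho ^+ 2.
    have h2 := fdot_sqrD_le (y - x) (x - xh); rewrite subrKA -/N in h2.
    have h3 : fdot (y - x) (y - x) <= rho ^+ 2.
      by rewrite -enorm_leP ?mulr_ge0 ?(ltW delta0) // /rho nnE.
    have h4 : 2 * ce * fdot (y - xh) (y - xh) <= 2 * ce * (2 * rho ^+ 2 + 2 * N).
      by rewrite ler_wpM2l ?mulr_ge0 //; lra.
    lra.
  by apply: le_trans (lerD h1 (lerD (lexx _) hm)) _; rewrite -!addrA.
have step2 : smooth delta (A psi) x <= A (smooth delta (V t1)) x + 2 * (L * (nn * delta')).
  rewrite /A (smooth_iter_walk d0 s _ m x delta0 lpsi) -iter_walk_addc //.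
  apply: iter_walk_le => // y; apply: (@smooth_le R n delta delta0 L) => //.
have sh0 : 0 < Num.sqrt h by rewrite sqrtr_gt0.
have shh : Num.sqrt h * Num.sqrt h = h by rewrite -expr2 sqr_sqrtr // ltW.
have hm0 : 0 <= h / m%:R by rewrite divr_ge0 // ltW.
have mh : m%:R * (h / m%:R) = h by rewrite mulrC divfK // gt_eqF // ltr0n.
(* The cubic remainder around x is replaced by quadratic and quartic terms with eta = sqrt(h), whose
   expectations along the walk started at x are of order h^(3/2). *)
have step3 : A (smooth delta (V t1)) x <= smooth delta (V t1) x + h * (dif s X)
    + h * (Num.sqrt h * (C * (S + (d%:R + 6) * S ^+ 2))).
  have c20 : 0 <= C / Num.sqrt h by rewrite divr_ge0 // ltW.
  have := @walk_poly R n d d0 s (h / m%:R) m (smooth delta (V t1) x) p X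
    (C * Num.sqrt h) (C / Num.sqrt h) x x hm0 c20.
  rewrite subrr /quad mulmx0 !fdot0r mh expr0n /= !(mulr0, addr0, add0r).
  have e1 : h * (C * Num.sqrt h * S) + C / Num.sqrt h * ((d%:R + 6) * S ^+ 2 * h ^+ 2) =
      h * (Num.sqrt h * (C * (S + (d%:R + 6) * S ^+ 2))).
    by move: sh0 shh; move: (Num.sqrt h) => q q0 <-; field; rewrite gt_eqF.
  rewrite -e1 => hw; apply: (le_trans _ (le_trans hw _)); last by rewrite mulrDr !addrA.
  apply: iter_walk_le => // z.
  have := hX (z - x); rewrite [x + _]addrC subrK ler_norml => /andP[_].
  have := cube_le_quartic sh0 (enorm_ge0 (z - x)).
  rewrite [enorm _ ^+ 2]enorm_sqr => /(ler_wpM2l C0).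
  rewrite -/(quad X (z - x)).
  have -> : C * (Num.sqrt h * fdot (z - x) (z - x) + fdot (z - x) (z - x) ^+ 2 / Num.sqrt h) =
     C * Num.sqrt h * fdot (z - x) (z - x) + C / Num.sqrt h * fdot (z - x) (z - x) ^+ 2.
    by ring.
  set c3 := C * enorm _ ^+ 3; set q1 := C * _ * _; set q2 := _ * _ ^+ 2.
  by set a := smooth _ _ z; set b := smooth _ _ x; lra.
have e2 : h * (e / 2 / h) = e / 2 by rewrite mulrC divfK // gt_eqF.
have := le_trans step1 (lerD (le_trans step2 (lerD step3 delta'E)) (lexx _)).
rewrite [h * (c + _ + _ + _)]mulrDr [h * (2 * ce * h * S + _)]mulrDr e2 -/rho -nnE -/N.
rewrite /rho; lra.
Qed.

End SmoothMeanValue.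

(** * Sup-convolutions *)

Section SupConvolution.
Context (R : realType) (n : nat) (T L eps : R).
Context (W : R -> 'cV[R]_n -> R).
Hypothesis L0 : 0 <= L.
Hypothesis eps0 : 0 < eps.
Hypothesis lW : forall t, 0 <= t <= T -> lipf L (W t).
Hypothesis cW : continuous_strip T W.
Local Notation c := ((2 * eps)^-1).

Let c0 : 0 < c. Proof. by rewrite invr_gt0 mulr_gt0. Qed.

(** A chosen maximizer; [get] would return a default value on an empty set, so its property comes
    only with the existence proof in [supc_ge]. *)
Definition argsup t x : 'cV[R]_n := get [set y | forall y',
  W t y' - c * fdot (x - y') (x - y') <= W t y - c * fdot (x - y) (x - y)].

Definition supc t x : R := W t (argsup t x) - c * fdot (x - argsup t x) (x - argsup t x).

Let far_le t x y : 0 <= t <= T -> 2 * L * eps <= enorm (x - y) ->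
  W t y - c * fdot (x - y) (x - y) <= W t x.
Proof.
move=> tT hy; have := lW tT y x; rewrite enormB ler_norml => /andP[_ h].
rewrite -enorm_sqr; set r := enorm (x - y) in h hy *.
have r0 : 0 <= r by exact: enorm_ge0.
have h2 : L * r <= c * r ^+ 2.
  rewrite expr2 mulrA ler_wpM2r // mulrC ler_pdivlMr ?mulr_gt0 //; lra.
lra.
Qed.

(** A maximizer exists: points at distance at least 2 L eps from x do no better than y = x, since
    the Lipschitz gain L r is at most the penalty r^2 / (2 eps); near x the maximum is attained by
    compactness, applied to the degenerate time interval [t, t]. *)
Lemma supc_ge t x y : 0 <= t <= T -> W t y - c * fdot (x - y) (x - y) <= supc t x.
Proof.
move=> tT; suff : [set y | forall y',
    W t y' - c * fdot (x - y') (x - y') <= W t y - c * fdot (x - y) (x - y)] !=set0.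
  by move=> /getPex/(_ y).
pose f (t : R) y := W t y - c * fdot (x - y) (x - y).
have r0 : 0 <= enorm x + 2 * L * eps.
  by rewrite addr_ge0 ?enorm_ge0 // mulr_ge0 ?mulr_ge0 // ltW.
have cf : {within [set q : R * 'cV[R]_n | t <= q.1 <= t], continuous (fun q => f q.1 q.2)}.
  move=> q; apply: cvgB.
    apply: (continuous_subspaceW _ cW) => -[t' y'] /= /andP[h1 h2].
    by have -> : t' = t by apply/eqP; rewrite eq_le h1 h2.
  apply: (@continuous_subspaceT _ _ _
    (fun q : R * 'cV[R]_n => c * fdot (x - q.2) (x - q.2))) => z.
  apply: cvgM; first exact: cvg_cst.
  have cv : continuous (fun z : R * 'cV[R]_n => x - z.2).
    by move=> z'; apply: cvgB; [exact: cvg_cst | exact: cvg_snd].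
  exact: (fdot_continuous cv cv).
have [t' [ys [ht hmax]]] := strip_max (lexx t) r0 cf.
have tt : t' = t by case/andP: ht => h1 h2; apply/eqP; rewrite eq_le h1 h2.
rewrite tt in hmax; have tt' : t <= t <= t by rewrite lexx.
exists ys => y' /=; have [y'r|y'r] := leP (enorm y') (enorm x + 2 * L * eps).
  exact: hmax.
apply: le_trans (hmax t x tt' _); last by rewrite lerDl mulr_ge0 ?mulr_ge0 // ltW.
rewrite /f subrr fdot0l mulr0 subr0; apply: far_le => //.
by have := enormD (y' - x) x; rewrite subrK enormB; lra.
Qed.

Lemma supc_geW t x : 0 <= t <= T -> W t x <= supc t x.
Proof. by move=> tT; have := supc_ge x x tT; rewrite subrr fdot0l mulr0 subr0. Qed.

Lemma supc_le t x : 0 <= t <= T -> supc t x <= W t x + L ^+ 2 * eps.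
Proof.
move=> tT; rewrite /supc; set y := argsup t x.
have := lW tT y x; rewrite enormB ler_norml => /andP[_ h].
rewrite -enorm_sqr; set r := enorm (x - y) in h *.
have : L * r <= c * r ^+ 2 + L ^+ 2 * eps.
  have h1 : 0 <= c * (r - L * eps) ^+ 2 by rewrite mulr_ge0 ?sqr_ge0 // ltW.
  have h2 : c * (r - L * eps) ^+ 2 = c * r ^+ 2 - L * r + 2^-1 * (L ^+ 2 * eps).
    by field; rewrite gt_eqF.
  have h3 : 0 <= L ^+ 2 * eps by rewrite mulr_ge0 ?sqr_ge0 // ltW.
  lra.
lra.
Qed.

Lemma argsup_near t x : 0 <= t <= T -> enorm (argsup t x - x) <= 2 * L * eps.
Proof.
move=> tT; have := supc_geW x tT; rewrite /supc; set y := argsup t x.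
have := lW tT y x; rewrite enormB ler_norml => /andP[_ h].
rewrite -enorm_sqr; set r := enorm (x - y) in h * => h2.
have r0 : 0 <= r by exact: enorm_ge0.
have h3 : c * r * r <= L * r by rewrite -mulrA -expr2; lra.
have [->|rn0] := eqVneq r 0; first by rewrite mulr_ge0 ?mulr_ge0 // ltW.
have rp : 0 < r by rewrite lt_def rn0.
move: h3; rewrite ler_pM2r // => h3.
have -> : r = (2 * eps) * (c * r) by field; rewrite gt_eqF.
have -> : 2 * L * eps = (2 * eps) * L by ring.
by rewrite ler_wpM2l // mulr_ge0 // ltW.
Qed.

(** The gradient at x of the paraboloid centred at the maximizer, which touches the sup-convolution
    from below. *)
Definition slope t x : 'cV[R]_n := eps^-1 *: (argsup t x - x).

Lemma slope_le t x : 0 <= t <= T -> enorm (slope t x) <= 2 * L.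
Proof.
move=> tT; rewrite /slope enormZ gtr0_norm ?invr_gt0 // ler_pdivrMl // mulrC.
exact: argsup_near.
Qed.

Lemma supc_paraboloid t x v : 0 <= t <= T ->
  supc t x + fdot (slope t x) v - c * fdot v v <= supc t (x + v).
Proof.
move=> tT; apply: le_trans (supc_ge (x + v) (argsup t x) tT).
rewrite /supc /slope; have [y yE] : exists y, y = x - argsup t x by eexists.
have -> : x + v - argsup t x = y + v by rewrite yE addrAC.
have -> : argsup t x - x = - y by rewrite yE opprB.
rewrite -yE !fdotE (fdotC v y).
rewrite le_eqVlt; apply/orP; left; apply/eqP; field.
by rewrite gt_eqF.
Qed.

Lemma supc_lip t : 0 <= t <= T -> lipf L (supc t).
Proof.
move=> tT x y.
have e z w : supc t z <= supc t w + L * enorm (z - w).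
  have := supc_ge w (argsup t z + (w - z)) tT.
  have -> : w - (argsup t z + (w - z)) = z - argsup t z.
    by rewrite opprD opprB addrCA [w + (z - w)]addrC subrK addrC.
  have := lW tT (argsup t z) (argsup t z + (w - z)).
  have -> : argsup t z - (argsup t z + (w - z)) = z - w.
    by rewrite opprD addrA subrr add0r opprB.
  by rewrite ler_norml /supc => /andP[_ ?]; lra.
have := e x y; have := e y x; rewrite enormB ler_norml.
by move: (supc t x) (supc t y) => a a' ? ?; apply/andP; split; lra.
Qed.

Lemma supc_ctime : ctime T supc.
Proof.
move=> x t e tT e0.
have [r r0 hr] := continuous_strip_unif (enorm x + 2 * L * eps) cW tT e0.
exists r => // t' t'T t't.
have near u : 0 <= u <= T -> enorm (argsup u x) <= enorm x + 2 * L * eps.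
  move=> uT; have := enormD x (argsup u x - x); rewrite addrC subrK.
  by have := argsup_near x uT; lra.
have h1 := hr t' t'T t't _ (near _ tT); have h2 := hr t' t'T t't _ (near _ t'T).
have h3 := supc_ge x (argsup t x) t'T; have h4 := supc_ge x (argsup t' x) tT.
move: h1 h2; rewrite !ler_norml => /andP[? ?] /andP[? ?].
by apply/andP; split; rewrite /supc in h3 h4 *; lra.
Qed.

Lemma supc_continuous : continuous_strip T supc.
Proof. exact: ctime_continuous_strip supc_lip supc_ctime. Qed.

End SupConvolution.

(** * Jets of sup-convolutions *)

Section InfConvolutionMatrix.
Context (R : realType) (n : nat).
Implicit Types (X B M : 'M[R]_n) (v w h z : 'cV[R]_n).

Lemma small_scale (r : R) v : 0 < r -> exists2 e, 0 < e <= 1 & fdot (e *: v) (e *: v) < r.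
Proof.
move=> r0; pose N := fdot v v + 1; have N0 : 0 < N by rewrite ltr_wpDl ?fdot_ge0.
pose e := Num.min 1 (r / N); have e0 : 0 < e by rewrite lt_min ltr01 divr_gt0.
have e1 : e <= 1 by rewrite ge_min lexx.
exists e; first by rewrite e0 e1.
have eN : e * N <= r by rewrite -ler_pdivlMr // ge_min lexx orbT.
rewrite !fdotE mulrA; apply: (@lt_le_trans _ _ (e * N)) => //.
apply: (@le_lt_trans _ _ (e * fdot v v)).
  by rewrite ler_wpM2r ?fdot_ge0 // ler_piMl // ltW.
by rewrite ltr_pM2l // ltrDl.
Qed.

Lemma fdot_linear_eq0_local z (K r : R) : 0 < r ->
  (forall v, fdot v v < r -> fdot z v <= K * fdot v v) -> z = 0.
Proof.
move=> r0 hz; apply: (@fdot_linear_eq0 R n z `|K|) => v.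
have [e /andP[e0 e1] /hz] := small_scale v r0.
rewrite !fdotE mulrCA ler_pM2l // => h; apply: le_trans h _.
rewrite mulrA ler_wpM2r ?fdot_ge0 //; apply: le_trans (ler_norm _) _.
by rewrite normrM (gtr0_norm e0) ler_piMr.
Qed.

(* For symmetric X > - 1/eps, the quadratic form X' of the lemma is the
   inf-convolution of X with |.|^2 / eps; M is the (linear) minimizer. *)
Lemma quad_infconv X (eps eta : R) : 0 < eps -> 0 < eta -> X^T = X ->
  (forall v, - (eps^-1 * fdot v v) <= quad X v) ->
  exists M, forall w h, quad X (M *m h) + eps^-1 * fdot (M *m h - h) (M *m h - h)
    <= quad X w + eta * fdot w w + eps^-1 * fdot (w - h) (w - h).
Proof.
(* The form X + 1/eps may be degenerate; adding [eta] makes B positive definite, hence invertible,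
   at the price of the term in [eta]. *)
move=> eps0 eta0 Xsym hX; pose B := X + (eta + eps^-1)%:M.
have qB v : eta * fdot v v <= quad B v.
  by rewrite /B quadD quad_scalar; have := hX v; lra.
have Bsym : B^T = B by rewrite /B linearD /= Xsym tr_scalar_mx.
have BU : B \in unitmx.
  rewrite -unitmx_tr -row_free_unit; apply: inj_row_free => v hv.
  have bv : B *m v^T = 0 by rewrite -[B]trmxK -trmx_mul hv trmx0.
  have := qB v^T; rewrite /quad bv fdot0r => h.
  have : fdot v^T v^T = 0.
    apply/eqP; rewrite eq_le fdot_ge0 andbT; rewrite -(ler_pM2l eta0) mulr0 //.
  by move/fdot_eq0 => /(congr1 trmx); rewrite trmxK trmx0.
exists (eps^-1 *: invmx B) => w h.
have [u uE] : exists u, u = eps^-1 *: invmx B *m h by eexists.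
have Bu : B *m u = eps^-1 *: h by rewrite uE -scalemxAl -scalemxAr mulKVmx.
rewrite -uE.
have [dl dE] : exists dl, dl = w - u by eexists.
have -> : w = u + dl by rewrite dE addrC subrK.
have qd : 0 <= quad B dl by apply: le_trans (qB dl); rewrite mulr_ge0 ?fdot_ge0 // ltW.
have Bq v : quad X v = quad B v - (eta + eps^-1) * fdot v v.
  by rewrite /B quadD quad_scalar; ring.
have qud : quad B (u + dl) = quad B u + 2 * eps^-1 * fdot dl h + quad B dl.
  rewrite quad_add Bu fdotZr.
  have -> : fdot u (B *m dl) = fdot (B *m u) dl by rewrite fdot_mulmxl Bsym.
  by rewrite Bu fdotZl (fdotC h dl); ring.
have eu : 0 <= eta * fdot u u by rewrite mulr_ge0 ?fdot_ge0 // ltW.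
rewrite !Bq qud !fdotE (fdotC h u) (fdotC h dl) (fdotC dl u).
lra.
Qed.

End InfConvolutionMatrix.

Section SupConvolutionJets.
Context (R : realType) (n : nat) (T L eps : R).
Context (W : R -> 'cV[R]_n -> R).
Hypothesis L0 : 0 <= L.
Hypothesis eps0 : 0 < eps.
Hypothesis lW : forall t, 0 <= t <= T -> lipf L (W t).
Hypothesis cW : continuous_strip T W.
Local Notation V := (supc eps W).
Local Notation Y := (argsup eps W).
Local Notation c := ((2 * eps)^-1).

(** Usually W inherits the jet with X itself. The sharper X' satisfies the stated inequality for two
    different vectors w and h; with w and h columns of sigma at two different points it compares the
    diffusion terms there at the cost |w - h|^2 / eps. This takes over the role of the matrix
    inequality in the theorem on sums. *)
Lemma supc_ujet t x a p X eta : 0 <= t <= T -> ujet T V t x a p X -> 0 < eta ->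
  p = slope eps W t x /\
  exists2 X', ujet T W t (Y t x) a p X' & forall w h,
    quad X' h <= quad X w + eta * fdot w w + eps^-1 * fdot (w - h) (w - h).
Proof.
move=> tT jV eta0; pose Xs := 2^-1 *: (X + X^T).
have Xssym : Xs^T = Xs by rewrite /Xs linearZ /= linearD /= trmxK addrC.
have qXs v : quad Xs v = quad X v by rewrite /Xs quadZ quadD quad_tr; field.
have tt : 0 <= t + 0 <= T by rewrite addr0.
(* The jet lies above the touching paraboloid. First order terms then identify p, and second order
   terms give X >= - 1/eps. *)
have low e : 0 < e -> exists2 r, 0 < r & forall v, fdot v v < r ->
    fdot (slope eps W t x) v - c * fdot v v <= fdot p v + 2^-1 * quad X v + e * fdot v v.
  move=> e0; have [C [r [r0 hr]]] := jV e e0; exists r => // v vr.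
  have z0 : `|0 : R| < r by rewrite normr0.
  have := hr 0 v z0 vr tt; rewrite addr0 !(mulr0, addr0) expr0n /= mulr0 addr0.
  have := supc_paraboloid L0 eps0 lW cW x v tT; lra.
have pE : p = slope eps W t x.
  have [r r0 hr] := low 1 ltr01.
  apply/esym/subr0_eq; apply: (@fdot_linear_eq0_local R n _ (c + 1 + enorm X) r r0) => v vr.
  have := hr v vr; have := quad_abs_le X v; rewrite ler_norml fdotBl => /andP[_ ?].
  have : 0 <= enorm X * fdot v v by rewrite mulr_ge0 ?enorm_ge0 ?fdot_ge0.
  lra.
have qX v : - (eps^-1 * fdot v v) <= quad Xs v.
  rewrite qXs -subr_ge0 opprK; apply/ler_addgt0Pr => e e0.
  have e'0 : 0 < e / (2 * (fdot v v + 1)).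
    by rewrite divr_gt0 // mulr_gt0 // ltr_wpDl ?fdot_ge0.
  have [r r0 hr] := low _ e'0.
  have [f /andP[f0 _] /hr] := small_scale v r0.
  rewrite -pE quad_scale !fdotE => h.
  have f2 : 0 < f * f by rewrite mulr_gt0.
  have h2 : 0 <= quad X v + eps^-1 * fdot v v + 2 * (e / (2 * (fdot v v + 1))) * fdot v v.
    rewrite -(pmulr_rge0 _ f2).
    have -> : eps^-1 = 2 * c by field; rewrite gt_eqF.
    by rewrite expr2 in h; lra.
  have h3 : 2 * (e / (2 * (fdot v v + 1))) * fdot v v <= e.
    have -> : 2 * (e / (2 * (fdot v v + 1))) * fdot v v = e * (fdot v v / (fdot v v + 1)).
      by field; rewrite gt_eqF // ltr_wpDl ?fdot_ge0.
    by rewrite ler_piMr ?(ltW e0) // ler_pdivrMr ?mul1r ?lerDl // ltr_wpDl ?fdot_ge0.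
  lra.
split => //; have [M hM] := quad_infconv eps0 eta0 Xssym qX.
pose X' := M^T *m X *m M + eps^-1 *: ((M - 1%:M)^T *m (M - 1%:M)).
have qX' h : quad X' h = quad X (M *m h) + eps^-1 * fdot (M *m h - h) (M *m h - h).
  rewrite /X' quadD quadZ; congr (_ + _ * _).
    by rewrite /quad -!mulmxA fdot_mulmxl.
  have -> : M *m h - h = (M - 1%:M) *m h by rewrite mulmxBl mul1mx.
  by rewrite /quad -mulmxA fdot_mulmxl.
exists X'; last by move=> w h; rewrite qX' -!qXs; exact: hM.
move=> e e0; pose K := enorm M ^+ 2 + 1.
have K0 : 0 < K by rewrite ltr_wpDl ?sqr_ge0.
have MK w : fdot (M *m w) (M *m w) <= K * fdot w w.
  rewrite -!enorm_sqr; have := enorm_mulmx M w; rewrite -ler_sqr ?nnegrE ?mulr_ge0 ?enorm_ge0 //.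
  rewrite exprMn /K; have := sqr_ge0 (enorm w); lra.
have eK0 : 0 < e / K by rewrite divr_gt0.
have [C [r [r0 hr]]] := jV _ eK0.
exists C, (Num.min r (r / K)); split; first by rewrite lt_min r0 divr_gt0.
move=> sg w; rewrite !lt_min => /andP[sr _] /andP[_ wr] tsT.
have Mwr : fdot (M *m w) (M *m w) < r.
  apply: (@le_lt_trans _ _ (K * fdot w w)); first exact: MK.
  by rewrite mulrC -ltr_pdivlMr.
have h1 := hr sg (M *m w) sr Mwr tsT.
(* Moving the base point by M w while moving the maximizer by w is the optimal coupling of the two
   increments, and produces X' as an inf-convolution. *)
have h2 := supc_ge L0 eps0 lW cW (x + M *m w) (Y t x + w) tsT.
have h3 : e / K * fdot (M *m w) (M *m w) <= e * fdot w w.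
  by rewrite -mulrA ler_pM2l // ler_pdivrMl.
have [u uE] : exists u, u = M *m w by eexists.
have [y yE] : exists y, y = x - Y t x by eexists.
rewrite -uE in h1 h2 h3.
have e1 : x + u - (Y t x + w) = y + (u - w).
  by rewrite yE opprD addrACA.
rewrite e1 in h2.
have slE : p = - (eps^-1 *: y) by rewrite pE /slope yE -scalerN opprB.
have h4 : V t x = W t (Y t x) - c * fdot y y by rewrite /supc yE.
have h5 : fdot p u + c * (2 * fdot y (u - w)) = fdot p w.
  by rewrite slE !fdotE; field; rewrite gt_eqF.
have h6 : fdot (y + (u - w)) (y + (u - w)) =
    fdot y y + 2 * fdot y (u - w) + fdot (u - w) (u - w).
  by move: (u - w) => z; rewrite !fdotE (fdotC z y); ring.
have h7 : 2^-1 * quad X' w = 2^-1 * quad X u + c * fdot (u - w) (u - w).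
  by rewrite qX' -uE; field; rewrite gt_eqF.
rewrite h7; rewrite h6 in h2; rewrite h4 in h1.
move: h1 h2 h3 h5; rewrite ![c * (_ + _)]mulrDr; lra.
Qed.

(** V(t) lies above a paraboloid with the slope at x, and V(th) below one with the slope at xh.
    Since V(t) and V(th) are uniformly close on bounded sets, evaluating both at a point displaced
    from x along the difference of the slopes bounds that difference. *)
Lemma supc_slope_control th xh K theta : 0 <= th <= T -> 0 < theta ->
  (forall v, V th (xh + v) <= V th xh + fdot (slope eps W th xh) v + K * fdot v v) ->
  exists r C, [/\ 0 < r, 0 <= C & forall t x, 0 <= t <= T -> `|t - th| < r ->
    fdot (slope eps W t x - slope eps W th xh) (slope eps W t x - slope eps W th xh)
      <= theta + C * fdot (x - xh) (x - xh)].
Proof.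
move=> thT theta0 hK; have c0 : 0 < c by rewrite invr_gt0 mulr_gt0.
have [C1 C1E] : exists C1 : R, C1 = c + 2 * `|K| by eexists.
have C10 : 0 < C1 by rewrite C1E ltr_pwDl // mulr_ge0.
have om0 : 0 < theta / (8 * C1) by rewrite divr_gt0 // mulr_gt0.
have [rad radE] : exists rad : R, rad = enorm xh + 1 + 4 * L / (2 * C1) by eexists.
have cV := supc_continuous L0 eps0 lW cW.
have [r r0 hr] := continuous_strip_unif rad cV thT om0.
exists r, (4 * C1 ^+ 2 + 16 * L ^+ 2); split => //.
  by rewrite addr_ge0 // mulr_ge0 // sqr_ge0.
move=> t x tT tr.
have [p pE] : exists p, p = slope eps W t x - slope eps W th xh by eexists.
rewrite -pE; have [y yE] : exists y, y = x - xh by eexists.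
rewrite -yE.
have p4 : enorm p <= 4 * L.
  rewrite pE; apply: le_trans (enormD _ _) _; rewrite enormN.
  have := slope_le L0 eps0 lW cW x tT; have := slope_le L0 eps0 lW cW xh thT; lra.
have y0 := fdot_ge0 y; have L20 := sqr_ge0 L.
(* Uniform closeness in time holds on bounded sets only; far from xh the bound 4 L on the difference
   of the slopes is enough. *)
have [y1|y1] := leP (fdot y y) 1; last first.
  have : fdot p p <= (4 * L) ^+ 2 by rewrite -enorm_leP // mulr_ge0.
  have h1 : 16 * L ^+ 2 <= 16 * L ^+ 2 * fdot y y.
    by rewrite ler_peMr ?mulr_ge0 // ltW.
  have h2 : 0 <= C1 ^+ 2 * fdot y y by rewrite mulr_ge0 ?sqr_ge0.
  rewrite exprMn -natrX; lra.
(* This step length maximizes the gain k |p|^2 - C1 k^2 |p|^2. *)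
have [k kE] : exists k : R, k = (2 * C1)^-1 by eexists.
have k0 : 0 < k by rewrite kE invr_gt0 mulr_gt0.
have xE : x = xh + y by rewrite yE addrC subrK.
have ny : enorm y <= 1 by apply: enorm_le => //; rewrite expr1n.
have nx : enorm x <= rad.
  rewrite xE; apply: le_trans (enormD _ _) _.
  have : 0 <= 4 * L / (2 * C1) by rewrite divr_ge0 ?mulr_ge0 // ltW.
  by rewrite radE; lra.
have nw : enorm (x + k *: p) <= rad.
  rewrite xE; apply: le_trans (enormD _ _) _; apply: le_trans (lerD (enormD _ _) (lexx _)) _.
  rewrite enormZ (gtr0_norm k0) radE.
  have : k * enorm p <= 4 * L / (2 * C1) by rewrite kE mulrC ler_wpM2r // invr_ge0 mulr_ge0 // ltW.
  lra.
have Kle : K * fdot (y + k *: p) (y + k *: p) <=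
    2 * `|K| * fdot y y + 2 * `|K| * (k ^+ 2 * fdot p p).
  have h := fdot_sqrD_le y (k *: p); apply: (@le_trans _ _ (`|K| * fdot (y + k *: p) (y + k *: p))).
    by rewrite ler_wpM2r ?fdot_ge0 // ler_norm.
  have := ler_wpM2l (normr_ge0 K) h; rewrite !fdotE; lra.
have w1 := hr _ tT tr _ nx; have w2 := hr _ tT tr _ nw.
have par := supc_paraboloid L0 eps0 lW cW x (k *: p) tT.
have par2 := supc_paraboloid L0 eps0 lW cW xh y thT; rewrite -xE in par2.
have up := hK (y + k *: p); rewrite addrA -xE in up.
have slE : slope eps W t x = p + slope eps W th xh by rewrite pE subrK.
rewrite slE in par; move: (slope eps W th xh) par par2 up => ph par par2 up.
move: w1 w2; rewrite !ler_norml => /andP[w1 _] /andP[_ w2].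
have main : k * fdot p p <= C1 * (k ^+ 2 * fdot p p) + C1 * fdot y y + 2 * (theta / (8 * C1)).
  move: par par2 up Kle w1 w2.
  rewrite (fdotDr ph y) (fdotDl p ph) !(fdotZr, fdotZl) C1E => par par2 up Kle w1 w2.
  move: (fdot (y + k *: p) (y + k *: p)) up Kle => Q up Kle.
  rewrite expr2 in Kle *.
  move: (V t (x + k *: p)) (V th (x + k *: p)) (V t x) (V th x) (V th xh) par par2 up w1 w2.
  move=> v1 v2 v3 v4 v5 par par2 up w1 w2; lra.
have kC : C1 * (k ^+ 2 * fdot p p) = 2^-1 * (k * fdot p p).
  by rewrite kE; field; rewrite gt_eqF.
rewrite kC in main; clear par par2 up w1 w2.
have -> : fdot p p = 4 * C1 * (2^-1 * (k * fdot p p)) by rewrite kE; field; rewrite gt_eqF.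
have h1 : 2^-1 * (k * fdot p p) <= C1 * fdot y y + 2 * (theta / (8 * C1)) by lra.
have C40 : 0 <= 4 * C1 by rewrite mulr_ge0 // ltW.
apply: le_trans (ler_wpM2l C40 h1) _.
have -> : 4 * C1 * (C1 * fdot y y + 2 * (theta / (8 * C1))) = theta + 4 * C1 ^+ 2 * fdot y y.
  by field; rewrite gt_eqF.
by rewrite lerD2l ler_wpM2r // lerDl mulr_ge0.
Qed.

End SupConvolutionJets.

(** * Freezing the coefficients *)

Section ScalarEstimates.
Context (R : realType).
Implicit Types a c e eps kf l th y z : R.

Lemma young_sq (a y theta : R) : 0 < theta -> 0 <= a ->
  a * y <= theta + a ^+ 2 / (4 * theta) * y ^+ 2.
Proof.
move=> th0 a0; rewrite -subr_ge0.
have -> : theta + a ^+ 2 / (4 * theta) * y ^+ 2 - a * y =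
  (2 * theta - a * y) ^+ 2 / (4 * theta) by field; rewrite gt_eqF.
by rewrite divr_ge0 ?sqr_ge0 ?mulr_ge0 // ltW.
Qed.

Lemma young_linear kf l eps th z5 y : 0 < th -> 0 <= kf -> 0 <= l -> kf * z5 <= th ->
  kf * (y + 2 * l * eps + (l * (y + 2 * l * eps) + z5 + l ^+ 2 * eps)) <=
  kf * (2 * l + 3 * l ^+ 2) * eps + 2 * th + (kf * (1 + l)) ^+ 2 / (4 * th) * y ^+ 2.
Proof.
move=> th0 kf0 l0 h; have M0 : 0 <= kf * (1 + l) by rewrite mulr_ge0 // addr_ge0.
have := young_sq y th0 M0; move: (_ / _ * y ^+ 2) => w; lra.
Qed.

Lemma young_slope a c z3 th y z : 0 < th -> 0 <= a -> a ^+ 2 / (4 * th) * z3 <= th ->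
  z ^+ 2 <= z3 + c * y ^+ 2 -> a * z <= 2 * th + a ^+ 2 / (4 * th) * c * y ^+ 2.
Proof.
move=> th0 a0 h1 h2; have := young_sq z th0 a0.
have a20 : 0 <= a ^+ 2 / (4 * th) by rewrite divr_ge0 ?sqr_ge0 // mulr_ge0 // ltW.
by move: h1 (ler_wpM2l a20 h2); rewrite mulrDr !mulrA; lra.
Qed.

Lemma sq_jump_le c l eps th z2 y z : 0 < eps -> 0 < th -> z2 ^+ 2 <= eps * th -> 0 <= z ->
  z <= c * y + c * (2 * l * eps) + z2 ->
  (2 * eps)^-1 * z ^+ 2 <=
  3 * c ^+ 2 / (2 * eps) * y ^+ 2 + 6 * c ^+ 2 * l ^+ 2 * eps + 2 * th.
Proof.
move=> eps0 th0 h2 z0 hz.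
have hz2 : z ^+ 2 <= 3 * (c * y) ^+ 2 + 3 * (c * (2 * l * eps)) ^+ 2 + 3 * z2 ^+ 2.
  apply: (@le_trans _ _ ((c * y + c * (2 * l * eps) + z2) ^+ 2)).
    by rewrite lerXn2r ?nnegrE // (le_trans z0 hz).
  move: (c * y) (c * (2 * l * eps)) => q1 q2.
  have := sqr_ge0 (q1 - q2); have := sqr_ge0 (q1 - z2); have := sqr_ge0 (q2 - z2).
  by rewrite !expr2; lra.
have ce0 : 0 <= (2 * eps)^-1 by rewrite invr_ge0 mulr_ge0 // ltW.
apply: le_trans (ler_wpM2l ce0 hz2) _.
have := ler_wpM2l ce0 h2.
have -> : (2 * eps)^-1 * (eps * th) = th / 2 by field; rewrite gt_eqF.
have -> : (2 * eps)^-1 * (3 * (c * y) ^+ 2 + 3 * (c * (2 * l * eps)) ^+ 2 + 3 * z2 ^+ 2) =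
  3 * c ^+ 2 / (2 * eps) * y ^+ 2 + 6 * c ^+ 2 * l ^+ 2 * eps + 3 * ((2 * eps)^-1 * z2 ^+ 2).
  by field; rewrite gt_eqF.
move: ((2 * eps)^-1 * _) => w; lra.
Qed.

Lemma scaled_le_budget e z f : 0 < e -> 0 <= f -> f <= z -> e / (z + 1) / 2 * f <= e.
Proof.
move=> e0 f0 fz; have z1 : 0 < z + 1 by lra.
have -> : e / (z + 1) / 2 * f = e * (f / (2 * (z + 1))) by field; rewrite gt_eqF.
by rewrite ler_piMr ?(ltW e0) // ler_pdivrMr ?mulr_gt0 //; lra.
Qed.

Lemma abs_diff_le (w v0 w' V l r th m : R) : `|w - v0| <= l * r -> `|v0 - w'| <= th ->
  w' <= V -> V <= w' + m -> `|w - V| <= l * r + th + m.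
Proof.
rewrite !ler_norml => /andP[? ?] /andP[? ?] ? ?; apply/andP; split; lra.
Qed.

Lemma sum_le_budget (d1 d2 n1 n2 n3 f1 f2 F P a a' c c' c'' q e eps th : R) :
  0 < th -> n3 <= n1 + n2 -> n1 <= F + P -> n2 <= th -> F <= a * eps + 2 * th + c * q ->
  P <= 2 * th + c' * q -> d1 <= d2 + f1 + f2 -> f2 <= c'' * q + a' * eps + 2 * th -> f1 <= e ->
  d1 + n3 <= d2 + ((a + a') * eps + 8 * th + (c' + c + c'') * q) + e.
Proof. by move=> h h1 h2 h3 h4 h5 h6 h7 h8; rewrite !mulrDl; lra. Qed.

End ScalarEstimates.

Section FrozenCoefficients.
Context (R : realType) (n d k : nat) (T : R) (U : set 'cV[R]_k).
Context (b : R -> 'cV[R]_n -> R -> 'rV[R]_d -> 'cV[R]_k -> 'cV[R]_n).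
Context (sigma : R -> 'cV[R]_n -> 'cV[R]_k -> 'M[R]_(n, d)).
Context (g : R -> 'cV[R]_n -> R -> 'rV[R]_d -> 'cV[R]_k -> R).
Context (phi : 'cV[R]_n -> R).
Variables (Lc Lw B : R).
Hypothesis T0 : 0 <= T.
Hypothesis Lc0 : 0 <= Lc.
Hypothesis Lw0 : 0 <= Lw.
Hypothesis lip : lip_coefs T U b sigma g Lc.
Hypothesis cU : compact U.
Hypothesis cc : continuous_coefficients T U b sigma g phi.
Hypothesis bdd : forall t u, 0 <= t <= T -> U u ->
  [/\ enorm (sigma t 0 u) <= B, enorm (b t 0 0 0 u) <= B & `|g t 0 0 0 u| <= B].
Hypothesis B0 : 0 <= B.
Local Notation ft := (fterm b sigma g).

Definition ft_lip : R := (2 * Lw + 1) * Lc * (1 + 2 * Lw * Lc).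

Lemma ft_lip_ge0 : 0 <= ft_lip.
Proof. by rewrite /ft_lip !mulr_ge0 ?addr_ge0 ?mulr_ge0. Qed.

(** The factor of eps in the freezing error. The first summand comes from |Y - x| <= 2 Lw eps and
    the gap Lw^2 eps between W and its sup-convolution, the second from the squared jump of sigma
    divided by 2 eps. It does not depend on eps or on the point, so a small eps makes the error
    small. *)
Definition frozen_err : R := ft_lip * (2 * Lw + 3 * Lw ^+ 2) + 6 * Lc ^+ 2 * Lw ^+ 2.

Lemma frozen_err_ge0 : 0 <= frozen_err.
Proof.
apply: addr_ge0; last by rewrite !mulr_ge0 ?sqr_ge0.
by apply: mulr_ge0; [exact: ft_lip_ge0 | rewrite addr_ge0 ?mulr_ge0 ?sqr_ge0].
Qed.

Section Frozen.
Variables (W : R -> 'cV[R]_n -> R) (eps sg : R).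
Hypothesis eps0 : 0 < eps.
Hypothesis lW : forall t, 0 <= t <= T -> lipf Lw (W t).
Hypothesis cW : continuous_strip T W.
Hypothesis sg1 : `|sg| = 1.
Local Notation V := (supc eps W).
Local Notation Y := (argsup eps W).
Local Notation sl := (slope eps W).

Lemma dif_jump_le (s s' : 'M[R]_(n, d)) (X X' : 'M[R]_n) eta :
  (forall w h, quad X' h <= quad X w + eta * fdot w w + eps^-1 * fdot (w - h) (w - h)) ->
  dif s' X' <= dif s X + eta / 2 * fdot s s + (2 * eps)^-1 * fdot (s - s') (s - s').
Proof.
move=> h.
have -> : dif s X + eta / 2 * fdot s s + (2 * eps)^-1 * fdot (s - s') (s - s') =
  2^-1 * \sum_j (quad X (col j s) + eta * fdot (col j s) (col j s) +
    eps^-1 * fdot (col j s - col j s') (col j s - col j s')).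
  rewrite !big_split /= -!mulr_sumr sum_fdot_col.
  under [X in eps^-1 * X]eq_bigr do rewrite -linearB /=.
  by rewrite sum_fdot_col /dif; field; rewrite gt_eqF.
by rewrite ler_wpM2l ?invr_ge0 //; apply: ler_sum => j _; exact: h.
Qed.

(** The sign [sg] lets one statement serve W1 and - W2, and the absolute value bounds the change of
    the first order term in both directions. Since X' is obtained before u, the inequality holds for
    all controls at once. *)
Lemma supc_frozen th xh K theta : 0 <= th <= T -> 0 < theta ->
  (forall v, V th (xh + v) <= V th xh + fdot (sl th xh) v + K * fdot v v) ->
  exists r C, [/\ 0 < r, 0 <= C & forall t x a p X, 0 <= t <= T -> `|t - th| < r ->
    ujet T V t x a p X -> forall e, 0 < e ->
    exists2 X', ujet T W t (Y t x) a p X' & forall u, U u ->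
      dif (sigma t (Y t x) u) X' +
      `|ft t (Y t x) (sg * W t (Y t x)) (sg *: p) u - ft th xh (sg * V th xh) (sg *: sl th xh) u|
      <= dif (sigma th xh u) X + (frozen_err * eps + theta + C * fdot (x - xh) (x - xh)) + e].
Proof.
move=> thT th0 hK.
(* The budget [theta] is spent in eight equal shares, added up in [sum_le_budget]. *)
pose th6 := theta / 8; have th60 : 0 < th6 by rewrite divr_gt0.
pose ph := sl th xh; pose vh := sg * V th xh.
pose sb := B + Lc * enorm xh.
have sb0 : 0 <= sb by rewrite addr_ge0 // mulr_ge0 // enorm_ge0.
pose bb := B + Lc * (enorm xh + `|vh| + 2 * Lw * sb).
pose A := bb + (2 * Lw + 1) * Lc * sb.
have A0 : 0 <= A.
  by rewrite /A /bb !addr_ge0 ?mulr_ge0 ?addr_ge0 ?mulr_ge0 ?enorm_ge0.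
(* |p - ph| enters linearly with the factor A; Young's inequality turns it
   into a small constant plus a multiple of |x - xh|^2. *)
pose A2 := A ^+ 2 / (4 * th6).
have A20 : 0 <= A2 by rewrite divr_ge0 ?sqr_ge0 // mulr_ge0 // ltW.
pose th3 := th6 / (A2 + 1).
have A21 : 0 < A2 + 1 by rewrite ltr_wpDl.
have th30 : 0 < th3 by rewrite divr_gt0.
have [r1 [C1 [r10 C10 h1]]] := supc_slope_control Lw0 eps0 lW cW thT th30 hK.
(* The jump of sigma in time is squared and divided by 2 eps, so its square must be at most eps
   times a share; the minimum with 1 makes the square smaller than the number. *)
pose th2 := Num.min 1 (eps * th6).
have th20 : 0 < th2 by rewrite lt_min ltr01 mulr_gt0.
have [r2 r20 h2] := coefs_time_modulus T0 Lc0 lip cU cc xh vh (sg *: ph) thT th60.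
have [r4 r40 h4] := coefs_time_modulus T0 Lc0 lip cU cc xh vh (sg *: ph) thT th20.
have KF0 := ft_lip_ge0; set KF := ft_lip in KF0.
pose th5 := th6 / (KF + 1).
have KF1 : 0 < KF + 1 by rewrite ltr_wpDl.
have th50 : 0 < th5 by rewrite divr_gt0.
have [r3 r30 h3] := continuous_strip_ctime cW xh thT th50.
pose M := KF * (1 + Lw); have M0 : 0 <= M by rewrite mulr_ge0 // addr_ge0.
pose C := A2 * C1 + M ^+ 2 / (4 * th6) + 3 * Lc ^+ 2 / (2 * eps).
have C2 : 0 <= M ^+ 2 / (4 * th6) by rewrite divr_ge0 ?sqr_ge0 // mulr_ge0 // ltW.
have C3 : 0 <= 3 * Lc ^+ 2 / (2 * eps).
  by rewrite divr_ge0 ?mulr_ge0 ?sqr_ge0 // ltW.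
exists (Num.min (Num.min r1 r2) (Num.min r3 r4)), C; split.
- by rewrite !lt_min r10 r20 r30.
- by rewrite /C !addr_ge0 // mulr_ge0.
move=> t x a p X tT; rewrite !lt_min => /andP[/andP[t1 t2] /andP[t3 t4]] jV e e0.
pose eta := e / (sb ^+ 2 + 1).
have sb1 : 0 < sb ^+ 2 + 1 by rewrite ltr_wpDl ?sqr_ge0.
have eta0 : 0 < eta by rewrite divr_gt0.
have [pE [X' jX' hX']] := supc_ujet Lw0 eps0 lW cW tT jV eta0.
exists X' => // u Uu.
have sgth : enorm (sigma th xh u) <= sb by exact: (sigma_growth lip bdd).
have [nu nuE] : exists nu : R, nu = enorm (x - xh) by eexists.
have nu0 : 0 <= nu by rewrite nuE enorm_ge0.
have nu2 : fdot (x - xh) (x - xh) = nu ^+ 2 by rewrite nuE enorm_sqr.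
have Yxh : enorm (Y t x - xh) <= nu + 2 * Lw * eps.
  rewrite -(subrKA x); apply: le_trans (enormD _ _) _; rewrite -nuE addrC lerD2l.
  exact: (argsup_near Lw0 eps0 lW cW).
have Yxh0 := enorm_ge0 (Y t x - xh).
have sgE (z : 'cV[R]_n) : enorm (sg *: z) = enorm z by rewrite enormZ sg1 mul1r.
have Wvh : `|sg * W t (Y t x) - vh| <= Lw * enorm (Y t x - xh) + th5 + Lw ^+ 2 * eps.
  rewrite /vh -mulrBr normrM sg1 mul1r.
  have e1 := lW tT (Y t x) xh; have e2 := h3 _ tT t3.
  have e3 := supc_geW Lw0 eps0 lW cW xh thT; have e4 := supc_le eps0 lW xh thT.
  exact: abs_diff_le e1 e2 e3 e4.
have ppl : enorm (sg *: p) <= 2 * Lw by rewrite sgE pE (slope_le Lw0 eps0 lW cW).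
have phl : enorm (sg *: ph) <= 2 * Lw by rewrite sgE (slope_le Lw0 eps0 lW cW).
have [dp dpE] : exists dp : R, dp = enorm (p - ph) by eexists.
have hdp : A * dp <= 2 * th6 + A2 * C1 * nu ^+ 2.
  have y2 : dp ^+ 2 <= th3 + C1 * nu ^+ 2.
    by rewrite dpE enorm_sqr -nu2 pE; exact: h1.
  apply: young_slope y2 => //.
  by rewrite /th3 mulrCA ler_piMr ?(ltW th60) // ler_pdivrMr // mul1r lerDl.
have hft : `|ft t (Y t x) (sg * W t (Y t x)) (sg *: p) u - ft t xh vh (sg *: ph) u| <=
    KF * (nu + 2 * Lw * eps + (Lw * (nu + 2 * Lw * eps) + th5 + Lw ^+ 2 * eps)) + A * dp.
  apply: le_trans (fterm_lip Lc0 lip xh _ vh _ (sg *: ph) tT Uu ppl) _; apply: lerD.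
    rewrite -/ft_lip -/KF ler_wpM2l // lerD //; apply: le_trans Wvh _.
    by rewrite !lerD2r ler_wpM2l.
  rewrite -scalerBr sgE -dpE ler_wpM2r ?dpE ?enorm_ge0 //.
  have sgt : enorm (sigma t xh u) <= sb by exact: (sigma_growth lip bdd).
  apply: lerD; last by rewrite ler_wpM2l // mulr_ge0 // addr_ge0 // mulr_ge0.
  apply: le_trans (b_growth lip bdd _ _ _ tT Uu) _.
  rewrite /bb lerD2l ler_wpM2l // lerD2l.
  apply: le_trans (enorm_mulmx _ _) _; rewrite enorm_trmx.
  by apply: ler_pM; rewrite ?enorm_ge0.
have [_ hft2] := h2 _ tT t2 _ Uu.
have hft3 : KF * (nu + 2 * Lw * eps + (Lw * (nu + 2 * Lw * eps) + th5 + Lw ^+ 2 * eps)) <=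
   KF * (2 * Lw + 3 * Lw ^+ 2) * eps + 2 * th6 + M ^+ 2 / (4 * th6) * nu ^+ 2.
  apply: young_linear => //.
  by rewrite /th5 mulrCA ler_piMr ?(ltW th60) // ler_pdivrMr // mul1r lerDl.
have [hs _] := h4 _ tT t4 _ Uu.
have hsig : enorm (sigma th xh u - sigma t (Y t x) u) <= Lc * nu + Lc * (2 * Lw * eps) + th2.
  rewrite -(subrKA (sigma t xh u)); apply: le_trans (enormD _ _) _.
  have [_ l1 _] := lip tT Uu xh (Y t x) 0 0 0 0.
  rewrite enormB in hs; rewrite enormB in Yxh.
  rewrite addrC lerD // (le_trans l1) // -mulrDr ler_wpM2l //.
have hsig2 : (2 * eps)^-1 * fdot (sigma th xh u - sigma t (Y t x) u)
     (sigma th xh u - sigma t (Y t x) u) <=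
   3 * Lc ^+ 2 / (2 * eps) * nu ^+ 2 + 6 * Lc ^+ 2 * Lw ^+ 2 * eps + 2 * th6.
  rewrite -enorm_sqr; apply: sq_jump_le hsig => //; last exact: enorm_ge0.
  rewrite expr2; have m1 : th2 <= 1 by rewrite ge_min lexx.
  have m2 : th2 <= eps * th6 by rewrite ge_min lexx orbT.
  by apply: le_trans m2; rewrite ler_piMl // ltW.
have hdif := dif_jump_le (sigma th xh u) (sigma t (Y t x) u) hX'.
have heta : eta / 2 * fdot (sigma th xh u) (sigma th xh u) <= e.
  by apply: scaled_le_budget; rewrite ?fdot_ge0 // -enorm_leP.
rewrite -/ph -/vh nu2.
have tri := ler_normD (ft t (Y t x) (sg * W t (Y t x)) (sg *: p) u - ft t xh vh (sg *: ph) u)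
  (ft t xh vh (sg *: ph) u - ft th xh vh (sg *: ph) u).
rewrite subrKA in tri.
have thE : theta = 8 * th6 by rewrite /th6; field.
rewrite /frozen_err -/KF thE /C; exact: (sum_le_budget th60 tri hft hft2 hft3 hdp hdif hsig2 heta).
Qed.

End Frozen.
End FrozenCoefficients.

(** * Comparison *)

Section DoubledGrowth.
Context (R : realType) (n d : nat) (T : R) (I : Type).
Hypothesis d0 : (0 < d)%N.
Context (s : I -> 'M[R]_(n, d)) (c1 c2 : I -> R) (S D ce L A th h0 : R) (xh : 'cV[R]_n).
Context (V1 V2 : R -> 'cV[R]_n -> R).
Hypothesis sS : forall i, fdot (s i) (s i) <= S.
Hypothesis S0 : 0 <= S.
Hypothesis ce0 : 0 <= ce.
Hypothesis L0 : 0 <= L.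
Hypothesis A0 : 0 <= A.
Hypothesis th0 : 0 <= th.
Hypothesis h00 : 0 < h0.
Hypothesis thT : th + h0 <= T.
Hypothesis cD : forall i, c1 i + c2 i <= D.
Hypothesis lV1 : forall t, 0 <= t <= T -> lipf L (V1 t).
Hypothesis cV1 : continuous_strip T V1.
Hypothesis cV2 : continuous_strip T V2.
Hypothesis gV1 : exists G, forall t x, 0 <= t <= T -> V1 t x <= G * (1 + fdot x x).
Hypothesis gV2 : exists G, forall t x, 0 <= t <= T -> V2 t x <= G * (1 + fdot x x).
Hypothesis jV1 : forall i,
  @subjet R n d T unit (fun=> s i) (fun=> c1 i) ce xh V1 th (th + h0).
Hypothesis jV2 : subjet T s c2 ce xh V2 th (th + h0).
Hypothesis V12 : forall x, V1 (th + h0) x + V2 (th + h0) x <= A * (1 + fdot x x).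

(** For each i the mean value inequality bounds - dif (s i) X + c2 i from above by the difference
    quotient of the smoothed V1 plus c1 i + c2 i <= D and errors. The barrier for V2 has Hessian - X
    plus a scalar matrix, so V2 moves back by h at a rate independent of i, and that difference
    quotient replaces [V1 t1] by [V1 t0] in the bound. *)
Lemma doubled_step t0 t1 delta C q z : th <= t0 -> t0 < t1 -> t1 <= th + h0 ->
  0 < delta -> 0 <= C -> 0 <= z -> z <= h0 ->
  (forall x, exists p X, forall v,
    `|smooth delta (V1 t1) (x + v) - smooth delta (V1 t1) x - fdot p v - 2^-1 * quad X v|
      <= C * enorm v ^+3) ->
  (forall x, V2 t1 x <= - smooth delta (V1 t1) x + A * (1 + fdot x x) + q +
     z * (6 * ce * fdot (x - xh) (x - xh))) ->
  forall x, V2 t0 x <= - smooth delta (V1 t0) x + A * (1 + fdot x x) + q +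
     (z + (t1 - t0)) * (6 * ce * fdot (x - xh) (x - xh)) +
     (t1 - t0) * (D + (A + 6 * ce * h0) * S + 4 * ce * ((n + n)%:R * delta) ^+ 2 +
       Num.sqrt (t1 - t0) * (4 * ce * S * Num.sqrt h0 +
         (C + 1) * (2 * S + (d%:R + 12) * S ^+ 2))).
Proof.
move=> tt0 t01 tt1 delta0 C0 z0 zh hX hV x.
have t00 : 0 <= t0 by apply: le_trans tt0.
have t1T : t1 <= T by apply: le_trans thT.
have t0T' : 0 <= t0 <= T by rewrite t00 (ltW (lt_le_trans t01 t1T)).
have t1T' : 0 <= t1 <= T by rewrite t1T andbT (le_trans t00) // ltW.
have [p [X hpX]] := hX x.
have [h hE] : exists h, h = t1 - t0 by eexists.
have hp : 0 < h by rewrite hE subr_gt0.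
have hh0 : h <= h0 by rewrite hE; lra.
have [eta etaE] : exists eta, eta = Num.sqrt h by eexists.
have eta0 : 0 < eta by rewrite etaE sqrtr_gt0.
have eta2 : h = eta ^+ 2 by rewrite etaE sqr_sqrtr // ltW.
have etah0 : eta <= Num.sqrt h0 by rewrite etaE; exact: ler_wsqrtr.
have [N NE] : exists N, N = fdot (x - xh) (x - xh) by eexists.
have N0 : 0 <= N by rewrite NE fdot_ge0.
have [F0 F0E] : exists F0, F0 = smooth delta (V1 t0) x by eexists.
have [F1 F1E] : exists F1, F1 = smooth delta (V1 t1) x by eexists.
have [rho rhoE] : exists rho, rho = 4 * ce * ((n + n)%:R * delta) ^+ 2 + 2 * ce * h * S +
   eta * (C * (S + (d%:R + 6) * S ^+ 2)) by eexists.
have mv i : F0 <= F1 + h * (dif (s i) X + c1 i + 4 * ce * N + rho).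
  have := @smooth_mean_value R n d d0 (s i) T (c1 i) ce xh ce0 V1 t0 t1 L delta C x p X
    t00 t01 t1T cV1 gV1 _ L0 (lV1 t0T') (lV1 t1T') delta0 C0 hpX.
  have js : @subjet R n d T unit (fun=> s i) (fun=> c1 i) ce xh V1 t0 t1.
    by apply: subjet_sub (jV1 i).
  move=> /(_ js); rewrite -F0E -F1E -hE -NE -etaE => hm; apply: le_trans hm _.
  rewrite lerD2l ler_wpM2l ?(ltW hp) // lerD2l rhoE.
  have Si := sS i; have Si0 := fdot_ge0 (s i).
  apply: lerD; last first.
    rewrite !ler_wpM2l ?(ltW eta0) // lerD // ler_wpM2l ?addr_ge0 //.
    by rewrite lerXn2r ?nnegrE.
  by rewrite lerD2l ler_wpM2l // !mulr_ge0 // ltW.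
pose K := 2 * A + 2 * z * (6 * ce).
pose pm := - p + (2 * A) *: x + (2 * z * (6 * ce)) *: (x - xh).
pose Xm := - X + K%:M.
pose f0 := - F1 + A * (1 + fdot x x) + q + z * (6 * ce * N).
(* Of the factor 6 ce in the conclusion, 4 ce comes from the mean value inequality, visible here,
   and 2 ce from [one_step]. *)
pose l := (F1 - F0) / h + D + 4 * ce * N + rho + (A + 6 * ce * h0) * S.
have hf v : V2 t1 (x + v) <= f0 + fdot pm v + 2^-1 * quad Xm v +
    (C + 1) * (eta * fdot v v + fdot v v ^+ 2 / eta).
  apply: le_trans (hV _) _; have := hpX v; rewrite ler_norml -F1E => /andP[hl _].
  have hc := cube_le_quartic eta0 (enorm_ge0 v); rewrite enorm_sqr in hc; have C1 : 0 < C + 1 by rewrite ltr_wpDl.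
  have [w wE] : exists w, w = x - xh by eexists.
  have -> : x + v - xh = w + v by rewrite wE addrAC.
  rewrite /f0 NE /pm /Xm -wE quadD quadN quad_scalar !(fdotDl, fdotDr, fdotZl, fdotNl).
  rewrite (fdotC v x) (fdotC v w) /K.
  move: hl hc; have e0 := enorm_ge0 v; have := exprn_ge0 3 e0.
  move: (smooth _ _ _) (enorm v ^+ 3) (fdot p v) (quad X v) => y1 y2 y3 y4 y20 hl hc.
  have hc' := ler_wpM2l (ltW C1) hc.
  move: (fdot v v) (fdot v v ^+ 2 / eta) hc hc' => y5 y6 hc hc'.
  move: (fdot x v) (fdot w v) (fdot x x) (fdot w w) => y7 y8 y9 y10.
  nra.
have hl i : dif (s i) Xm + c2 i <= l.
  have Si := sS i; have Si0 := fdot_ge0 (s i).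
  rewrite /Xm difD difN dif_scalar /l /K.
  have := mv i; rewrite -lerBlDl -ler_pdivrMl // => m1.
  have : 2^-1 * (2 * A + 2 * z * (6 * ce)) * fdot (s i) (s i) <= (A + 6 * ce * h0) * S.
    have -> : 2^-1 * (2 * A + 2 * z * (6 * ce)) = A + 6 * ce * z by field.
    apply: ler_pM => //; first by rewrite addr_ge0 // !mulr_ge0.
    by rewrite lerD2l ler_wpM2l // mulr_ge0.
  have := cD i; have -> : (F1 - F0) / h = - (h^-1 * (F0 - F1)) by field; rewrite gt_eqF.
  move: (h^-1 * _) m1 => y1; move: (2^-1 * _ * _) ((_ + _ * h0) * S) => y2 y3; lra.
have jV2' : subjet T s c2 ce xh V2 t0 t1.
  by move=> t /andP[h1 h2]; apply: jV2; rewrite (le_lt_trans tt0) ?(lt_le_trans h2).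
have [G hG] := gV2.
have C10 : 0 < C + 1 by rewrite ltr_wpDl.
have cw : {within [set q : R * 'cV[R]_n | t0 <= q.1 <= t1], continuous (fun q => V2 q.1 q.2)}.
  apply: continuous_subspaceW cV2 => -[t y]; rewrite /strip /= => /andP[h1 h2].
  by rewrite (le_trans t00 h1) (le_trans h2 t1T).
have gw : exists G, forall t x, t0 <= t <= t1 -> V2 t x <= G * (1 + fdot x x).
  by exists G => t y /andP[h1 h2]; apply: hG; rewrite (le_trans t00 h1) (le_trans h2).
have := @one_step R n d T I s c2 S ce xh sS S0 ce0 V2 t0 t1 x f0 pm Xm (C + 1) eta l
  t00 t01 t1T (continuous_strip_ctime cV2) cw gw jV2' C10 eta0 hf hl.
rewrite -hE -NE => ho; apply: le_trans ho _.
have e1 : h * ((F1 - F0) / h) = F1 - F0 by field; rewrite gt_eqF.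
have -> : f0 + h * (l + 2 * ce * N + ((C + 1) * eta * S +
    h * S * (6 * (C + 1) * S / eta + 2 * ce))) =
  f0 + h * ((F1 - F0) / h) + h * (D + 6 * ce * N + rho + (A + 6 * ce * h0) * S + (C + 1) * eta * S +
    6 * (C + 1) * S ^+ 2 * (h / eta) + h * S * 2 * ce).
  by rewrite /l; field; rewrite !gt_eqF.
have -> : h / eta = eta by rewrite eta2 expr2 mulfK // gt_eqF.
rewrite e1 /f0 -F0E -etaE rhoE.
have hle : 4 * ce * S * h <= eta * (4 * ce * S * Num.sqrt h0).
  rewrite {1}eta2 expr2 mulrCA ler_wpM2l ?(ltW eta0) // ler_wpM2l // !mulr_ge0 //.
have [d' d'E] : exists r : R, r = d%:R by eexists.
have d'0 : 0 <= d' by rewrite d'E.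
have hC : eta * (C * (S + (d%:R + 6) * S ^+ 2)) + (C + 1) * eta * S + 6 * (C + 1) * S ^+ 2 * eta <=
   eta * ((C + 1) * (2 * S + (d%:R + 12) * S ^+ 2)).
  rewrite -d'E.
  have S2 : 0 <= S ^+ 2 by exact: sqr_ge0.
  have : 0 <= eta * (S + (d' + 6) * S ^+ 2).
    by apply: mulr_ge0; [exact: ltW | apply: addr_ge0 => //; apply: mulr_ge0 => //; lra].
  nra.
move: hle hC; rewrite -subr_ge0 -d'E => hle; rewrite -subr_ge0 => hC.
have := mulr_ge0 (ltW hp) (addr_ge0 hle hC).
move: (Num.sqrt h0) ((n + n)%:R * delta) => y2 y3 hh.
by rewrite -subr_ge0; move: hh; congr (0 <= _); ring.
Qed.

(** The step is iterated m times with h = h0 / m. At xh the accumulated multiple of |x - xh|^2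
    vanishes and leaves only its Hessian, the term 6 ce h0 S. *)
Lemma doubled_growth :
  V1 th xh + V2 th xh <= A * (1 + fdot xh xh) + h0 * (D + (A + 6 * ce * h0) * S).
Proof.
apply/ler_addgt0Pr => e e0.
have [nn nnE] : exists r : R, r = (n + n)%:R by eexists.
have nn0 : 0 <= nn by rewrite nnE.
(* A smoothing radius y <= 1 for which both the gap L y, counted at th + h0 and at th, and the error
   4 h0 ce y fit into e. *)
have [y yE] : exists y, y = e / (e + 4 * L + 16 * h0 * ce + 1) by eexists.
have q0 : 0 <= 16 * h0 * ce by rewrite mulr_ge0 // mulr_ge0 // ltW.
have he : 0 < e + 4 * L + 16 * h0 * ce + 1.
  by apply: ltr_wpDl => //; rewrite !addr_ge0 ?(ltW e0) // mulr_ge0.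
have y0 : 0 < y by rewrite yE divr_gt0.
have yh : y * (e + 4 * L + 16 * h0 * ce + 1) = e by rewrite yE divfK // gt_eqF.
have y_le1 : y <= 1.
  rewrite yE ler_pdivrMr // mul1r.
  by rewrite -!addrA lerDl !addr_ge0 // mulr_ge0.
pose delta := y / (nn + 1).
have delta0 : 0 < delta by rewrite divr_gt0 // ltr_wpDl.
have dy : nn * delta <= y.
  rewrite /delta mulrCA ler_piMr ?(ltW y0) // ler_pdivrMr ?ltr_wpDl // mul1r lerDl //.
have dnn0 : 0 <= nn * delta by rewrite mulr_ge0 // ltW.
have [C C0 hC] := @smooth_taylor R n delta L delta0 L0.
pose K := 4 * ce * S * Num.sqrt h0 + (C + 1) * (2 * S + (d%:R + 12) * S ^+ 2).
have eh0 : 0 < e / 4 / h0 by rewrite !divr_gt0.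
(* The number of steps is chosen after [delta], because C and hence K depend on [delta]. *)
have [m [m0 hm]] := @sqrt_div_small R h0 K _ (ltW h00) eh0.
have mR0 : (0 : R) < m%:R by rewrite ltr0n.
have [h hE] : exists h, h = h0 / m%:R by eexists.
have hp : 0 < h by rewrite hE divr_gt0.
have mh : m%:R * h = h0 by rewrite hE mulrC divfK // gt_eqF.
have [l lE] : exists l, l = D + (A + 6 * ce * h0) * S + 4 * ce * (nn * delta) ^+ 2 +
  Num.sqrt h * K by eexists.
have claim j : (j <= m)%N -> forall x, V2 (th + h0 - j%:R * h) x <=
    - smooth delta (V1 (th + h0 - j%:R * h)) x + A * (1 + fdot x x) +
    (L * (nn * delta) + j%:R * h * l) + j%:R * h * (6 * ce * fdot (x - xh) (x - xh)).
  elim: j => [|j IH] jm x.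
    rewrite mulr0n !mul0r subr0 !addr0.
    have t1T : 0 <= th + h0 <= T by rewrite thT addr_ge0 // ltW.
    have := @smooth_near R n delta delta0 L _ x (lV1 t1T) L0.
    rewrite -nnE ler_norml => /andP[_ h1]; have := V12 x; lra.
  have jh : j.+1%:R * h <= h0 by rewrite -mh ler_wpM2r ?(ltW hp) // ler_nat.
  have jh0 : 0 <= j%:R * h by rewrite mulr_ge0 // ltW.
  have jS : j.+1%:R * h = j%:R * h + h by rewrite mulrSr mulrDl mul1r.
  have tE : (th + h0 - j%:R * h) - (th + h0 - j.+1%:R * h) = h by rewrite jS; ring.
  have := @doubled_step (th + h0 - j.+1%:R * h) (th + h0 - j%:R * h) delta C
     (L * (nn * delta) + j%:R * h * l) (j%:R * h) _ _ _ delta0 C0 jh0 _ _ (IH (ltnW jm)) x.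
  rewrite tE -nnE -/K -lE => hst.
  have {hst} := hst _ _ _ _ _.
  have -> : - smooth delta (V1 (th + h0 - j.+1%:R * h)) x + A * (1 + fdot x x) +
      (L * (nn * delta) + j%:R * h * l) + (j%:R * h + h) * (6 * ce * fdot (x - xh) (x - xh)) + h * l =
    - smooth delta (V1 (th + h0 - j.+1%:R * h)) x + A * (1 + fdot x x) +
      (L * (nn * delta) + j.+1%:R * h * l) + j.+1%:R * h * (6 * ce * fdot (x - xh) (x - xh)).
    by rewrite jS; ring.
  have /andP[jT0 jT1] : 0 <= th + h0 - j.+1%:R * h <= T.
    rewrite -addrA addr_ge0 ?subr_ge0 //= (le_trans _ thT) // lerD2l gerBl.
    by rewrite mulr_ge0 // ltW.
  apply.
  - by rewrite -addrA lerDl subr_ge0.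
  - by rewrite -subr_gt0 tE.
  - by rewrite gerBl.
  - by apply: le_trans jh; rewrite jS lerDl ltW.
  move=> z; have := hC (V1 (th + h0 - j%:R * h)) _ z; apply; apply: lV1.
  rewrite (le_trans jT0) ?(le_trans _ thT) ?gerBl //= lerD2l lerN2 jS lerDl.
  exact: ltW.
have := claim m (leqnn m) xh; rewrite mh addrK subrr fdot0l !mulr0 addr0.
have thT' : 0 <= th <= T by rewrite th0 (le_trans _ thT) // lerDl ltW.
have := @smooth_near R n delta delta0 L _ xh (lV1 thT') L0.
rewrite -nnE ler_norml => /andP[h1 _] h2.
have Ly : L * (nn * delta) <= L * y by rewrite ler_wpM2l.
have cy : h0 * (4 * ce * (nn * delta) ^+ 2) <= 4 * h0 * ce * y.
  have -> : 4 * h0 * ce * y = h0 * (4 * ce * y) by ring.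
  rewrite ler_wpM2l ?(ltW h00) // ler_wpM2l ?mulr_ge0 //.
  apply: (@le_trans _ _ (y ^+ 2)); first by rewrite lerXn2r ?nnegrE // ltW.
  by rewrite expr2 ler_piMl // ltW.
have hK : h0 * (Num.sqrt h * K) <= e / 4.
  by have := ler_wpM2l (ltW h00) hm; rewrite -hE mulrCA [h0 * (_ / h0)]mulrC divfK ?gt_eqF // mulrC.
have y20 : 0 <= y * e by rewrite mulr_ge0 // ltW.
rewrite lE in h2.
move: h2 cy hK; rewrite !(mulrDr h0).
move: (h0 * (4 * _ * _)) (h0 * (_ * K)) (h0 * D) (h0 * (_ * S)) => z1 z2 z3 z4.
move: h1 Ly; move: (smooth _ _ _) (L * (nn * delta)) => z5 z6 h1 Ly h2 cy hK.
have := mulr_ge0 (ltW y0) q0; have := mulr_ge0 (ltW y0) L0.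
move: yh; rewrite !mulrDr mulr1 => yh; lra.
Qed.

End DoubledGrowth.

(** * The maximum of the quotient and the slopes there *)

Section Touching.
Context (R : realType) (n : nat).

(** Subtracting the lower paraboloid of one function from the upper bound of the sum gives an upper
    paraboloid for the other. The slopes add up to the gradient of the weight because their
    difference is a linear form bounded by a quadratic one. *)
Lemma touching_slopes (f1 f2 : 'cV[R]_n -> R) x p1 p2 c M :
  (forall v, f1 x + fdot p1 v - c * fdot v v <= f1 (x + v)) ->
  (forall v, f2 x + fdot p2 v - c * fdot v v <= f2 (x + v)) ->
  (forall y, f1 y + f2 y <= M * (1 + fdot y y)) ->
  f1 x + f2 x = M * (1 + fdot x x) ->
  [/\ p1 + p2 = (2 * M) *: x,
      forall v, f1 (x + v) <= f1 x + fdot p1 v + (M + c) * fdot v v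
    & forall v, f2 (x + v) <= f2 x + fdot p2 v + (M + c) * fdot v v].
Proof.
move=> h1 h2 hM e.
have hv v : f1 (x + v) + f2 (x + v) <=
    f1 x + f2 x + 2 * M * fdot x v + M * fdot v v.
  apply: le_trans (hM _) _; rewrite e !(fdotDl, fdotDr) (fdotC v x).
  rewrite -subr_ge0; set z := (X in 0 <= X); suff -> : z = 0 by [].
  by rewrite /z; ring.
have pE : p1 + p2 = (2 * M) *: x.
  apply/eqP; rewrite -subr_eq0; apply/eqP.
  apply: (@fdot_linear_eq0 R n _ (M + 2 * c)) => v.
  rewrite fdotBl fdotDl fdotZl; have := h1 v; have := h2 v; have := hv v; lra.
have pv v : fdot p1 v + fdot p2 v = 2 * M * fdot x v by rewrite -fdotDl pE fdotZl.
by split=> // v; have := h1 v; have := h2 v; have := hv v; have := pv v; lra.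
Qed.

(** V grows linearly and the weight quadratically, so the quotient is largest on a bounded set. *)
Lemma strip_max_quotient (T G lam : R) (V : R -> 'cV[R]_n -> R) ts xs :
  0 <= lam -> continuous_strip T V ->
  (forall t x, 0 <= t <= T -> V t x <= G * (1 + enorm x)) ->
  0 <= ts <= T -> 0 < V ts xs ->
  exists al th xh, [/\ V ts xs / (expR (lam * (T - ts)) * (1 + fdot xs xs)) <= al, 0 <= th <= T,
    V th xh = al * expR (lam * (T - th)) * (1 + fdot xh xh) &
    forall t x, 0 <= t <= T -> V t x <= al * expR (lam * (T - t)) * (1 + fdot x x)].
Proof.
move=> lam0 cV gV tsT V0; pose Q (x : 'cV[R]_n) := 1 + fdot x x.
have Q0 x : 0 < Q x by rewrite /Q ltr_pwDl // fdot_ge0.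
pose be t := expR (lam * (T - t)).
have be0 t : 0 < be t by exact: expR_gt0.
pose f t x := V t x / (be t * Q x).
have T0 : 0 <= T by case/andP: tsT; exact: le_trans.
have cf : {within [set q : R * 'cV[R]_n | 0 <= q.1 <= T], continuous (fun q => f q.1 q.2)}.
  have cq : continuous (fun q : R * 'cV[R]_n => (be q.1 * Q q.2)^-1).
    move=> q; apply: cvgV; first by rewrite gt_eqF // mulr_gt0.
    apply: cvgM.
      apply: (@continuous_comp _ _ _ fst be); first exact: cvg_fst.
      rewrite /be; apply: continuous_comp; last exact: continuous_expR.
      apply: cvgM; first exact: cvg_cst.
      by apply: cvgB; [exact: cvg_cst | exact: cvg_id].
    apply: (@continuous_comp _ _ _ snd Q); first exact: cvg_snd.
    have cid : continuous (fun x : 'cV[R]_n => x) by move=> x; exact: cvg_id.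
    have c1 := fdot_continuous cid cid.
    have c2 : continuous (fun x : 'cV[R]_n => 1 + fdot x x).
      by move=> y; have := cvgD (cvg_cst (1 : R)) (c1 y : fdot x x @[x --> y] --> fdot y y); apply.
    exact: c2.
  move=> q; apply: cvgM; first exact: cV.
  exact: (continuous_subspaceT cq).
have [mu muE] : exists mu, mu = f ts xs by eexists.
have mu0 : 0 < mu by rewrite muE divr_gt0 // mulr_gt0.
(* Outside this radius the linear growth bound already makes the quotient smaller than its value mu
   at (ts, xs). *)
pose r := enorm xs + 2 * `|G| / mu + 1.
have G0 : 0 <= 2 * `|G| / mu by rewrite divr_ge0 ?mulr_ge0 // ltW.
have x0 := enorm_ge0 xs.
have r0 : 0 <= r by rewrite /r !addr_ge0.
have [th [xh [thT hm]]] := strip_max T0 r0 cf.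
have al_mu : mu <= f th xh by rewrite muE; apply: hm => //; rewrite /r -addrA lerDl addr_ge0.
have fle t x : 0 <= t <= T -> f t x <= f th xh.
  move=> tT; have [xr|xr] := leP (enorm x) r; first exact: hm.
  apply: le_trans al_mu; rewrite ler_pdivrMr ?mulr_gt0 //.
  have be1 : 1 <= be t.
    apply: le_trans (expR_ge1Dx _); rewrite lerDl mulr_ge0 // subr_ge0.
    by case/andP: tT.
  apply: (@le_trans _ _ (mu * Q x)); last first.
    by rewrite ler_wpM2l ?(ltW mu0) // ler_peMl // ltW.
  apply: le_trans (gV _ _ tT) _; rewrite /Q -enorm_sqr.
  have [z zE] : exists z, z = enorm x by eexists.
  rewrite -zE in xr *.
  have z1 : 1 <= z by move: xr; rewrite /r; lra.
  have Gz : 2 * `|G| <= mu * z.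
    rewrite [leRHS]mulrC -ler_pdivrMr // (le_trans _ (ltW xr)) // /r.
    by rewrite -addrA addrCA lerDl addr_ge0.
  apply: (@le_trans _ _ (`|G| * (1 + z))).
    by rewrite ler_wpM2r ?ler_norm // addr_ge0 // (le_trans _ z1).
  apply: (@le_trans _ _ (mu * z * z)); last by rewrite mulrDr expr2 mulr1 mulrA lerDr ltW.
  have g0 := normr_ge0 G.
  apply: (@le_trans _ _ (2 * `|G| * z)); last by rewrite ler_wpM2r // (le_trans _ z1).
  have := ler_wpM2l g0 z1; lra.
exists (f th xh), th, xh; split => //; first by rewrite -/(be ts) -/(Q xs) -/(f ts xs) -muE.
  by rewrite -/(be th) -/(Q xh) /f -mulrA divfK // gt_eqF // mulr_gt0.
move=> t x tT; rewrite -mulrA -ler_pdivrMr; first exact: fle.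
exact: (mulr_gt0 (be0 t) (Q0 x)).
Qed.

Lemma strip_linear_growth (T L : R) (W : R -> 'cV[R]_n -> R) : 0 <= T -> 0 <= L ->
  (forall t, 0 <= t <= T -> lipf L (W t)) -> continuous_strip T W ->
  exists2 G, 0 <= G & forall t x, 0 <= t <= T -> `|W t x| <= G + L * enorm x.
Proof.
move=> T0 L0 lW cW.
have cW' : continuous_strip T (fun t x => `|W t x|).
  by move=> q; apply: cvg_norm; exact: cW.
have [th [xh [thT hm]]] := strip_max T0 (lexx 0) cW'.
exists `|W th xh| => // t x tT.
have h1 := hm t 0 tT; rewrite enorm0 lexx in h1; have {}h1 := h1 isT.
have h2 := lW t tT x 0; rewrite subr0 in h2.
rewrite -(subrK (W t 0) (W t x)) addrC; apply: le_trans (ler_normD _ _) _.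
exact: lerD.
Qed.

End Touching.

Section ScalarBounds.
Context (R : realType).
Implicit Types (a eps x y z : R).

Lemma small_eps a er l : 0 < a -> 0 <= er -> 0 <= l ->
  exists eps, [/\ 0 < eps, eps <= 1, 4 * (er * eps) <= a & 4 * (l * eps) < a].
Proof.
move=> a0 er0 l0; have p0 : 0 < 4 * (er + l + 1) by rewrite mulr_gt0 // ltr_wpDl // addr_ge0.
have [eps [eps0 eps1 epsE]] : exists eps, [/\ 0 < eps, eps <= 1 & 4 * (er + l + 1) * eps <= a].
  exists (Num.min 1 (a / (4 * (er + l + 1)))); split.
  - by rewrite lt_min ltr01 divr_gt0.
  - by rewrite ge_min lexx.
  by rewrite mulrC -ler_pdivlMr // ge_min lexx orbT.
have ere : 0 <= er * eps by rewrite mulr_ge0 // ltW.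
have le : 0 <= l * eps by rewrite mulr_ge0 // ltW.
by exists eps; split => //; move: epsE; rewrite !(mulrDr, mulrDl); lra.
Qed.

Lemma expR_half x y z : 0 <= x -> 0 <= z <= 2^-1 -> x * expR z = y ->
  x * (1 + z) <= y /\ y <= 2 * x.
Proof.
move=> x0 /andP[z0 z1] <-; split; first by rewrite ler_wpM2l // expR_ge1Dx.
have e1 : expR z * expR (- z) = 1 by rewrite -expRD subrr expR0.
have e2 : expR z * (1 - z) <= 1 by rewrite -[leRHS]e1 ler_wpM2l ?expR_ge0 ?expR_ge1Dx.
have e3 : expR z * 2^-1 <= expR z * (1 - z) by rewrite ler_wpM2l ?expR_ge0 //; lra.
have : expR z <= 2 by lra.
by move=> /(ler_wpM2l x0); rewrite mulrC [2 * x]mulrC.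
Qed.

(** All terms on the right are measured in units of h A Q: 2 ka <= a <= M Q counts at most 2, the
    term in ga at most 2 ga, the one in S at most sg + 1. The sum 3 + 2 ga + sg is below the growth
    5 + 2 ga + sg of M Q. *)
Lemma decay_rate_dominates A M Q h ce S ga sg ka a : 0 < A -> 1 <= Q -> 0 < h -> 0 <= ga ->
  0 < a -> a <= M -> 2 * ka <= a -> 12 * ce * S * h <= a -> S = sg * Q -> M <= 2 * A ->
  A * (1 + (5 + 2 * ga + sg) * h) <= M ->
  ~ M * Q <= A * Q + h * (2 * ka + ga * (M * Q) + (A + 6 * ce * h) * S).
Proof.
move=> A0 Q1 h0 ga0 a0 aM ka_a ce_a SE M2A MA fin.
have Q0 : 0 < Q by lra.
have AQ0 : 0 < A * Q by rewrite mulr_gt0.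
have AlQ : h * ((5 + 2 * ga + sg) * (A * Q)) <=
    h * (2 * ka + ga * (M * Q) + (A + 6 * ce * h) * S).
  have := le_trans (ler_wpM2r (ltW Q0) MA) fin.
  have -> : A * (1 + (5 + 2 * ga + sg) * h) * Q = A * Q + h * ((5 + 2 * ga + sg) * (A * Q)).
    by ring.
  by rewrite lerD2l.
rewrite ler_pM2l // in AlQ.
have AS : (A + 6 * ce * h) * S = sg * (A * Q) + 2^-1 * (12 * ce * S * h).
  by rewrite mulrDl {1}SE; field.
have MQ : M * Q <= 2 * (A * Q) by rewrite mulrA ler_wpM2r // ltW.
have a0Q : a <= M * Q by rewrite (le_trans aM) // ler_peMr // (le_trans (ltW a0)).
have gaQ := ler_wpM2l ga0 MQ.
move: AlQ ce_a MQ a0Q gaQ AQ0; rewrite AS.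
move: (12 * _ * _ * _) (M * Q) (A * Q) => z1 z2 z3; lra.
Qed.

End ScalarBounds.

Section Comparison.
Context (R : realType) (n d k : nat) (T : R) (U : set 'cV[R]_k).
Context (b : R -> 'cV[R]_n -> R -> 'rV[R]_d -> 'cV[R]_k -> 'cV[R]_n).
Context (sigma : R -> 'cV[R]_n -> 'cV[R]_k -> 'M[R]_(n, d)).
Context (g : R -> 'cV[R]_n -> R -> 'rV[R]_d -> 'cV[R]_k -> R).
Context (phi : 'cV[R]_n -> R).
Variables (Lc Lw B : R).
Hypothesis T0 : 0 < T.
Hypothesis d0 : (0 < d)%N.
Hypothesis U0 : U !=set0.
Hypothesis Lc0 : 0 <= Lc.
Hypothesis Lw0 : 0 <= Lw.
Hypothesis lip : lip_coefs T U b sigma g Lc.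
Hypothesis cU : compact U.
Hypothesis cc : continuous_coefficients T U b sigma g phi.
Hypothesis B0 : 0 <= B.
Hypothesis bdd : forall t u, 0 <= t <= T -> U u ->
  [/\ enorm (sigma t 0 u) <= B, enorm (b t 0 0 0 u) <= B & `|g t 0 0 0 u| <= B].
Local Notation ft := (fterm b sigma g).

Let sigma_bdd t x : 0 <= t <= T -> exists S, forall u, U u ->
  fdot (sigma t x u) (sigma t x u) <= S.
Proof.
move=> tT; exists ((B + Lc * enorm x) ^+ 2) => u Uu.
by rewrite -enorm_leP ?addr_ge0 ?mulr_ge0 ?enorm_ge0 // (sigma_growth lip bdd).
Qed.

Let fterm_bdd t x v p : 0 <= t <= T ->
  exists M, forall u, U u -> `|ft t x v p u| <= M.
Proof. by move=> tT; apply: (fterm_growth Lc0 lip bdd). Qed.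

Let T0' : 0 <= T := ltW T0.

Section Pair.
Variables (W1 W2 : R -> 'cV[R]_n -> R) (eps theta : R).
Hypothesis lW1 : forall t, 0 <= t <= T -> lipf Lw (W1 t).
Hypothesis lW2 : forall t, 0 <= t <= T -> lipf Lw (W2 t).
Hypothesis cW1 : continuous_strip T W1.
Hypothesis cW2 : continuous_strip T W2.
Hypothesis sub1 : viscosity_subsolution T U b sigma g phi W1.
Hypothesis super2 : viscosity_supersolution T U b sigma g phi W2.
Hypothesis eps0 : 0 < eps.
Hypothesis theta0 : 0 < theta.
Let NW2 t x := - W2 t x.
Local Notation V1 := (supc eps W1).
Local Notation V2 := (supc eps NW2).
Local Notation kappa := (frozen_err Lc Lw * eps + theta).

Let lNW2 t : 0 <= t <= T -> lipf Lw (NW2 t).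
Proof. by move=> tT x y; rewrite /NW2 -opprD normrN; exact: lW2. Qed.

Let cNW2 : continuous_strip T NW2.
Proof. by move=> q; apply: cvgN; exact: cW2. Qed.

(** One linear inequality per control. The factor [ce] may be any number above C so that it can be
    shared with the supersolution. *)
Lemma sub_frozen_subjet th xh K : 0 <= th <= T ->
  (forall v, V1 th (xh + v) <= V1 th xh + fdot (slope eps W1 th xh) v + K * fdot v v) ->
  exists r C, [/\ 0 < r, 0 <= C & forall u h ce, U u -> h <= r -> th + h <= T -> C <= ce ->
    @subjet R n d T unit (fun=> sigma th xh u)
      (fun=> ft th xh (V1 th xh) (slope eps W1 th xh) u + kappa) ce xh V1 th (th + h)].
Proof.
move=> thT hK.
have [r [C [r0 C0 hf]]] := supc_frozen T0' Lc0 Lw0 lip cU cc bdd B0 eps0 lW1 cW1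
  (normr1 _) thT theta0 hK.
exists r, C; split => // u h ce Uu hr hT Cce t /andP[t1 t2] x a p X jV e e0; exists tt.
have /andP[th0 _] := thT.
have tT : 0 <= t < T by apply/andP; split; lra.
have tT' : 0 <= t <= T by case/andP: tT => -> /ltW ->.
have tr : `|t - th| < r by rewrite gtr0_norm; lra.
have [X' jX' hX'] := hf t x a p X tT' tr jV e e0.
have := hX' u Uu; rewrite !mul1r !scale1r.
have := viscosity_sub_ujet T0 U0 sigma_bdd fterm_bdd sub1 tT jX' Uu.
have := ler_norm (ft t (argsup eps W1 t x) (W1 t (argsup eps W1 t x)) p u -
   ft th xh (V1 th xh) (slope eps W1 th xh) u).
have := ler_wpM2r (fdot_ge0 (x - xh)) Cce.
move: (`|_|) (dif _ X') (dif _ X) => y1 y2 y3.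
move: (ft t _ _ _ _) (ft th _ _ _ _) (fdot _ _) => y4 y5 y6; lra.
Qed.

(** The control depends on the jet, so the index runs over all of U, as a subtype. *)
Lemma super_frozen_subjet th xh K : 0 <= th <= T ->
  (forall v, V2 th (xh + v) <= V2 th xh + fdot (slope eps NW2 th xh) v + K * fdot v v) ->
  exists r C, [/\ 0 < r, 0 <= C & forall h ce, h <= r -> th + h <= T -> C <= ce ->
    subjet T (fun u : {u | U u} => sigma th xh (sval u))
      (fun u => - ft th xh (- V2 th xh) (- slope eps NW2 th xh) (sval u) + kappa)
      ce xh V2 th (th + h)].
Proof.
move=> thT hK.
have sgn : `|(-1 : R)| = 1 by rewrite normrN normr1.
have [r [C [r0 C0 hf]]] := supc_frozen T0' Lc0 Lw0 lip cU cc bdd B0 eps0 lNW2 cNW2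
  sgn thT theta0 hK.
exists r, C; split => // h ce hr hT Cce t /andP[t1 t2] x a p X jV e e0.
have /andP[th0 _] := thT.
have tT : 0 <= t < T by apply/andP; split; lra.
have tT' : 0 <= t <= T by case/andP: tT => -> /ltW ->.
have tr : `|t - th| < r by rewrite gtr0_norm; lra.
have e20 : 0 < e / 2 by rewrite divr_gt0.
have [X' jX' hX'] := hf t x a p X tT' tr jV _ e20.
have [u Uu hu] := viscosity_super_ujet T0 U0 sigma_bdd fterm_bdd super2 tT jX' e20.
exists (exist _ u Uu); move: hu; rewrite /=.
have := hX' u Uu; rewrite !mulN1r !scaleN1r {1 2}/NW2 opprK.
have := ler_norm (- (ft t (argsup eps NW2 t x) (W2 t (argsup eps NW2 t x)) (- p) u -
   ft th xh (- V2 th xh) (- slope eps NW2 th xh) u)); rewrite normrN.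
have := ler_wpM2r (fdot_ge0 (x - xh)) Cce.
move: (`|_|) (dif _ X') (dif _ X) => y1 y2 y3.
move: (ft t _ _ _ _) (ft th _ _ _ _) (fdot _ _) => y4 y5 y6; lra.
Qed.

Lemma supc_pair_terminal x : V1 T x + V2 T x <= 4 * (Lw ^+ 2 * eps).
Proof.
have TT : 0 <= T <= T by rewrite T0' lexx.
have := supc_le eps0 lW1 x TT; have := supc_le eps0 lNW2 x TT.
have [_ + _] := sub1; have [_ + _] := super2 => /(_ x) p1 /(_ x) p2.
have : 0 <= Lw ^+ 2 * eps by rewrite mulr_ge0 ?sqr_ge0 // ltW.
rewrite {2}/NW2; lra.
Qed.

End Pair.

Definition gap_rate Cv : R :=
  ft_lip Lc Lw + 4 * (B + Lc * (1 + Cv + 2 * Lw * (B + Lc)) + (2 * Lw + 1) * Lc * (B + Lc)).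

Lemma gap_rate_ge0 Cv : 0 <= Cv -> 0 <= gap_rate Cv.
Proof.
move=> Cv0; have := ft_lip_ge0 Lc0 Lw0; rewrite /gap_rate => h.
by rewrite !(addr_ge0, mulr_ge0).
Qed.

Lemma sigma_sq_growth t x u : 0 <= t <= T -> U u ->
  fdot (sigma t x u) (sigma t x u) <= 2 * (B + Lc) ^+ 2 * (1 + fdot x x).
Proof.
move=> tT Uu; have hs := sigma_growth lip bdd x tT Uu.
rewrite -!enorm_sqr; have := enorm_ge0 (sigma t x u); have := enorm_ge0 x.
move: (enorm x) (enorm _) hs => r z hs r0 z0.
have [lc0 [b0 bl0]] : 0 <= Lc /\ 0 <= B /\ 0 <= B + Lc by split; rewrite ?addr_ge0.
apply: (@le_trans _ _ (((B + Lc) * (1 + r)) ^+ 2)).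
  have hz : z <= (B + Lc) * (1 + r).
    have := mulr_ge0 b0 r0; have := lc0; move: hs; rewrite !(mulrDl, mulrDr); lra.
  by rewrite lerXn2r ?nnegrE // (le_trans z0 hz).
rewrite exprMn [leRHS](_ : _ = (B + Lc) ^+ 2 * (2 * (1 + r ^+ 2))); last by ring.
rewrite ler_wpM2l ?sqr_ge0 //.
have := sqr_ge0 (r - 1); rewrite !expr2; lra.
Qed.

(** At the maximum the values differ by the weight M (1 + |x|^2) and the slopes by its gradient 2 M
    x. The latter is multiplied by coefficients of size 1 + |x|, so the gap is again a multiple of
    the weight, with a rate that does not involve lambda. *)
Lemma fterm_gap th x u v1 v2 p1 p2 M Cv : 0 <= th <= T -> U u -> 0 <= M -> 0 <= Cv ->
  enorm p1 <= 2 * Lw -> enorm p2 <= 2 * Lw -> `|v2| <= Cv * (1 + enorm x) ->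
  v1 + v2 = M * (1 + fdot x x) -> p1 + p2 = (2 * M) *: x ->
  ft th x v1 p1 u - ft th x (- v2) (- p2) u <= gap_rate Cv * (M * (1 + fdot x x)).
Proof.
move=> thT Uu M0 Cv0 p1L p2L v2C vE pE.
apply: le_trans (ler_norm _) _.
apply: le_trans (fterm_lip Lc0 lip x x (- v2) v1 (- p2) thT Uu p1L) _.
rewrite subrr enorm0 add0r !opprK vE pE enormZ -/(ft_lip Lc Lw) [`|2 * M|]ger0_norm ?mulr_ge0 //.
have Mq0 : 0 <= M * (1 + fdot x x) by rewrite mulr_ge0 // addr_ge0 ?fdot_ge0.
rewrite ger0_norm // /gap_rate [leRHS]mulrDl lerD2l.
have hs := sigma_growth lip bdd x thT Uu.
have hb := b_growth lip bdd x (- v2) ((- p2)^T *m sigma th x u) thT Uu.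
have [r rE] : exists r, r = enorm x by eexists.
have r0 : 0 <= r by rewrite rE enorm_ge0.
have hs' : enorm (sigma th x u) <= (B + Lc) * (1 + r).
  rewrite rE (le_trans hs) // -rE.
  have := mulr_ge0 B0 r0; have := Lc0; rewrite !(mulrDl, mulrDr); lra.
have hp : enorm ((- p2)^T *m sigma th x u) <= 2 * Lw * ((B + Lc) * (1 + r)).
  apply: le_trans (enorm_mulmx _ _) _; rewrite enorm_trmx enormN.
  by apply: ler_pM; rewrite ?enorm_ge0.
have hb' : enorm (b th x (- v2) ((- p2)^T *m sigma th x u) u) <=
    (B + Lc * (1 + Cv + 2 * Lw * (B + Lc))) * (1 + r).
  apply: le_trans hb _; rewrite normrN -rE in v2C *.
  have := ler_wpM2l Lc0 (lerD v2C hp); have := mulr_ge0 B0 r0; have := Lc0.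
  rewrite !(mulrDl, mulrDr); lra.
rewrite -enorm_sqr -rE.
have K0 : 0 <= (2 * Lw + 1) * Lc by rewrite mulr_ge0 // addr_ge0 ?mulr_ge0.
have [K KE] : exists K, K = B + Lc * (1 + Cv + 2 * Lw * (B + Lc)) + (2 * Lw + 1) * Lc * (B + Lc).
  by eexists.
have Kp : 0 <= K by rewrite KE !(addr_ge0, mulr_ge0).
apply: (@le_trans _ _ (K * (1 + r) * (2 * M * r))).
  rewrite ler_wpM2r ?mulr_ge0 // KE [leRHS]mulrDl.
  by apply: lerD => //; rewrite -[leRHS]mulrA ler_wpM2l.
rewrite -KE; have -> : 4 * K * (M * (1 + r ^+ 2)) = (K * M) * (4 * (1 + r ^+ 2)) by ring.
have -> : K * (1 + r) * (2 * M * r) = (K * M) * (2 * (1 + r) * r) by ring.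
rewrite ler_wpM2l ?mulr_ge0 //.
have := sqr_ge0 (r - 1); have := sqr_ge0 r; rewrite !expr2; lra.
Qed.

Lemma viscosity_comparison (W1 W2 : R -> 'cV[R]_n -> R) :
  (forall t, 0 <= t <= T -> lipf Lw (W1 t)) -> (forall t, 0 <= t <= T -> lipf Lw (W2 t)) ->
  continuous_strip T W1 -> continuous_strip T W2 ->
  viscosity_subsolution T U b sigma g phi W1 ->
  viscosity_supersolution T U b sigma g phi W2 ->
  forall t x, 0 <= t <= T -> W1 t x <= W2 t x.
Proof.
move=> lW1 lW2 cW1 cW2 sub1 super2 ts xs tsT; rewrite leNgt; apply/negP => W12.
pose NW2 t x := - W2 t x.
have lNW2 t : 0 <= t <= T -> lipf Lw (NW2 t).
  by move=> tT x y; rewrite /NW2 -opprD normrN; exact: lW2.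
have cNW2 : continuous_strip T NW2 by move=> q; apply: cvgN; exact: cW2.
have [G1 G10 hG1] := strip_linear_growth T0' Lw0 lW1 cW1.
have [G2 G20 hG2] := strip_linear_growth T0' Lw0 lNW2 cNW2.
have Lw2 : 0 <= Lw ^+ 2 by exact: sqr_ge0.
have lwp := Lw0.
have [Cv CvE] : exists Cv, Cv = G2 + Lw + Lw ^+ 2 by eexists.
have Cv0 : 0 <= Cv by rewrite CvE !addr_ge0.
have [ga gaE] : exists ga, ga = gap_rate Cv by eexists.
have ga0 : 0 <= ga by rewrite gaE gap_rate_ge0.
have [sg sgE] : exists sg, sg = 2 * (B + Lc) ^+ 2 by eexists.
have sg0 : 0 <= sg by rewrite sgE mulr_ge0 ?sqr_ge0.
(* The rate exceeds the growth rates ga of the first order terms and sg of the diffusion; 5 leaves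
   room for the small errors, see [decay_rate_dominates]. *)
have [lam lamE] : exists lam, lam = 5 + 2 * ga + sg by eexists.
have lam0 : 0 < lam by rewrite lamE -addrA ltr_pwDl // addr_ge0 // mulr_ge0.
pose be t := expR (lam * (T - t)).
have be0 t : 0 < be t by exact: expR_gt0.
have Q1 (x : 'cV[R]_n) : 1 <= 1 + fdot x x by rewrite lerDl fdot_ge0.
have Q0 (x : 'cV[R]_n) : 0 < 1 + fdot x x by exact: lt_le_trans ltr01 (Q1 x).
pose mu := W1 ts xs - W2 ts xs; have mu0 : 0 < mu by rewrite subr_gt0.
have [a0 a0E] : exists a0, a0 = mu / (be ts * (1 + fdot xs xs)) by eexists.
have a00 : 0 < a0 by rewrite a0E divr_gt0 // mulr_gt0.
have [er erE] : exists er, er = frozen_err Lc Lw by eexists.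
have er0 : 0 <= er by rewrite erE frozen_err_ge0.
(* The lower bound a0 on the maximum of the quotient does not depend on eps, so the freezing error
   and the terminal gap can be made small compared with it. *)
have [eps [eps0 eps1 eps2 eps3]] := small_eps a00 er0 Lw2.
have ere : 0 <= er * eps by rewrite mulr_ge0 // ltW.
have lwe : 0 <= Lw ^+ 2 * eps by rewrite mulr_ge0 // ltW.
have lwe1 : Lw ^+ 2 * eps <= Lw ^+ 2 by rewrite ler_piMr.
have theta0 : 0 < a0 / 4 by rewrite divr_gt0.
pose V1 := supc eps W1; pose V2 := supc eps NW2.
have V1ge t x : 0 <= t <= T -> W1 t x <= V1 t x by exact: (supc_geW Lw0 eps0 lW1 cW1).
have V2ge t x : 0 <= t <= T -> NW2 t x <= V2 t x by exact: (supc_geW Lw0 eps0 lNW2 cNW2).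
have V1le t x : 0 <= t <= T -> V1 t x <= W1 t x + Lw ^+ 2 * eps by exact: (supc_le eps0 lW1).
have V2le t x : 0 <= t <= T -> V2 t x <= NW2 t x + Lw ^+ 2 * eps by exact: (supc_le eps0 lNW2).
have V1g t x : 0 <= t <= T -> V1 t x <= (G1 + Lw + Lw ^+ 2) * (1 + enorm x).
  move=> tT; have := V1le t x tT; have := hG1 t x tT; rewrite ler_norml => /andP[_].
  have := enorm_ge0 x; move: (enorm x) => r r0.
  have := mulr_ge0 G10 r0; have := mulr_ge0 Lw2 r0.
  rewrite !(mulrDl, mulrDr); lra.
have V2g t x : 0 <= t <= T -> `|V2 t x| <= Cv * (1 + enorm x).
  move=> tT; have := V2le t x tT; have := V2ge t x tT.
  have := hG2 t x tT; rewrite !ler_norml => /andP[].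
  have := enorm_ge0 x; move: (enorm x) => r r0.
  have := mulr_ge0 G20 r0; have := mulr_ge0 Lw2 r0.
  by rewrite CvE !(mulrDl, mulrDr) => ? ? ? ? ? ?; apply/andP; split; lra.
have enQ (x : 'cV[R]_n) : 1 + enorm x <= 2 * (1 + fdot x x).
  rewrite -enorm_sqr; have := sqr_ge0 (enorm x - 1); have := sqr_ge0 (enorm x).
  rewrite !expr2; lra.
have cV : continuous_strip T (fun t x => V1 t x + V2 t x).
  move=> q; apply: cvgD; first exact: (supc_continuous Lw0 eps0 lW1 cW1).
  exact: (supc_continuous Lw0 eps0 lNW2 cNW2).
have gV t x : 0 <= t <= T -> V1 t x + V2 t x <= (G1 + Lw + Lw ^+ 2 + Cv) * (1 + enorm x).
  by move=> tT; rewrite mulrDl lerD ?V1g // (le_trans (ler_norm _)) // V2g.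
have Vts : mu <= V1 ts xs + V2 ts xs by rewrite lerD // ?V1ge // V2ge.
have [al [th [xh [al0 thT Vth Vle]]]] :=
  strip_max_quotient (ltW lam0) cV gV tsT (lt_le_trans mu0 Vts).
have {}al0 : a0 <= al.
  apply: le_trans al0; rewrite a0E ler_wpM2r // invr_ge0 ltW // mulr_gt0 //.
have alp : 0 < al by exact: lt_le_trans al0.
have /andP[th0 thT'] := thT.
(* At T the sup-convolutions exceed W1 and - W2 by O(eps) only, and W1 <= phi <= W2 there, which is
   incompatible with a quotient of at least a0. *)
have thlt : th < T.
  rewrite lt_neqAle thT' andbT; apply/eqP => thE.
  have TT : 0 <= T <= T by rewrite T0' lexx.
  have : a0 <= al * (1 + fdot xh xh) by rewrite (le_trans al0) // ler_peMr // ltW.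
  move: Vth; rewrite thE subrr mulr0 expR0 mulr1 => <-; apply/negP; rewrite -ltNge.
  apply: le_lt_trans eps3; exact: supc_pair_terminal.
have [M ME] : exists M, M = al * be th by eexists.
have M0 : 0 < M by rewrite ME mulr_gt0.
rewrite -/(be th) -ME in Vth.
have Vth_le y : V1 th y + V2 th y <= M * (1 + fdot y y) by rewrite ME; exact: Vle.
have [pE hK1 hK2] := @touching_slopes R n (V1 th) (V2 th) xh (slope eps W1 th xh)
   (slope eps NW2 th xh) (2 * eps)^-1 M
   (fun v => supc_paraboloid Lw0 eps0 lW1 cW1 xh v thT)
   (fun v => supc_paraboloid Lw0 eps0 lNW2 cNW2 xh v thT)
   Vth_le Vth.
have [r1 [C1 [r10 C10 j1]]] := sub_frozen_subjet lW1 cW1 sub1 eps0 theta0 thT hK1.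
have [r2 [C2 [r20 C20 j2]]] := super_frozen_subjet lW2 cW2 super2 eps0 theta0 thT hK2.
have [ka kaE] : exists ka, ka = frozen_err Lc Lw * eps + a0 / 4 by eexists.
have ka_le : 2 * ka <= a0.
  rewrite kaE -erE mulrDr.
  have -> : 2 * (er * eps) = 2^-1 * (4 * (er * eps)) by field.
  have -> : 2 * (a0 / 4) = 2^-1 * a0 by field.
  rewrite [leRHS](_ : _ = 2^-1 * a0 + 2^-1 * a0); last by field.
  by rewrite lerD2r ler_wpM2l // invr_ge0.
rewrite -kaE in j1 j2.
have [ce ceE] : exists ce, ce = C1 + C2 by eexists.
have C1ce : C1 <= ce by rewrite ceE lerDl.
have C2ce : C2 <= ce by rewrite ceE lerDr.
have ce0 : 0 <= ce by rewrite ceE addr_ge0.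
have [S SE] : exists S, S = sg * (1 + fdot xh xh) by eexists.
have S0 : 0 <= S by rewrite SE mulr_ge0 // ltW.
have cS0 : 0 <= 12 * ce * S by rewrite !mulr_ge0.
have cS1 : 0 < 12 * ce * S + 1 by rewrite ltr_wpDl.
(* The step stays within both freezing radii and below T; [lam * h0 <= 2^-1] keeps M and A within a
   factor 2, and the last condition makes the error from |x - xh|^2 negligible although [ce]
   contains 1 / eps. *)
have [h0 [h00 h0r1 h0r2 h0T [h0l h0e]]] : exists h0, [/\ 0 < h0, h0 <= r1, h0 <= r2,
    th + h0 <= T & lam * h0 <= 2^-1 /\ 12 * ce * S * h0 <= a0].
  exists (Num.min (Num.min r1 r2) (Num.min (T - th)
    (Num.min (2^-1 / lam) (a0 / (12 * ce * S + 1))))).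
  split.
  - by rewrite !lt_min r10 r20 subr_gt0 thlt !divr_gt0.
  - by rewrite !ge_min lexx.
  - by rewrite !ge_min lexx orbT.
  - by rewrite -lerBrDl !ge_min lexx !orbT.
  split; first by rewrite mulrC -ler_pdivlMr // !ge_min lexx !orbT.
  apply: (@le_trans _ _ ((12 * ce * S + 1) *
      Num.min (Num.min r1 r2) (Num.min (T - th) (Num.min (2^-1 / lam) (a0 / (12 * ce * S + 1)))))).
    by rewrite ler_wpM2r ?lerDl // !le_min !ltW // ?subr_gt0 // divr_gt0.
  by rewrite mulrC -ler_pdivlMr // !ge_min lexx !orbT.
have [A AE] : exists A, A = al * be (th + h0) by eexists.
have bE : be (th + h0) * expR (lam * h0) = be th.
  by rewrite /be -expRD; congr expR; ring.
have A0 : 0 < A by rewrite AE mulr_gt0.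
have AM : A * expR (lam * h0) = M by rewrite AE ME -bE mulrA.
have lh0 : 0 <= lam * h0 <= 2^-1 by rewrite h0l andbT mulr_ge0 // ltW.
have [MA M2A] := expR_half (ltW A0) lh0 AM.
have a0M : a0 <= M.
  rewrite ME (le_trans al0) // ler_peMr ?(ltW alp) //.
  by apply: le_trans (expR_ge1Dx _); rewrite lerDl mulr_ge0 ?(ltW lam0) ?subr_ge0.
have [Q QE] : exists Q, Q = 1 + fdot xh xh by eexists.
have Qp : 1 <= Q by rewrite QE.
(* For a common control the two frozen first order terms nearly cancel: what remains is their gap at
   the touching point and twice the freezing error. *)
pose D := 2 * ka + ga * (M * Q).
have hD (u : {u | U u}) :
  ft th xh (V1 th xh) (slope eps W1 th xh) (sval u) + ka +
  (- ft th xh (- V2 th xh) (- slope eps NW2 th xh) (sval u) + ka) <= D.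
  rewrite addrACA addrC /D [2 * ka]mulr_natl mulr2n lerD2l gaE QE.
  apply: (fterm_gap thT (svalP u) (ltW M0) Cv0 _ _ _ Vth pE).
  - exact: (slope_le Lw0 eps0 lW1 cW1 xh thT).
  - exact: (slope_le Lw0 eps0 lNW2 cNW2 xh thT).
  exact: V2g.
have fin : M * Q <= A * Q + h0 * (D + (A + 6 * ce * h0) * S).
  rewrite QE -Vth.
  apply: (@doubled_growth R n d T {u | U u} d0 (fun u => sigma th xh (sval u))
    (fun u => ft th xh (V1 th xh) (slope eps W1 th xh) (sval u) + ka)
    (fun u => - ft th xh (- V2 th xh) (- slope eps NW2 th xh) (sval u) + ka)
    S D ce Lw A th h0 xh V1 V2) => //.
  - by move=> [u Uu] /=; rewrite SE sgE sigma_sq_growth.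
  - exact: ltW.
  - by move=> t tT; exact: (supc_lip Lw0 eps0 lW1 cW1).
  - exact: (supc_continuous Lw0 eps0 lW1 cW1).
  - exact: (supc_continuous Lw0 eps0 lNW2 cNW2).
  - exists ((G1 + Lw + Lw ^+ 2) * 2) => t x tT; rewrite -mulrA (le_trans (V1g t x tT)) //.
    by rewrite ler_wpM2l // !addr_ge0.
  - exists (Cv * 2) => t x tT; rewrite -mulrA (le_trans (ler_norm _)) //.
    by rewrite (le_trans (V2g t x tT)) // ler_wpM2l.
  - by move=> [u Uu] /=; exact: j1.
  - exact: j2.
  have hT : 0 <= th + h0 <= T by rewrite h0T andbT addr_ge0 // ltW.
  by move=> x; rewrite AE; exact: Vle.
rewrite lamE in MA; rewrite -QE in SE.
by apply: (decay_rate_dominates A0 Qp h00 ga0 a00 a0M ka_le h0e SE M2A MA fin).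
Qed.

End Comparison.

Theorem theorem4p1 (R : realType) (T : R) (n d k : nat) (U : set 'cV[R]_k)
    (b : R -> 'cV[R]_n -> R -> 'rV[R]_d -> 'cV[R]_k -> 'cV[R]_n)
    (sigma : R -> 'cV[R]_n -> 'cV[R]_k -> 'M[R]_(n, d))
    (g : R -> 'cV[R]_n -> R -> 'rV[R]_d -> 'cV[R]_k -> R)
    (phi : 'cV[R]_n -> R)
    (T_gt0 : 0 < T) (n_gt0 : (0 < n)%N) (d_gt0 : (0 < d)%N) (k_gt0 : (0 < k)%N)
    (U_neq0 : U !=set0) (U_compact : compact U)
    (lip : lipschitz_condition T U b sigma g phi)
    (W1 W2 : R -> 'cV[R]_n -> R)
    (W1_cont : continuous_strip T W1) (W1_lip : lipschitz_in_x T W1)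
    (W2_cont : continuous_strip T W2) (W2_lip : lipschitz_in_x T W2)
    (W1_sol : viscosity_solution T U b sigma g phi W1)
    (W2_sol : viscosity_solution T U b sigma g phi W2) :
  forall (t : R) (x : 'cV[R]_n), 0 <= t <= T -> W1 t x = W2 t x.
Proof.
move=> t x tT; have [cc _] := lip.
have [Lc Lc0 lc] := lipschitz_condition_lip_coefs lip.
have [B B0 bdd] := coefs_bounded (ltW T_gt0) U_compact cc.
have [L1 l1] := W1_lip; have [L2 l2] := W2_lip.
(* A common nonnegative constant, so that the comparison can be applied in both directions. *)
pose Lw := Num.max `|L1| `|L2|.
have Lw0 : 0 <= Lw by rewrite le_max normr_ge0.
have lW1 s : 0 <= s <= T -> lipf Lw (W1 s).
  move=> sT y z; apply: le_trans (l1 s y z sT) _; rewrite ler_wpM2r ?enorm_ge0 //.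
  by rewrite le_max ler_norm.
have lW2 s : 0 <= s <= T -> lipf Lw (W2 s).
  move=> sT y z; apply: le_trans (l2 s y z sT) _; rewrite ler_wpM2r ?enorm_ge0 //.
  by rewrite le_max ler_norm orbT.
have [[sub1 super1] [sub2 super2]] := (W1_sol, W2_sol).
apply/eqP; rewrite eq_le.
rewrite (viscosity_comparison T_gt0 d_gt0 U_neq0 Lc0 Lw0 lc U_compact cc B0 bdd
  lW1 lW2 W1_cont W2_cont sub1 super2 _ tT).
exact: (viscosity_comparison T_gt0 d_gt0 U_neq0 Lc0 Lw0 lc U_compact cc B0 bdd
  lW2 lW1 W2_cont W1_cont sub2 super1 _ tT).
Qed.
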